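(* Let $0<\hat R<R$, let $n\ge 4$ be an integer, $\sigma>0$, $Q>0$ and $K>0$. Let $f\in\mathcal C_Q$ and let $u(x,k)$, $k>0$, be the solution of $$\Delta^2u(x,k)-k^2u(x,k)-\mathrm{i}k\sigma u(x,k)=f(x),\quad x\in\mathbb R^3.$$ Define $\epsilon\ge 0$ by $$\epsilon^2:=\int_0^K\|u(x,k)\|_{\partial B_R}^2\,\mathrm dk .$$ Then, for $\epsilon>0$ sufficiently small, the following estimate holds: $$\|f\|_{L^2(B_R)}^2\lesssim e^{C\sigma^2}\Big(\epsilon^2+\frac{Q^2}{K^{\frac12(n-3)}\,(\ln|\ln\epsilon|)^{\frac12(n-3)}}\Big).$$
   Context: $B_R=\{x\in\mathbb R^3:|x|<R\}$ with boundary $\partial B_R$; $\sigma>0$ is the damping coefficient. The class of sources is $\mathcal C_Q=\{f\in H^n(B_R): n\ge4,\ \|f\|_{H^n(B_R)}\le Q,\ \operatorname{supp} f\subset B_{\hat R}\subset B_R,\ f:B_R\to\mathbb R\}$, where $\hat R<R$; such $f$ is extended by zero to $\mathbb R^3$. For each $k>0$ the solution $u(\cdot,k)$ of the equation is the unique solution in the sense of tempered (Schwartz) distributions on $\mathbb R^3$; it belongs to $H^4(\mathbb R^3)$, decays exponentially at infinity, and is smooth near $\partial B_R$. The boundary data norm is $$\|u(x,k)\|_{\partial B_R}^2:=\int_{\partial B_R}\Big((k^4+k^2)|u(x,k)|^2+k^2|\nabla u(x,k)|^2+(k^2+1)|\Delta u(x,k)|^2+|\nabla\Delta u(x,k)|^2\Big)\,\mathrm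 ds(x).$$ The notation $a\lesssim b$ means $a\le C'b$ for a generic constant $C'>0$. Both $C'$ and the constant $C>0$ in the exponent are independent of $f,Q,K,\epsilon,\sigma$ (they may depend on $R,\hat R,n$). ''For $\epsilon$ sufficiently small'' means for $0<\epsilon<\epsilon_0$ with a threshold $\epsilon_0\in(0,e^{-1})$, which may depend on the fixed parameters $R,\hat R,n,\sigma,Q,K$. *)

(* Defs.v *)
From HB Require Import structures.
From mathcomp Require Import all_boot all_order all_algebra.
From mathcomp Require Import all_classical all_reals all_analysis.
From mathcomp Require Import complex.

Set Implicit Arguments.
Unset Strict Implicit.
Unset Printing Implicit Defensive.

Import Order.TTheory GRing.Theory Num.Theory.
Import numFieldNormedType.Exports.

Local Open Scope classical_set_scope.
Local Open Scope ring_scope.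
Local Open Scope complex_scope.

(* R^3 is the iterated product, so that the product Lebesgue measure and the
   product normed-space structure (used by 'D_v and differentiable) are those
   of the library.  The library's norm on products is the sup norm; the
   Euclidean one is enorm. *)
Notation pt3 R := (R * R * R)%type.
Notation leb3 R := ((@lebesgue_measure R \x @lebesgue_measure R)
                      \x @lebesgue_measure R)%E.

Definition enorm (R : realType) (x : pt3 R) : R :=
  Num.sqrt (x.1.1 ^+ 2 + x.1.2 ^+ 2 + x.2 ^+ 2).

Definition ball3 (R : realType) (r : R) : set (pt3 R) := [set x | enorm x < r].
Definition sphere3 (R : realType) (r : R) : set (pt3 R) := [set x | enorm x = r].

Definition basis3 (R : realType) (i : 'I_3) : pt3 R :=
  ((val i == 0%N)%:R, (val i == 1%N)%:R, (val i == 2%N)%:R).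

Definition cmod (R : realType) (z : R[i]) : R :=
  Num.sqrt (complex.Re z ^+ 2 + complex.Im z ^+ 2).

Definition cplx (R : realType) (f : pt3 R -> R) : pt3 R -> R[i] :=
  fun x => (f x)%:C.

(* Derivatives of complex-valued functions are taken componentwise, since R[i]
   is not a normed R-module in the library. *)
Definition partial3 (R : realType) (i : 'I_3) (g : pt3 R -> R[i]) :
    pt3 R -> R[i] :=
  fun x => 'D_(basis3 R i) (fun y => complex.Re (g y)) x
             +i* 'D_(basis3 R i) (fun y => complex.Im (g y)) x.

Definition laplacian (R : realType) (g : pt3 R -> R[i]) : pt3 R -> R[i] :=
  fun x => \sum_(i < 3) partial3 i (partial3 i g) x.

Definition multi_order (a : 'I_3 -> nat) : nat := (\sum_(i < 3) a i)%N.

Definition partial_multi (R : realType) (a : 'I_3 -> nat) (g : pt3 R -> R[i]) :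
    pt3 R -> R[i] :=
  foldr (fun i h => iter (a i) (partial3 i) h) g (enum 'I_3).

(* C^oo on the open set U: every iterated partial derivative, in any order of
   differentiation, exists and is differentiable (hence continuous) on U. *)
Definition smooth_on (R : realType) (U : set (pt3 R)) (g : pt3 R -> R[i]) :=
  forall (s : seq 'I_3) (x : pt3 R), U x ->
    differentiable (fun y => complex.Re (foldr (@partial3 R) g s y)) x /\
    differentiable (fun y => complex.Im (foldr (@partial3 R) g s y)) x.

Definition cintegral (R : realType) (D : set (pt3 R)) (g : pt3 R -> R[i]) :
    R[i] :=
  (\int[leb3 R]_(x in D) complex.Re (g x))
    +i* (\int[leb3 R]_(x in D) complex.Im (g x)).

Definition L2norm2 (R : realType) (D : set (pt3 R)) (g : pt3 R -> R[i]) :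
    \bar R :=
  (\int[leb3 R]_(x in D) (cmod (g x) ^+ 2)%:E)%E.

Definition in_L2 (R : realType) (D : set (pt3 R)) (g : pt3 R -> R[i]) :=
  [/\ measurable_fun D (fun x => complex.Re (g x)),
      measurable_fun D (fun x => complex.Im (g x)) &
      (L2norm2 D g < +oo)%E].

Definition test_fun (R : realType) (U : set (pt3 R)) (phi : pt3 R -> R[i]) :=
  [/\ smooth_on setT phi,
      compact (closure [set x | phi x != 0]) &
      closure [set x | phi x != 0] `<=` U].

Definition is_weak_deriv (R : realType) (U : set (pt3 R)) (a : 'I_3 -> nat)
    (g h : pt3 R -> R[i]) :=
  [/\ in_L2 U g, in_L2 U h &
    forall phi, test_fun U phi ->
      cintegral U (fun x => g x * partial_multi a phi x) =
      (- 1) ^+ multi_order a * cintegral U (fun x => h x * phi x)].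

Definition weak_deriv (R : realType) (U : set (pt3 R)) (a : 'I_3 -> nat)
    (g : pt3 R -> R[i]) : pt3 R -> R[i] :=
  xget (fun=> 0) [set h | is_weak_deriv U a g h].

Definition in_sobolev (R : realType) (n : nat) (U : set (pt3 R))
    (g : pt3 R -> R[i]) :=
  forall a : 'I_3 -> nat, (multi_order a <= n)%N ->
    exists h, is_weak_deriv U a g h.

(* Meaningful when in_sobolev n U g holds: the weak derivatives are then
   determined almost everywhere, so the choice made by weak_deriv is immaterial. *)
Definition sobolev_norm (R : realType) (n : nat) (U : set (pt3 R))
    (g : pt3 R -> R[i]) : \bar R :=
  sqrte (\sum_(a : {ffun 'I_3 -> 'I_n.+1} | (multi_order (val \o a) <= n)%N)
           L2norm2 U (weak_deriv U (val \o a) g))%E.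

Definition extend0 (R : realType) (r : R) (f : pt3 R -> R) : pt3 R -> R :=
  patch (fun=> 0) (ball3 r) f.

(* Only the restriction of f to ball3 r matters. *)
Definition source_class (R : realType) (rhat r : R) (n : nat) (Q : R)
    (f : pt3 R -> R) :=
  [/\ in_sobolev n (ball3 r) (cplx f),
      (sobolev_norm n (ball3 r) (cplx f) <= Q%:E)%E &
      closure [set x | extend0 r f x != 0] `<=` ball3 rhat].

Definition schwartz (R : realType) (phi : pt3 R -> R[i]) :=
  smooth_on setT phi /\
  forall (m : nat) (s : seq 'I_3), exists M : R, forall x,
    (1 + enorm x) ^+ m * cmod (foldr (@partial3 R) phi s x) <= M.

(* The operator has even order, so it is its own transpose. *)
Definition biharmonic_op (R : realType) (sigma k : R) (phi : pt3 R -> R[i]) :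
    pt3 R -> R[i] :=
  fun x => laplacian (laplacian phi) x - (k ^+ 2)%:C * phi x
           - (0 +i* (k * sigma)) * phi x.

Definition tempered_sol (R : realType) (sigma k : R) (F v : pt3 R -> R[i]) :=
  forall phi, schwartz phi ->
    cintegral setT (fun x => v x * biharmonic_op sigma k phi x) =
    cintegral setT (fun x => F x * phi x).

(* v is the function representing the unique tempered-distribution solution.  The
   H^4 and decay clauses are known properties of that solution; the smoothness
   clause moreover fixes the pointwise values of v near the sphere, which the
   boundary data need. *)
Definition is_solution (R : realType) (r sigma k : R) (f : pt3 R -> R)
    (v : pt3 R -> R[i]) :=
  [/\ tempered_sol sigma k (cplx (extend0 r f)) v,
      in_sobolev 4 setT v,
      exists M c : R, 0 < c /\
        {ae leb3 R, forall x, cmod (v x) <= M * expR (- c * enorm x)} &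
      exists2 U : set (pt3 R), open U & sphere3 r `<=` U /\ smooth_on U v].

Definition sphere_pt (R : realType) (r theta phi : R) : pt3 R :=
  (r * sin theta * cos phi, r * sin theta * sin phi, r * cos theta).

(* Surface integral over sphere3 r, with ds = r^2 sin(theta) dphi dtheta. *)
Definition sphere_integral (R : realType) (r : R) (g : pt3 R -> R) : \bar R :=
  (\int[@lebesgue_measure R]_(theta in `[0%R, pi])
     \int[@lebesgue_measure R]_(phi in `[0%R, (2 * pi)%R])
       (g (sphere_pt r theta phi) * (r ^+ 2 * sin theta))%:E)%E.

Definition grad_norm2 (R : realType) (g : pt3 R -> R[i]) (x : pt3 R) : R :=
  \sum_(i < 3) cmod (partial3 i g x) ^+ 2.

Definition boundary_norm2 (R : realType) (r k : R) (v : pt3 R -> R[i]) :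
    \bar R :=
  sphere_integral r (fun x =>
    (k ^+ 4 + k ^+ 2) * cmod (v x) ^+ 2
    + k ^+ 2 * grad_norm2 v x
    + (k ^+ 2 + 1) * cmod (laplacian v x) ^+ 2
    + grad_norm2 (laplacian v) x).

(* Main.v *)
(* If s^4 = k^2 + i k sigma and |d| = 1, the plane wave w = exp(i s d.x) solves
   Laplace^2 w = s^4 w.  Testing the equation against w, cut off across the
   sphere, and applying Green's identity bounds the transform
   F(s) = int f exp(i s d.x) by the boundary data at the wavenumber k.  A
   pigeonhole argument gives n well separated wavenumbers in [K/2, K] at which
   these data are O(sqrt(n) eps).  Since F is entire of exponential type,
   Lagrange interpolation at the corresponding roots s_j, with Taylor's formula
   for the remainder, controls F on the real interval [0, T] by
   exp(C T^3) eps + exp(-T) as soon as n is of order T^2.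
   The cosine coefficients of f on the cube of half-side r are values of F at
   real s.  Those of index at most M are controlled by the interpolation with T
   of order M, the others decay like M^-4 because f has four weak derivatives;
   hence ||f||^2 <= exp(a M^3) eps^2 + A / M for all M.  With M = y^(n+1) and
   y = ln |ln eps| the first term is at most exp(- exp y) for small eps, and
   the second beats the power (n-3)/2 of y.  As a, A may depend on Q, K and
   sigma, so may the threshold eps0, and this makes C' = C = 1 admissible. *)

Require Import Defs.
From HB Require Import structures.
From mathcomp Require Import all_boot all_order all_algebra.
From mathcomp Require Import all_classical all_reals all_analysis.
From mathcomp Require Import measurable_realfun complex ring lra.

Set Implicit Arguments.
Unset Strict Implicit.
Unset Printing Implicit Defensive.

Import Order.TTheory GRing.Theory Num.Theory.
Import numFieldNormedType.Exports.

Local Open Scope classical_set_scope.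
Local Open Scope ring_scope.

(** * Smooth functions and cutoffs *)

Section PartialDerivatives.
Variable R : realType.
Implicit Types (U : set (pt3 R)) (g h : pt3 R -> R) (i : 'I_3) (x : pt3 R).

(** The equation holds only against Schwartz functions, and the solution is controlled pointwise
    only near the sphere, so no Green formula on the ball is available. The wave is cut off in a
    shell of thickness of order [e], and Green's identity is arranged to leave a single derivative
    of the cutoff: its size [1 / e] is compensated by the volume of the shell. Hence [e] may depend
    on the solution while the constant does not. The powers of [k] in the boundary data are bounded
    below only away from 0, which is why wavenumbers below [K / 2] are discarded. The number of
    nodes comes from one quotient. For [n] nodes the Lagrange weights have size [(C T)^n] and the
    Taylor remainder [(C T)^n / n!], so their product behaves like [(C T^2 / n)^n] and is tiny once
    [n] exceeds a multiple of [T^2]. The weights alone then cost [exp (C n T)], the cubic exponent.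
    Decay of order 4 in dimension 3 makes the cosine series converge uniformly. Its limit is [f]
    because the cosines are complete, which rests on Dynkin's argument and on polynomials in one
    cosine. *)

Definition pd i g : pt3 R -> R := fun x => 'D_(basis3 R i) g x.

(** A finite order turns closure under sums, products and composition into an induction on [N];
    [smooth_on], which quantifies over lists of directions, is recovered in [smooth_onP]. Order 0
    already asks for differentiability. *)
Fixpoint smn (N : nat) U g : Prop :=
  (forall x, U x -> differentiable g x) /\
  (if N is N'.+1 then forall i, smn N' U (pd i g) else True).

Definition sm U g := forall N, smn N U g.

Lemma smn_diff N U g x : smn N U g -> U x -> differentiable g x.
Proof. by case: N => [|N] [H _]; apply: H. Qed.

Lemma smn_pred N U g : smn N.+1 U g -> smn N U g.
Proof.
elim: N g => [|N IH] g [H1 H2]; split => //= i.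
by apply: IH; apply: H2.
Qed.

Lemma sm_pd U g i : sm U g -> sm U (pd i g).
Proof. by move=> H N; have [_] := H N.+1; apply. Qed.

Lemma sm_diff U g x : sm U g -> U x -> differentiable g x.
Proof. by move=> H; apply: (smn_diff (H 0%N)). Qed.

Lemma eq_near_pd i g h x : (\near x, g x = h x) -> pd i g x = pd i h x.
Proof. exact: near_eq_derive. Qed.

Lemma eq_on_pd U i g h : open U -> (forall x, U x -> g x = h x) ->
  forall x, U x -> pd i g x = pd i h x.
Proof.
move=> oU gh x Ux; apply: eq_near_pd; near=> y; apply: gh.
by near: y; apply: open_nbhs_nbhs; split.
Unshelve. all: by end_near. Qed.

(** Such a function is negligible against the increment, so the zero map is its differential.
    Locality of differentiability follows from this case by subtraction. *)
Lemma near0_differentiable (V W : normedModType R) (k : V -> W) (x : V) :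
  (\near x, k x = 0) -> differentiable k x.
Proof.
move=> k0.
have H : continuous (\0 : V -> W) /\
    k \o shift x = cst (k x) + (\0 : V -> W) +o_ 0 id.
  split; first exact: cst_continuous.
  apply/eqaddoE; rewrite addr0 (nbhs_singleton k0).
  have -> : k \o shift x = [o_ 0 id of k \o shift x]; last by rewrite add0r.
  apply/eqoP => _/posnumP[e] /=.
  move: k0; rewrite [X in X -> _](near_shift 0) subr0 => k0.
  near=> y; rewrite (_ : k (y + x) = 0) ?normr0 ?mulr_ge0//.
  by near: y.
apply/diff_locallyP; have -> := (diff_unique H.1 H.2); exact: H.
Unshelve. all: by end_near. Qed.

Lemma near_eq_differentiable g h x : (\near x, g x = h x) ->
  differentiable g x -> differentiable h x.
Proof.
move=> gh dg; have -> : h = g + (h - g) by apply/funext => y /=; rewrite !fctE addrC subrK.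
apply: differentiableD => //; apply: near0_differentiable.
by near=> y; rewrite !fctE (_ : g y = h y) ?subrr//; near: y.
Unshelve. all: by end_near. Qed.

Lemma smn_ext N U g h : open U -> (forall x, U x -> g x = h x) ->
  smn N U g -> smn N U h.
Proof.
move=> oU; elim: N g h => [|N IH] g h gh sg; split => //; have dg := sg.1.
- move=> x Ux; apply: (near_eq_differentiable _ (dg _ Ux)).
  by near=> y; apply: gh; near: y; apply: open_nbhs_nbhs; split.
- by move=> x Ux; apply: (near_eq_differentiable _ (dg _ Ux));
    near=> y; apply: gh; near: y; apply: open_nbhs_nbhs; split.
- by move=> i; apply: (IH (pd i g)); [move=> x; exact: eq_on_pd|exact: sg.2].
Unshelve. all: by end_near. Qed.

Lemma pdD i g h x : differentiable g x -> differentiable h x ->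
  pd i (g \+ h) x = pd i g x + pd i h x.
Proof.
by move=> dg dh; rewrite /pd deriveD//; apply: diff_derivable.
Qed.

Lemma pdM i g h x : differentiable g x -> differentiable h x ->
  pd i (g \* h) x = pd i g x * h x + g x * pd i h x.
Proof.
move=> dg dh; rewrite /pd deriveM//; try exact: diff_derivable.
by rewrite addrC [h x *: _]mulrC.
Qed.

Lemma pd_cst i (c : R) x : pd i (fun=> c) x = 0.
Proof. exact: derive_cst. Qed.

Lemma pd_comp i g (h : R -> R) (h' : R) x : differentiable g x ->
  is_derive (g x) 1 h h' -> pd i (h \o g) x = h' * pd i g x.
Proof.
move=> dg [dh <-].
have dh' : differentiable h (g x) by apply/derivable1_diffP.
rewrite /pd deriveE; last exact: differentiable_comp.
rewrite diff_comp// deriveE//= diff1E// derive1E -deriveE// scale1r.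
exact: mulrC.
Qed.


Lemma smnD N U g h : open U -> smn N U g -> smn N U h -> smn N U (g \+ h).
Proof.
move=> oU; elim: N g h => [|N IH] g h sg sh.
  by split => // x Ux; apply: differentiableD; [apply: sg.1|apply: sh.1].
split=> [x Ux|i]; first by apply: differentiableD; [apply: sg.1|apply: sh.1].
apply: (@smn_ext N U (pd i g \+ pd i h)) => //.
  by move=> x Ux; rewrite pdD//; [apply: sg.1|apply: sh.1].
by apply: IH; [apply: sg.2|apply: sh.2].
Qed.

Lemma smnM N U g h : open U -> smn N U g -> smn N U h -> smn N U (g \* h).
Proof.
move=> oU; elim: N g h => [|N IH] g h sg sh.
  by split => // x Ux; apply: differentiableM; [apply: sg.1|apply: sh.1].
split=> [x Ux|i]; first by apply: differentiableM; [apply: sg.1|apply: sh.1].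
apply: (@smn_ext N U ((pd i g \* h) \+ (g \* pd i h))) => //.
  by move=> x Ux; rewrite pdM//; [apply: sg.1|apply: sh.1].
apply: smnD => //.
  by apply: IH; [apply: sg.2|apply: smn_pred].
by apply: IH; [apply: smn_pred|apply: sh.2].
Qed.

Lemma smn_cst N U (c : R) : smn N U (fun=> c).
Proof.
elim: N c => [|N IH] c; split => //=.
  by move=> i; have -> : pd i (fun=> c) = fun=> 0; [apply/funext => x; apply: pd_cst|apply: IH].
Qed.

Lemma sm_ext U g h : open U -> (forall x, U x -> g x = h x) ->
  sm U g -> sm U h.
Proof. by move=> oU gh sg N; apply: (smn_ext oU gh); apply: sg. Qed.

Lemma smD U g h : open U -> sm U g -> sm U h -> sm U (g \+ h).
Proof. by move=> oU sg sh N; apply: smnD. Qed.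

Lemma smM U g h : open U -> sm U g -> sm U h -> sm U (g \* h).
Proof. by move=> oU sg sh N; apply: smnM. Qed.

Lemma sm_cst U (c : R) : sm U (fun=> c).
Proof. by move=> N; apply: smn_cst. Qed.

Lemma smZ U (c : R) g : open U -> sm U g -> sm U (fun x => c * g x).
Proof. by move=> oU sg; apply: (@smM U (fun=> c) g) => //; apply: sm_cst. Qed.

Lemma smN U g : open U -> sm U g -> sm U (fun x => - g x).
Proof.
move=> oU /(smZ (-1) oU); apply: sm_ext => // x _; exact: mulN1r.
Qed.

Lemma smB U g h : open U -> sm U g -> sm U h -> sm U (fun x => g x - h x).
Proof. by move=> oU sg sh; apply: (@smD U g (fun x => - h x)) => //; apply: smN. Qed.

(** The functions [h a] form a family that differentiation maps into itself, the index moving by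
    [d]. The chain rule then keeps every derivative within products of such members and derivatives
    of [q], and no formula for higher derivatives is needed. *)
Lemma sm_comp (A : Type) (h : A -> R -> R) (d : A -> A) (V : set R) U q a :
  (forall a t, V t -> is_derive t 1 (h a) (h (d a) t)) ->
  open U -> (forall x, U x -> V (q x)) -> sm U q -> sm U (h a \o q).
Proof.
move=> hd oU UV sq N; elim: N a => [|N IH] a.
  split=> // x Ux; apply: differentiable_comp; first exact: sm_diff sq Ux.
  by apply/derivable1_diffP; case: (hd a _ (UV _ Ux)).
split=> [x Ux|i].
  apply: differentiable_comp; first exact: sm_diff sq Ux.
  by apply/derivable1_diffP; case: (hd a _ (UV _ Ux)).
apply: (@smn_ext N U ((h (d a) \o q) \* pd i q)) => //.
  move=> x Ux; rewrite (pd_comp _ (sm_diff sq Ux) (hd _ _ (UV _ Ux)))//.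
by apply: smnM => //; apply: sm_pd.
Qed.

Definition coord3 (i : 'I_3) (x : pt3 R) : R :=
  if val i == 0%N then x.1.1 else if val i == 1%N then x.1.2 else x.2.

Lemma coord3_is_linear i : linear (coord3 i).
Proof. by move=> a x y; rewrite /coord3; case: ifP => _; [|case: ifP => _]. Qed.

HB.instance Definition _ i := GRing.isLinear.Build R (pt3 R) R _ (coord3 i)
  (coord3_is_linear i).

Lemma coord3_continuous i : continuous (coord3 i).
Proof.
case: i => [[|[|[|//]]] ?] x.
- exact: (cvg_comp _ _ cvg_fst cvg_fst).
- exact: (cvg_comp _ _ cvg_fst cvg_snd).
- exact: cvg_snd.
Qed.

Lemma coord3_differentiable i x : differentiable (coord3 i) x.
Proof. by apply: linear_differentiable; apply: coord3_continuous. Qed.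

Lemma pd_coord3 i j x : pd i (coord3 j) x = (i == j)%:R.
Proof.
rewrite /pd deriveE; last exact: coord3_differentiable.
rewrite diff_lin; last exact: coord3_continuous.
by case: i j => [[|[|[|//]]] ?] [[|[|[|//]]] ?].
Qed.

Lemma sm_coord3 U j : sm U (coord3 j).
Proof.
have dc x : U x -> differentiable (coord3 j) x by move=> _; exact: coord3_differentiable.
move=> [|N]; split => //= i.
have -> : pd i (coord3 j) = fun=> (i == j)%:R by apply/funext => x; exact: pd_coord3.
exact: smn_cst.
Qed.

Lemma sm_expR U q : open U -> sm U q -> sm U (expR \o q).
Proof.
by move=> oU sq; apply: (@sm_comp unit (fun=> expR) id setT U q tt).
Qed.

(** Differentiation acts on [a sin + b cos] by [(a, b) -> (- b, a)], so this two-parameter family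
    fits [sm_comp]. *)
Lemma sm_trig U (ab : R * R) q : open U -> sm U q ->
  sm U ((fun t => ab.1 * sin t + ab.2 * cos t) \o q).
Proof.
move=> oU sq; apply: (@sm_comp _ (fun ab t => ab.1 * sin t + ab.2 * cos t)
  (fun ab => (- ab.2, ab.1)) setT U q ab) => // a t _ /=.
apply: is_derive_eq.
by rewrite /GRing.scale/=; ring.
Qed.

Lemma sm_sin U q : open U -> sm U q -> sm U (sin \o q).
Proof.
by move=> oU /(sm_trig (1, 0) oU); apply: sm_ext => // x _ /=; rewrite mul1r mul0r addr0.
Qed.

Lemma sm_cos U q : open U -> sm U q -> sm U (cos \o q).
Proof.
by move=> oU /(sm_trig (0, 1) oU); apply: sm_ext => // x _ /=; rewrite mul1r mul0r add0r.
Qed.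

(** The family is [c * t^-n], and differentiation sends the index [(c, n)] to [(- c * n, n + 1)]. *)
Lemma sm_inv U q : open U -> sm U q -> (forall x, U x -> q x != 0) ->
  sm U (fun x => (q x)^-1).
Proof.
move=> oU sq q0.
have := @sm_comp (R * nat) (fun a t => a.1 * (t^-1) ^+ a.2)
  (fun a => (- a.1 * a.2%:R, a.2.+1)) [set t | t != 0] U q (1, 1%N).
move=> /(_ _ oU q0 sq) H; apply: (sm_ext oU _ (H _)).
  by move=> x Ux /=; rewrite mul1r expr1.
move=> [c n] t /= t0.
have dV : is_derive t 1 (fun y : R => y^-1) (- t ^- 2).
  split; first by apply: derivableV => //; exact: derivable_id.
  rewrite (@deriveV _ _ id)//.
  by rewrite derive_id /GRing.scale/= mulr1.
rewrite (_ : (fun _ => _) = c *: ((fun y : R => y^-1) ^+ n)); last first.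
  by apply/funext => y; rewrite fctE.
apply: is_derive_eq; rewrite ?scaler0 ?addr0 /GRing.scale/=.
case: n => [|n]; first by rewrite /= !(mulr0, mul0r).
by rewrite /= !exprVn !exprS; field; rewrite t0 expf_neq0.
Qed.

(** The difference quotient at 0 is at most [C * |t|]. This settles the only point where the two
    branches of [flat] are glued. *)
Lemma bounded_quadratic_derive0 (h : R -> R) (C : R) :
  h 0 = 0 -> (forall t, `|h t| <= C * t ^+ 2) -> is_derive (0 : R) 1 h 0.
Proof.
move=> h0 hC.
have H : (fun e : R => e^-1 *: (h (e *: (1 : R) + 0) - h 0)) e @[e --> 0^'] --> (0 : R).
  have C0 : 0 <= C by have := le_trans (normr_ge0 _) (hC 1); rewrite expr1n mulr1.
  apply/cvgr0Pnorm_lt => /= eps eps0; near=> e.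
  have e0 : e != 0 by near: e; exact: nbhs_dnbhs_neq.
  rewrite h0 subr0 addr0 /GRing.scale/= mulr1 normrM normfV.
  rewrite mulrC ltr_pdivrMr ?normr_gt0//.
  apply: (le_lt_trans (hC e)); rewrite -real_normK ?num_real// expr2 mulrA.
  rewrite ltr_pM2r ?normr_gt0//.
  apply: (@le_lt_trans _ _ ((C + 1) * `|e|)); first by rewrite ler_wpM2r// lerDl.
  rewrite mulrC -ltr_pdivlMr ?ltr_wpDl//.
  near: e; apply: dnbhs0_lt; rewrite divr_gt0 ?ltr_wpDl//.
by split; [apply/cvg_ex; exists 0|apply: cvg_lim].
Unshelve. all: by end_near. Qed.

(** From [u / n <= expR (u / n)], raised to the power [n]. *)
Lemma expr_le_expR (n : nat) (u : R) : 0 <= u -> u ^+ n <= n%:R ^+ n * expR u.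
Proof.
case: n => [|n] u0; first by rewrite !expr0 mul1r (le_trans _ (expR_ge1Dx _))// lerDl.
have n0 : 0 < n.+1%:R :> R by rewrite ltr0n.
have -> : expR u = expR (u / n.+1%:R) ^+ n.+1.
  by rewrite -expRM_natr divfK ?gt_eqF.
rewrite -exprMn lerXn2r ?nnegrE ?mulr_ge0 ?expR_ge0//.
rewrite mulrC -ler_pdivrMr// (le_trans _ (expR_ge1Dx _))// lerDr//.
Qed.

Lemma horner_le_expR (p : {poly R}) :
  exists2 C : R, 0 <= C & forall u, 0 <= u -> `|p.[u]| <= C * expR u.
Proof.
exists (\sum_(i < size p) `|p`_i| * i%:R ^+ i); first by apply: sumr_ge0 => i _; rewrite mulr_ge0.
move=> u u0; rewrite horner_coef (le_trans (ler_norm_sum _ _ _))// mulr_suml.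
apply: ler_sum => i _; rewrite normrM -mulrA ler_wpM2l//.
by rewrite ger0_norm ?exprn_ge0// expr_le_expR.
Qed.

(* Functions p(1/t) exp(-1/t) on t > 0, extended by 0, are closed under
   differentiation: the derivative of flat p is flat (flat_next p). *)
Definition flat (p : {poly R}) (t : R) : R :=
  if 0 < t then p.[t^-1] * expR (- t^-1) else 0.

Definition flat_next (p : {poly R}) : {poly R} := 'X^2 * (p - p^`()).

(** With [u = t^-1] the claim is that [u^2 p(u) exp(-u)] is bounded, which is [horner_le_expR] for
    the polynomial [p * 'X^2]. *)
Lemma flat_bound (p : {poly R}) : exists C, forall t, `|flat p t| <= C * t ^+ 2.
Proof.
have [C C0 HC] := horner_le_expR (p * 'X^2).
exists C => t; rewrite /flat; case: ifPn => [t0|_]; last first.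
  by rewrite normr0 mulr_ge0// sqr_ge0.
rewrite normrM (ger0_norm (expR_ge0 _)) expRN.
rewrite ler_pdivrMr ?expR_gt0// -mulrA mulrC -mulrA.
have := HC t^-1; rewrite invr_ge0 ltW// => /(_ isT).
rewrite hornerM hornerXn normrM => H.
rewrite -(ler_pM2r (_ : 0 < `|t^-1 ^+ 2|)); last by rewrite normr_gt0 expf_neq0// invr_eq0 gt_eqF.
apply: (le_trans H); rewrite ger0_norm ?exprn_ge0 ?invr_ge0 ?(ltW t0)//.
rewrite exprVn le_eqVlt; apply/orP; left; apply/eqP; field.
by rewrite gt_eqF.
Qed.

Lemma flat_derive (p : {poly R}) (t : R) : is_derive t 1 (flat p) (flat (flat_next p) t).
Proof.
have [t0|t0|->] := ltgtP t 0; last first.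
- have [C HC] := flat_bound p.
  rewrite {2}/flat ltxx; apply: (bounded_quadratic_derive0 _ HC).
  by rewrite /flat ltxx.
- have dV : is_derive t 1 (fun y : R => y^-1) (- t ^- 2).
    split; first by apply: derivableV; rewrite ?gt_eqF//; exact: derivable_id.
    by rewrite (@deriveV _ _ id) ?gt_eqF// derive_id /GRing.scale/= mulr1.
  have E : is_derive t 1 (fun y => p.[y^-1] * expR (- y^-1))
      (flat (flat_next p) t).
    have dp : is_derive t 1 (fun y : R => p.[y^-1]) (p^`().[t^-1] * (- t ^- 2)).
      exact: (@is_derive1_comp _ (horner p) (fun y : R => y^-1)).
    have de : is_derive t 1 (fun y : R => expR (- y^-1)) (expR (- t^-1) * t ^- 2).
      apply: (@is_derive1_comp _ expR (fun y : R => - y^-1)).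
      by rewrite -[X in is_derive _ _ _ X]opprK; exact: is_deriveN.
    apply: (@is_derive_eq _ _ _ _ _ _ _ _ (is_deriveM dp de)).
    rewrite /flat t0 /flat_next hornerM hornerXn !hornerE /GRing.scale/= exprVn.
    by ring.
  apply: near_eq_is_derive E; near=> y; rewrite /flat ifT//.
  by near: y; exact: lt_nbhsr.
- rewrite {2}/flat ltNge (ltW t0)/=.
  have E : is_derive t 1 (fun=> 0 : R) 0 by exact: is_derive_cst.
  apply: near_eq_is_derive E; near=> y; rewrite /flat ltNge ltW//.
  by near: y; exact: lt_nbhsl.
Unshelve. all: by end_near. Qed.

(* A smooth step: 0 for t <= 0 and 1 for t >= 1. *)
Definition stp (t : R) : R := flat 1 t / (flat 1 t + flat 1 (1 - t)).

Lemma flat1_ge0 t : 0 <= flat 1 t.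
Proof. by rewrite /flat; case: ifP => // _; rewrite hornerE mul1r expR_ge0. Qed.

Lemma flat1_gt0 t : 0 < t -> 0 < flat 1 t.
Proof. by rewrite /flat => ->; rewrite hornerE mul1r expR_gt0. Qed.

Lemma flat1_eq0 t : t <= 0 -> flat 1 t = 0.
Proof. by rewrite /flat ltNge => ->. Qed.

Lemma stp_den_gt0 t : 0 < flat 1 t + flat 1 (1 - t).
Proof.
have [t0|t0] := ltP 0 t; first by rewrite ltr_pwDl// ?flat1_gt0// flat1_ge0.
by rewrite ltr_wpDl ?flat1_ge0// flat1_gt0// subr_gt0 (le_lt_trans t0).
Qed.

Lemma stp0 t : t <= 0 -> stp t = 0.
Proof. by move=> t0; rewrite /stp flat1_eq0// mul0r. Qed.

Lemma stp1 t : 1 <= t -> stp t = 1.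
Proof.
move=> t1; rewrite /stp [flat 1 (1 - t)]flat1_eq0 ?subr_le0// addr0 divff// gt_eqF//.
by rewrite flat1_gt0// (lt_le_trans _ t1).
Qed.

Lemma stp_ge0 t : 0 <= stp t.
Proof. by rewrite divr_ge0 ?flat1_ge0// ltW// stp_den_gt0. Qed.

Lemma stp_le1 t : stp t <= 1.
Proof. by rewrite ler_pdivrMr ?stp_den_gt0// mul1r lerDl flat1_ge0. Qed.

Lemma sm_flat U p q : open U -> sm U q -> sm U (flat p \o q).
Proof.
move=> oU sq; apply: (@sm_comp _ flat flat_next setT U q p) => // a t _.
exact: flat_derive.
Qed.

Lemma sm_stp U q : open U -> sm U q -> sm U (stp \o q).
Proof.
move=> oU sq; have s1 := sm_flat 1 oU sq.
have s2 : sm U (fun x => flat 1 (1 - q x)).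
  by apply: (@sm_flat U 1 (fun x => 1 - q x)) => //; apply: smB => //; apply: sm_cst.
apply: (@smM U (flat 1 \o q) (fun x => (flat 1 (q x) + flat 1 (1 - q x))^-1)) => //.
apply: sm_inv => //; first exact: smD.
by move=> x _; rewrite gt_eqF// stp_den_gt0.
Qed.

End PartialDerivatives.

(** * Complex-valued functions by components, cubes, Schwartz functions *)

Section ComplexCalculus.
Variable R : realType.
Implicit Types (U : set (pt3 R)) (f g h : pt3 R -> R[i]) (i : 'I_3).

Definition csm U g := sm U (fun x => complex.Re (g x)) /\
                      sm U (fun x => complex.Im (g x)).

Definition cdiff g (x : pt3 R) := differentiable (fun x => complex.Re (g x)) x /\
                      differentiable (fun x => complex.Im (g x)) x.

Lemma csm_cdiff U g x : csm U g -> U x -> cdiff g x.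
Proof. by move=> [h1 h2] Ux; split; [apply: sm_diff h1 Ux|apply: sm_diff h2 Ux]. Qed.

Lemma csm_partial3 U g i : csm U g -> csm U (partial3 i g).
Proof. by move=> [h1 h2]; split; apply: sm_pd. Qed.

Lemma csm_foldr U g s : csm U g -> csm U (foldr (@partial3 R) g s).
Proof. by move=> sg; elim: s => //= i s; apply: csm_partial3. Qed.

(** In [foldr] the derivative taken first is the last entry of the list; for this reason the
    induction on the order passes through [rcons]. *)
Lemma smooth_onP U g : smooth_on U g <-> csm U g.
Proof.
split=> [sg|sg s x Ux]; last exact: csm_cdiff (csm_foldr s sg) Ux.
have key N : forall g, (forall (s : seq 'I_3) (x : pt3 R), U x ->
    cdiff (foldr (@partial3 R) g s) x) ->
    smn N U (fun x => complex.Re (g x)) /\ smn N U (fun x => complex.Im (g x)).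
  elim: N => [|N IH] h sh.
    by split; split => // x Ux; have [] := sh [::] x Ux.
  have H i : smn N U (pd i (fun x => complex.Re (h x))) /\
             smn N U (pd i (fun x => complex.Im (h x))).
    by apply: (IH (partial3 i h)) => s x Ux; have := sh (rcons s i) x Ux; rewrite foldr_rcons.
  by split; split => [x Ux|i]; by [have [] := sh [::] x Ux | have [] := H i].
by split=> N; have [] := key N g sg.
Qed.

Lemma csm_ext U g h : open U -> (forall x, U x -> g x = h x) -> csm U g -> csm U h.
Proof.
by move=> oU gh [sr si]; split; [apply: sm_ext sr|apply: sm_ext si] => // x Ux /=; rewrite gh.
Qed.

Lemma ReD (a b : R[i]) : complex.Re (a + b) = complex.Re a + complex.Re b.
Proof. by case: a b => [? ?] [? ?]. Qed.
Lemma ImD (a b : R[i]) : complex.Im (a + b) = complex.Im a + complex.Im b.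
Proof. by case: a b => [? ?] [? ?]. Qed.
Lemma ReN (a : R[i]) : complex.Re (- a) = - complex.Re a.
Proof. by case: a. Qed.
Lemma ImN (a : R[i]) : complex.Im (- a) = - complex.Im a.
Proof. by case: a. Qed.
Lemma ReM (a b : R[i]) : complex.Re (a * b) =
  complex.Re a * complex.Re b - complex.Im a * complex.Im b.
Proof. by case: a b => [? ?] [? ?]. Qed.
Lemma ImM (a b : R[i]) : complex.Im (a * b) =
  complex.Re a * complex.Im b + complex.Im a * complex.Re b.
Proof. by case: a b => [? ?] [? ?]. Qed.
Lemma complex_eq (a b : R[i]) : complex.Re a = complex.Re b ->
  complex.Im a = complex.Im b -> a = b.
Proof. by case: a b => [? ?] [? ?] /= -> ->. Qed.

Lemma csmD U g h : open U -> csm U g -> csm U h -> csm U (fun x => g x + h x).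
Proof.
move=> oU [g1 g2] [h1 h2]; split.
  by apply: (sm_ext oU _ (smD oU g1 h1)) => x _; rewrite ReD.
by apply: (sm_ext oU _ (smD oU g2 h2)) => x _; rewrite ImD.
Qed.

Lemma csmN U g : open U -> csm U g -> csm U (fun x => - g x).
Proof.
move=> oU [g1 g2]; split.
  by apply: (sm_ext oU _ (smN oU g1)) => x _; rewrite ReN.
by apply: (sm_ext oU _ (smN oU g2)) => x _; rewrite ImN.
Qed.

Lemma csmM U g h : open U -> csm U g -> csm U h -> csm U (fun x => g x * h x).
Proof.
move=> oU [g1 g2] [h1 h2]; split.
  by apply: (sm_ext oU _ (smB oU (smM oU g1 h1) (smM oU g2 h2))) => x _; rewrite ReM.
by apply: (sm_ext oU _ (smD oU (smM oU g1 h2) (smM oU g2 h1))) => x _; rewrite ImM.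
Qed.

Lemma csm_cst U (c : R[i]) : csm U (fun=> c).
Proof. by split; apply: sm_cst. Qed.

Lemma csm_sum U (n : nat) (g : 'I_n -> pt3 R -> R[i]) : open U ->
  (forall j, csm U (g j)) -> csm U (fun x => \sum_j g j x).
Proof.
move=> oU sg; elim: n g sg => [|n IH] g sg.
  by apply: (csm_ext oU _ (csm_cst U 0)) => x _; rewrite big_ord0.
apply: (csm_ext oU (g := fun x => g ord0 x + \sum_(j < n) g (lift ord0 j) x)).
  by move=> x _; rewrite big_ord_recl.
by apply: csmD => //; apply: IH => j; apply: sg.
Qed.

Lemma csm_laplacian U g : open U -> csm U g -> csm U (laplacian g).
Proof.
by move=> oU sg; apply: csm_sum => // j; apply: csm_partial3; apply: csm_partial3.
Qed.

Lemma csm_cplx U (g : pt3 R -> R) : sm U g -> csm U (cplx g).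
Proof. by move=> sg; split=> //=; apply: sm_cst. Qed.

Lemma eq_near_partial3 i g h (x : pt3 R) : (\near x, g x = h x) ->
  partial3 i g x = partial3 i h x.
Proof.
move=> gh; rewrite /partial3; congr (_ +i* _)%C; apply: near_eq_derive;
  by near=> y; rewrite (_ : g y = h y)//; near: y.
Unshelve. all: by end_near. Qed.

Lemma eq_on_partial3 U i g h : open U -> (forall x, U x -> g x = h x) ->
  forall x, U x -> partial3 i g x = partial3 i h x.
Proof.
move=> oU gh x Ux; apply: eq_near_partial3; near=> y; apply: gh.
by near: y; apply: open_nbhs_nbhs; split.
Unshelve. all: by end_near. Qed.

Lemma eq_on_laplacian U g h : open U -> (forall x, U x -> g x = h x) ->
  forall x, U x -> laplacian g x = laplacian h x.
Proof.
move=> oU gh x Ux; apply: eq_bigr => i _.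
by apply: (eq_on_partial3 _ oU) => // y Uy; apply: (eq_on_partial3 _ oU).
Qed.

Lemma partial3D i g h x : cdiff g x -> cdiff h x ->
  partial3 i (fun y => g y + h y) x = partial3 i g x + partial3 i h x.
Proof.
move=> [g1 g2] [h1 h2]; apply: complex_eq; rewrite ?ReD ?ImD /=.
  rewrite -[RHS](pdD i g1 h1); apply: (congr1 (fun k => pd i k x)).
  by apply/funext => y /=; rewrite ReD.
rewrite -[RHS](pdD i g2 h2); apply: (congr1 (fun k => pd i k x)).
by apply/funext => y /=; rewrite ImD.
Qed.

Lemma partial3_cst i (c : R[i]) x : partial3 i (fun=> c) x = 0.
Proof. by apply: complex_eq; apply: pd_cst. Qed.

Lemma partial3M i g h x : cdiff g x -> cdiff h x ->
  partial3 i (fun y => g y * h y) x = partial3 i g x * h x + g x * partial3 i h x.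
Proof.
move=> [g1 g2] [h1 h2].
have dN k : differentiable k x -> pd i (fun y => - k y) x = - pd i k x :> R.
  by move=> dk; rewrite /pd deriveN//; apply: diff_derivable.
apply: complex_eq; rewrite ?ReD ?ImD ?ReM ?ImM /=.
  transitivity (pd i ((fun y => complex.Re (g y) * complex.Re (h y)) \+
                      (fun y => - (complex.Im (g y) * complex.Im (h y)))) x).
    by apply: (congr1 (fun k => pd i k x)); apply/funext => y /=; rewrite ReM.
  rewrite pdD; [|exact: differentiableM|by apply: differentiableN; exact: differentiableM].
  rewrite dN; last exact: differentiableM.
  by rewrite (pdM i g1 h1) (pdM i g2 h2) /pd; ring.
transitivity (pd i ((fun y => complex.Re (g y) * complex.Im (h y)) \+
                    (fun y => complex.Im (g y) * complex.Re (h y))) x).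
  by apply: (congr1 (fun k => pd i k x)); apply/funext => y /=; rewrite ImM.
rewrite pdD; try exact: differentiableM.
by rewrite (pdM i g1 h2) (pdM i g2 h1) /pd; ring.
Qed.

Lemma cdiff_cst (c : R[i]) x : cdiff (fun=> c) x.
Proof. by split; exact: differentiable_cst. Qed.

Lemma partial3Z i (c : R[i]) g x : cdiff g x ->
  partial3 i (fun y => c * g y) x = c * partial3 i g x.
Proof.
by move=> dg; rewrite (partial3M i (cdiff_cst c x) dg) partial3_cst mul0r add0r.
Qed.

Lemma partial3N i g x : cdiff g x -> partial3 i (fun y => - g y) x = - partial3 i g x.
Proof.
move=> dg; rewrite -mulN1r -partial3Z//; apply: (congr1 (fun k => partial3 i k x)).
by apply/funext => y; rewrite mulN1r.
Qed.

Lemma partial3_cplx i (g : pt3 R -> R) : partial3 i (cplx g) = cplx (pd i g).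
Proof. by apply/funext => x; apply: complex_eq => //=; exact: pd_cst. Qed.

Lemma cmod_le (z : R[i]) : cmod z <= `|complex.Re z| + `|complex.Im z|.
Proof.
have -> : `|complex.Re z| + `|complex.Im z| =
    Num.sqrt ((`|complex.Re z| + `|complex.Im z|) ^+ 2).
  by rewrite sqrtr_sqr [RHS]ger0_norm// addr_ge0.
rewrite /cmod ler_wsqrtr//.
rewrite sqrrD !real_normK ?num_real// -addrA lerD2l addrC lerDl.
by rewrite mulrn_wge0// mulr_ge0.
Qed.

Lemma normRe_cmod (z : R[i]) : `|complex.Re z| <= cmod z.
Proof. by rewrite /cmod -sqrtr_sqr ler_wsqrtr// lerDl sqr_ge0. Qed.

Lemma normIm_cmod (z : R[i]) : `|complex.Im z| <= cmod z.
Proof. by rewrite /cmod -sqrtr_sqr ler_wsqrtr// lerDr sqr_ge0. Qed.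

Lemma cmod_ge0 (z : R[i]) : 0 <= cmod z.
Proof. exact: sqrtr_ge0. Qed.

Lemma cmod2 (z : R[i]) : cmod z ^+ 2 = complex.Re z ^+ 2 + complex.Im z ^+ 2.
Proof. by rewrite sqr_sqrtr// addr_ge0 ?sqr_ge0. Qed.

Lemma cmodM (a b : R[i]) : cmod (a * b) = cmod a * cmod b.
Proof.
rewrite /cmod -sqrtrM ?addr_ge0 ?sqr_ge0//; congr Num.sqrt.
by rewrite ReM ImM; ring.
Qed.

Lemma cmod_norm (z : R[i]) : (cmod z)%:C%C = `|z|.
Proof. by case: z. Qed.

Lemma cmodD (a b : R[i]) : cmod (a + b) <= cmod a + cmod b.
Proof. by have := ler_normD a b; rewrite -!cmod_norm -rmorphD/= lecR. Qed.

Lemma cmodN (a : R[i]) : cmod (- a) = cmod a.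
Proof. by rewrite /cmod ReN ImN !sqrrN. Qed.

Lemma cmod_cplx (a : R) : cmod a%:C%C = `|a|.
Proof. by rewrite /cmod/= expr0n/= addr0 sqrtr_sqr. Qed.

Lemma cmod_sum (I : Type) (r : seq I) (P : pred I) (F : I -> R[i]) :
  cmod (\sum_(j <- r | P j) F j) <= \sum_(j <- r | P j) cmod (F j).
Proof.
elim/big_rec2 : _ => [|j y x _ H]; first by rewrite cmod_cplx normr0.
by rewrite (le_trans (cmodD _ _))// lerD2l.
Qed.

(** Supports are confined to cubes rather than balls: compactness and volume come from the factors
    of the product, and the cube is also the domain of the cosine series. *)
Definition cube (a : R) : set (pt3 R) := [set x | forall i, `|coord3 i x| <= a].

Lemma cubeE (a : R) : cube a = (`[- a, a] `*` `[- a, a]) `*` `[- a, a].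
Proof.
apply/seteqP; split=> [x Hx|x [[]]].
  have := (Hx (inord 0), Hx (inord 1), Hx (inord 2)).
  by rewrite /coord3 /= !inordK//= !ler_norml => -[[h1 h2] h3]; split; [split|]; rewrite /= in_itv.
rewrite /= !in_itv /= => h1 h2 h3 i; rewrite ler_norml /coord3.
by case: ifP => // _; case: ifP.
Qed.

Lemma cube_compact (a : R) : compact (cube a).
Proof.
by rewrite cubeE; apply: compact_setX; [apply: compact_setX|]; apply: segment_compact.
Qed.

Lemma enorm_coord3 (x : pt3 R) i : `|coord3 i x| <= enorm x.
Proof.
rewrite /enorm -sqrtr_sqr ler_wsqrtr// /coord3.
by case: ifP => _; [|case: ifP => _];
  rewrite -?addrA ?lerDl ?addr_ge0 ?sqr_ge0// addrCA -?addrA ?lerDl ?addr_ge0 ?sqr_ge0// addrA lerDr ?addr_ge0 ?sqr_ge0.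
Qed.

Lemma enorm_ge0 (x : pt3 R) : 0 <= enorm x.
Proof. exact: sqrtr_ge0. Qed.

Lemma enorm2 (x : pt3 R) : enorm x ^+ 2 = x.1.1 ^+ 2 + x.1.2 ^+ 2 + x.2 ^+ 2.
Proof. by rewrite sqr_sqrtr// !addr_ge0 ?sqr_ge0. Qed.

Lemma ball_cube (a : R) (x : pt3 R) : enorm x <= a -> cube a x.
Proof. by move=> xa i; rewrite (le_trans (enorm_coord3 _ _)). Qed.

Lemma cube_enorm (a : R) (x : pt3 R) : cube a x -> enorm x <= 3 * a.
Proof.
move=> xa; have a0 : 0 <= a by rewrite (le_trans _ (xa ord0)).
rewrite -(@ler_pXn2r _ 2) ?nnegrE ?enorm_ge0 ?mulr_ge0// enorm2.
have := (xa (inord 0), xa (inord 1), xa (inord 2)).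
rewrite /coord3 /= !inordK//= => -[[h1 h2] h3].
have sq (t : R) : `|t| <= a -> t ^+ 2 <= a ^+ 2.
  by move=> ta; rewrite -real_normK ?num_real// lerXn2r ?nnegrE.
have := (sq _ h1, sq _ h2, sq _ h3) => -[[k1 k2] k3].
rewrite exprMn; nra.
Qed.

Lemma cube_closed (a : R) : closed (cube a).
Proof. by apply: compact_closed; [exact: norm_hausdorff|exact: cube_compact]. Qed.

Lemma real_compact_bounded (a : R) (h : pt3 R -> R) :
  {in cube a, continuous h} -> exists M, forall x, cube a x -> `|h x| <= M.
Proof.
move=> ch.
have [M [_ HM]] : bounded_set (h @` cube a).
  apply: compact_bounded; apply: continuous_compact; last exact: cube_compact.
  by apply: continuous_in_subspaceT.
exists (M + 1) => x xa; apply: HM; first by rewrite ltrDl.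
by exists x.
Qed.

Lemma cdiff_cmod_bounded (a : R) g : (forall x, cdiff g x) ->
  exists M, forall x, cube a x -> cmod (g x) <= M.
Proof.
move=> dg.
have [M1 H1] := @real_compact_bounded a (fun x => complex.Re (g x))
  (fun x _ => differentiable_continuous (dg x).1).
have [M2 H2] := @real_compact_bounded a (fun x => complex.Im (g x))
  (fun x _ => differentiable_continuous (dg x).2).
by exists (M1 + M2) => x xa; rewrite (le_trans (cmod_le _))// lerD ?H1 ?H2.
Qed.

Lemma foldr_partial3_out (F : set (pt3 R)) g s : closed F ->
  (forall x, ~ F x -> g x = 0) ->
  forall x, ~ F x -> foldr (@partial3 R) g s x = 0.
Proof.
move=> cF g0; elim: s => //= i s IH x Fx.
rewrite -[RHS](partial3_cst i 0 x).
by apply: (@eq_on_partial3 (~` F)) => //; exact: closed_openC.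
Qed.

(** Every derivative is bounded on the compact cube and vanishes off it, and on the cube the
    polynomial weight is at most [(1 + 3 * |a|) ^+ m]. *)
Lemma csm_schwartz (a : R) g : csm setT g -> (forall x, ~ cube a x -> g x = 0) ->
  schwartz g.
Proof.
move=> sg g0; split; first exact/smooth_onP.
move=> m s.
have [M HM] := @cdiff_cmod_bounded a (foldr (@partial3 R) g s)
  (fun x => csm_cdiff (csm_foldr s sg) I).
exists ((1 + 3 * `|a|) ^+ m * `|M|) => x.
have [xa|xa] := pselect (cube a x); last first.
  rewrite (foldr_partial3_out s (@cube_closed a) g0 xa) cmod_cplx normr0 mulr0.
  by rewrite mulr_ge0// exprn_ge0// addr_ge0// mulr_ge0.
apply: ler_pM; rewrite ?exprn_ge0 ?addr_ge0 ?enorm_ge0 ?cmod_ge0//.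
  rewrite lerXn2r ?nnegrE ?addr_ge0 ?enorm_ge0 ?mulr_ge0// lerD2l.
  by rewrite (le_trans (cube_enorm xa))// ler_pM2l// ler_norm.
by rewrite (le_trans (HM x xa))// ler_norm.
Qed.

Lemma csm_test_fun U (F : set (pt3 R)) (a : R) g : csm setT g ->
  closed F -> F `<=` U -> F `<=` cube a ->
  (forall x, ~ F x -> g x = 0) -> test_fun U g.
Proof.
move=> sg cF FU Fa g0.
have cl : closure [set x | g x != 0] `<=` F.
  apply: (subset_trans (@closure_subset _ _ F _)); last by rewrite -(closure_id F).1.
  by move=> x /= gx; apply: contrapT => Fx; move: gx; rewrite g0// eqxx.
split; first exact/smooth_onP.
  apply: (subclosed_compact _ (@cube_compact a)); first exact: closed_closure.
  exact: subset_trans cl Fa.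
exact: subset_trans cl FU.
Qed.

End ComplexCalculus.

(** * Integration on R^3 *)

Lemma bounded_support_integrable d (T : measurableType d) (R : realType)
    (mu : {measure set T -> \bar R}) (A : set T) (M : R) (h : T -> R) :
  measurable A -> (mu A < +oo)%E -> measurable_fun setT h ->
  (forall x, A x -> `|h x| <= M) -> (forall x, ~ A x -> h x = 0) ->
  mu.-integrable setT (EFin \o h).
Proof.
move=> mA Aoo mh hM h0.
have H : mu.-integrable A (EFin \o h).
  apply: measurable_bounded_integrable => //; first exact: measurable_funTS.
  exists M; split; first exact: num_real.
  by move=> y My x /= xa; rewrite (le_trans (hM _ xa))// ltW.
have -> : EFin \o h = (EFin \o h) \_ A.
  apply/funext => x; rewrite patchE/=.
  by case: ifPn => //; rewrite notin_setE => /h0 ->.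
exact/(integrable_mkcond _ mA).
Qed.

(** * Tonelli and Fubini on a threefold product *)

Section ProductSigmaFinite.
Local Open Scope ereal_scope.
Context d1 d2 (T1 : measurableType d1) (T2 : measurableType d2) (R : realType).
Variable m1 : {sigma_finite_measure set T1 -> \bar R}.
Variable m2 : {sigma_finite_measure set T2 -> \bar R}.

Lemma product_sigma_finite : sigma_finite setT (m1 \x m2).
Proof.
have [F TF Foo] := sigma_finiteT m1; have [G TG Goo] := sigma_finiteT m2.
(* An enumeration of the pairs of indices; numbers that code no pair are sent to [(0, 0)]. *)
pose c n : nat * nat := odflt (0%N, 0%N) (unpickle n).
exists (fun n => F (c n).1 `*` G (c n).2).
  apply/seteqP; split=> // -[x y] _.
  have [i _ Fi] : (\bigcup_i F i) x by rewrite -TF.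
  have [j _ Gj] : (\bigcup_j G j) y by rewrite -TG.
  by exists (pickle (i, j)) => //; rewrite /c pickleK.
move=> n; have [mF oF] := Foo (c n).1; have [mG oG] := Goo (c n).2.
split; first exact: measurableX.
by rewrite product_measure1E// lte_mul_pinfty// ge0_fin_numE.
Qed.

(* The library loses the sigma-finite structure of [m1 \x m2] to the instance
   for finite measures, hence the alias. *)
Definition prodm := (m1 \x m2).
HB.instance Definition _ := Measure.on prodm.
HB.instance Definition _ := Measure_isSigmaFinite.Build _ _ _ prodm
  product_sigma_finite.
End ProductSigmaFinite.

Section TripleFubini.
Local Open Scope ereal_scope.
Context d (T : measurableType d) (R : realType).
Variable m : {sigma_finite_measure set T -> \bar R}.

(** The third variable is left outermost, so that polar coordinates can first be introduced in the
    pair [(x1, x2)]. *)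
Lemma ge0_triple_fubini_rev (h : T * T * T -> \bar R) : measurable_fun setT h ->
  (forall x, 0 <= h x)%E ->
  (\int[(m \x m) \x m]_x h x =
   \int[m]_x3 \int[m]_x2 \int[m]_x1 h ((x1, x2), x3))%E.
Proof.
move=> mh h0; rewrite (@fubini_tonelli2 _ _ _ _ R (prodm m m) m h)//.
apply: eq_integral => x3 _.
have m3 : measurable_fun setT (fun p => h (p, x3)) by exact: measurable_fun_pair1.
exact: (@fubini_tonelli2 _ _ _ _ R m m (fun p => h (p, x3)) m3 (fun p => h0 _)).
Qed.

Lemma measurable_inner_integral (h : T * T * T -> \bar R) : measurable_fun setT h ->
  (forall x, 0 <= h x)%E -> measurable_fun setT (fun p => \int[m]_x3 h (p, x3)).
Proof.
move=> mh h0; exact: (@measurable_fun_fubini_tonelli_F _ _ _ _ _ m).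
Qed.

Lemma double_box (A B : set T) : measurable A -> measurable B ->
  (m \x m) (A `*` B) = m A * m B.
Proof. by move=> mA mB; exact: product_measure1E. Qed.

Lemma triple_box (A B C : set T) : measurable A -> measurable B -> measurable C ->
  ((m \x m) \x m) ((A `*` B) `*` C) = m A * m B * m C.
Proof.
move=> mA mB mC; have mAB := measurableX mA mB.
by rewrite product_measure1E//; congr (_ * _); exact: product_measure1E.
Qed.

(** A partial derivative integrates to zero along its own axis only; in each of the three cases the
    order of integration is chosen so that this axis is innermost. *)
Lemma triple_integral_eq0 (h : T * T * T -> \bar R) :
  ((m \x m) \x m).-integrable setT h ->
  (forall x3, (m \x m).-integrable setT (fun p => h (p, x3))) ->
  (forall x2 x3, \int[m]_x1 h ((x1, x2), x3) = 0) \/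
  (forall x1 x3, \int[m]_x2 h ((x1, x2), x3) = 0) \/
  (forall x1 x2, \int[m]_x3 h ((x1, x2), x3) = 0) ->
  \int[(m \x m) \x m]_x h x = 0.
Proof.
move=> ih ih2 [H|[H|H]].
- rewrite -(@integral21_prod_meas1 _ _ _ _ R (prodm m m) m h ih).
  apply: integral0_eq => x3 _; rewrite /fubini_G.
  rewrite -(@integral21_prod_meas1 _ _ _ _ R m m _ (ih2 x3)).
  by apply: integral0_eq => x2 _; exact: H.
- rewrite -(@integral21_prod_meas1 _ _ _ _ R (prodm m m) m h ih).
  apply: integral0_eq => x3 _; rewrite /fubini_G.
  rewrite -(@integral12_prod_meas1 _ _ _ _ R m m _ (ih2 x3)).
  by apply: integral0_eq => x2 _; exact: H.
- rewrite -(@integral12_prod_meas1 _ _ _ _ R (prodm m m) m h ih).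
  by apply: integral0_eq => -[x1 x2] _; exact: H.
Qed.

End TripleFubini.

(** * Measurability and the divergence theorem on R^3 *)

Section Integration3.
Variable R : realType.
Local Notation leb := (@lebesgue_measure R).
Local Notation mT := (measurableTypeR R).
Implicit Types (h : pt3 R -> R) (i : 'I_3).

(** The measurable sets are those generated by products, so an open set is written as the union of
    the countably many boxes with rational endpoints that it contains. *)
Lemma open3_measurable (U : set (pt3 R)) : open U -> measurable U.
Proof.
move=> oU.
pose iv (q : rat * rat) : set R := `]ratr q.1, ratr q.2[%classic.
pose box (q : (rat * rat) * (rat * rat) * (rat * rat)) : set (pt3 R) :=
  (iv q.1.1 `*` iv q.1.2) `*` iv q.2.
have -> : U = \bigcup_n (if unpickle n is Some q then
    if asbool (box q `<=` U) then box q else set0 else set0).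
  apply/seteqP; split=> [x Ux|x [n _]]; last first.
    by case: unpickle => // q; case: asboolP => // + bx; apply.
  have : nbhs x U by apply: open_nbhs_nbhs.
  rewrite -nbhs_ballE => -[e /= e0 eU].
  have rt (t : R) : exists q : rat * rat, iv q t /\ iv q `<=` ball t e.
    have l1 : t - e < t by rewrite ltrBlDr ltrDl.
    have l2 : t < t + e by rewrite ltrDl.
    have [q1] := rat_in_itvoo l1; rewrite in_itv/= => /andP[h1 h2].
    have [q2] := rat_in_itvoo l2; rewrite in_itv/= => /andP[h3 h4].
    exists (q1, q2); split; first by rewrite /iv/= in_itv/= h2 h3.
    move=> s; rewrite /iv/= in_itv/= => /andP[k1 k2].
    rewrite /ball/= ltr_norml; apply/andP; split; lra.
  have [q1 [a1 b1]] := rt x.1.1; have [q2 [a2 b2]] := rt x.1.2.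
  have [q3 [a3 b3]] := rt x.2.
  have bU : box ((q1, q2), q3) `<=` U.
    by move=> y [[y1 y2] y3]; apply: eU; split; [split|]; [apply: b1|apply: b2|apply: b3].
  have [n Hn] : exists n, unpickle n = Some ((q1, q2), q3).
    by exists (pickle ((q1, q2), q3)); exact: pickleK.
  by exists n; rewrite ?Hn ?asboolT.
apply: bigcupT_measurable => n; case: unpickle => // q; case: asboolP => // _.
by apply: measurableX; [apply: measurableX|]; exact: measurable_itv.
Qed.

Lemma continuous3_measurable h : continuous h -> measurable_fun setT h.
Proof.
move=> /continuousP ch; apply: (measurability _ (RGenOpens.measurableE R)).
move=> _ [_ [a [b ->] <-]]; rewrite setTI; apply: open3_measurable.
exact/ch/interval_open.
Qed.

(** A function of two variables is a function of three that ignores the last one; a section at 0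
    brings measurability back. *)
Lemma continuous2_measurable (h : R * R -> R) : continuous h -> measurable_fun setT h.
Proof.
move=> ch; have m : measurable_fun setT (h \o fst : pt3 R -> R).
  apply: continuous3_measurable => x; apply: continuous_comp; last exact: ch.
  exact: cvg_fst.
have := measurable_fun_pair1 (T1 := (R * R)%type) (T2 := R) (0 : R) m.
by rewrite /comp/=.
Qed.

Lemma ge0_fubini3_rev (h : pt3 R -> \bar R) : measurable_fun setT h ->
  (forall x, 0 <= h x)%E ->
  (\int[leb3 R]_x h x =
   \int[leb]_x3 \int[leb]_x2 \int[leb]_x1 h ((x1, x2), x3))%E.
Proof. move=> mh h0; exact: (@ge0_triple_fubini_rev _ _ _ leb h mh h0). Qed.

Lemma cube_measurable (a : R) : measurable (@cube R a).
Proof.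
by rewrite cubeE; apply: measurableX; [apply: measurableX|]; exact: measurable_itv.
Qed.

Lemma cube_measure (a : R) : 0 <= a -> leb3 R (cube a) = ((2 * a) ^+ 3)%:E.
Proof.
rewrite le_eqVlt => a0.
have E : leb `[(- a)%R, a] = (2 * a)%:E.
  rewrite lebesgue_measure_itv /= lte_fin; case: ifP => [_|].
    by rewrite -EFinB opprK mulr_natl mulr2n.
  by move: a0 => /orP[/eqP <-|a0]; [rewrite mulr0|rewrite ltrNl (lt_trans _ a0)// oppr_lt0].
transitivity (leb `[(- a)%R, a] * leb `[(- a)%R, a] * leb `[(- a)%R, a])%E.
  by rewrite cubeE; apply: triple_box; exact: measurable_itv.
by rewrite E -!EFinM !exprS expr0 mulr1 mulrA.
Qed.

Lemma cube_measure_lty (a : R) : (leb3 R (cube a) < +oo)%E.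
Proof.
rewrite (@le_lt_trans _ _ (leb3 R (cube `|a|)))//; last by rewrite cube_measure// ltry.
apply: le_measure; rewrite ?inE; try exact: cube_measurable.
by move=> x xa i; rewrite (le_trans (xa i))// ler_norm.
Qed.

Lemma continuous_csupp_integrable3 (a : R) h : continuous h ->
  (forall x, ~ cube a x -> h x = 0) -> (leb3 R).-integrable setT (EFin \o h).
Proof.
move=> ch h0.
have [M HM] := @real_compact_bounded R a h (fun x _ => ch x).
apply: (@bounded_support_integrable _ (mT * mT * mT)%type R (leb3 R) (cube a) M h) => //.
- exact: cube_measurable.
- exact: cube_measure_lty.
- exact: continuous3_measurable.
Qed.

Lemma integral_csupp_derive1 (a : R) (k : R -> R) :
  (forall t, derivable k t 1) -> continuous (derive1 k) ->
  (forall t, a < `|t| -> k t = 0) ->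
  (\int[leb]_t (derive1 k t)%:E = 0)%E.
Proof.
(* [b] lies strictly beyond the support, so that [k] and its derivative vanish at the endpoints and
   outside. *)
move=> dk ck k0; pose b : R := `|a| + 1.
have b0 : 0 < b by rewrite ltr_wpDl.
have kout t : b <= `|t| -> k t = 0 /\ derive1 k t = 0.
  move=> bt; have at' : a < `|t| by rewrite (lt_le_trans _ bt)// (le_lt_trans (ler_norm a))// ltrDl.
  split; first exact: k0.
  rewrite derive1E (@near_eq_derive _ _ _ k (fun=> 0)) ?derive_cst//.
  have cn : continuous (fun x : R => `|x|) by move=> x; exact: norm_continuous.
  have : \forall x \near t, a < `|x| by have /cvgr_gt := cn t; exact.
  by apply: filterS => x; exact: k0.
have -> : (\int[leb]_t (derive1 k t)%:E = \int[leb]_(t in `[(- b)%R, b]) (derive1 k t)%:E)%E.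
  rewrite [RHS]integral_mkcond; apply: eq_integral => t _; rewrite patchE.
  case: ifPn => //; rewrite notin_setE /= in_itv/= -ler_norml => /negP.
  by rewrite -ltNge => /ltW /kout [_ ->].
have bb : - b < b by rewrite ltrNl (lt_trans _ b0)// oppr_lt0.
have kb : k b = 0 by apply: (kout _ _).1; exact: ler_norm.
have kNb : k (- b) = 0 by apply: (kout _ _).1; rewrite normrN; exact: ler_norm.
transitivity ((k b)%:E - (k (- b))%:E)%E; last by rewrite kb kNb subee.
apply: continuous_FTC2 bb _ _ (fun _ _ => erefl); first exact: continuous_subspaceT.
- split; first by move=> t _; exact: dk.
    apply: cvg_at_right_filter; apply: differentiable_continuous.
    by apply/derivable1_diffP.
  apply: cvg_at_left_filter; apply: differentiable_continuous.
  by apply/derivable1_diffP.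
Qed.

Lemma continuous_csupp_integrable2 (a : R) (h : R * R -> R) : continuous h ->
  (forall x, a < `|x.1| \/ a < `|x.2| -> h x = 0) ->
  (leb \x leb)%E.-integrable setT (EFin \o h).
Proof.
move=> ch h0; pose A : set (R * R) := `[- a, a] `*` `[- a, a].
have mA : measurable A by apply: measurableX; exact: measurable_itv.
have cA : compact A by apply: compact_setX; exact: segment_compact.
have [M [_ HM]] : bounded_set (h @` A).
  by apply: compact_bounded; apply: continuous_compact => //; exact: continuous_subspaceT.
have A_E : ((leb \x leb) A = leb `[(- a)%R, a] * leb `[(- a)%R, a])%E.
  by apply: double_box; exact: measurable_itv.
have A_lty : ((leb \x leb)%E A < +oo)%E.
  rewrite A_E !lebesgue_measure_itv /=.
  by case: ifP => _; rewrite ?mule0 ?mul0e ?ltry// -!EFinB -!EFinM ltry.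
apply: (@bounded_support_integrable _ (mT * mT)%type R (leb \x leb)%E A (M + 1) h) => //.
- exact: continuous2_measurable.
- by move=> x xa; apply: HM; [rewrite ltrDl|exists x].
- move=> x xA; rewrite h0//.
  apply: contrapT => /not_orP[/negP + /negP]; rewrite -!leNgt !ler_norml => h1 h2.
  by apply: xA; rewrite /A/=; split; rewrite /= in_itv/=.
Qed.

Lemma derive_line i (x : pt3 R) h (t : R) :
  'D_1 (fun s : R => h (x + s *: basis3 R i)) t = pd i h (x + t *: basis3 R i).
Proof.
rewrite /pd /derive; congr (lim _); apply: (congr1 (fun k => k @ 0^')).
apply/funext => s /=; congr (_ *: (h _ - h _)).
by rewrite [s *: 1]mulr1 scalerDl addrCA.
Qed.

Lemma pt3_line (x1 x2 x3 t : R) (b : pt3 R) : ((x1, x2), x3) + t *: b =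
  ((x1 + t * b.1.1, x2 + t * b.1.2), x3 + t * b.2) :> pt3 R.
Proof. by []. Qed.

Lemma line_continuous i (x : pt3 R) : continuous (fun t : R => x + t *: basis3 R i).
Proof. by move=> t; apply: differentiable_continuous. Qed.

Lemma derivable_line i (x : pt3 R) h (t : R) : differentiable h (x + t *: basis3 R i) ->
  derivable (fun s : R => h (x + s *: basis3 R i)) t 1.
Proof.
move=> dh; apply/derivable1_diffP; apply: differentiable_comp => //.
Qed.

(** Fubini reduces the claim to the lines parallel to axis [i], on which the fundamental theorem of
    calculus is applied to a function of compact support. *)
Lemma integral_pd_eq0 (a : R) i h : (forall x, differentiable h x) ->
  continuous (pd i h) -> (forall x, ~ cube a x -> h x = 0) ->
  (\int[leb3 R]_x (pd i h x)%:E = 0)%E.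
Proof.
move=> dh cp h0.
have p0 x : ~ cube a x -> pd i h x = 0.
  move=> xa; rewrite -[RHS](@pd_cst R i 0 x); apply: (@eq_on_pd R (~` cube a)) => //.
  by apply: closed_openC; exact: cube_closed.
have coord_out j x : a < `|coord3 j x| -> ~ cube a x.
  by move=> ax /(_ j); rewrite leNgt ax.
have i3 := continuous_csupp_integrable3 cp p0.
apply: (@triple_integral_eq0 _ _ _ leb _ i3).
  move=> x3; apply: (@continuous_csupp_integrable2 a (fun p => pd i h (p, x3))).
    move=> p; apply: continuous_comp (cp _).
    exact: (cvg_pair cvg_id (cvg_cst _)).
  by move=> p ap; apply: p0; case: ap => ap; [apply: (coord_out (inord 0))|apply: (coord_out (inord 1))];
    rewrite /coord3 /= inordK.
(* The base point has [i]-th coordinate 0, so the parameter [t] is that coordinate and the section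
   vanishes for [|t| > a]. *)
have line (x : pt3 R) : (forall t, coord3 i (x + t *: basis3 R i) = t) ->
    (\int[leb]_t (pd i h (x + t *: basis3 R i))%:E = 0)%E.
  move=> xt; rewrite -[RHS](@integral_csupp_derive1 a (fun s : R => h (x + s *: basis3 R i))).
  - by apply: eq_integral => t _; rewrite derive1E derive_line.
  - by move=> t; apply: derivable_line.
  - rewrite (_ : derive1 _ = (fun t => pd i h (x + t *: basis3 R i))); last first.
      by apply/funext => t; rewrite derive1E derive_line.
    move=> t; exact: (continuous_comp (@line_continuous i x t) (cp _)).
  - by move=> t at'; apply: h0; apply: (coord_out i); rewrite xt.
clear -line; case: i line => [[|[|[|//]]] Hi] line.
- left => x2 x3; rewrite -[RHS](line ((0, x2), x3)); last first.
    by move=> t; rewrite /coord3 /basis3/= add0r /GRing.scale/= mulr1.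
  apply: eq_integral => t _; congr (pd _ h _)%:E.
  by rewrite pt3_line /= !(mulr0, mulr1, addr0, add0r).
- right; left => x1 x3; rewrite -[RHS](line ((x1, 0), x3)); last first.
    by move=> t; rewrite /coord3 /basis3/= add0r /GRing.scale/= mulr1.
  apply: eq_integral => t _; congr (pd _ h _)%:E.
  by rewrite pt3_line /= !(mulr0, mulr1, addr0, add0r).
- right; right => x1 x2; rewrite -[RHS](line ((x1, x2), 0)); last first.
    by move=> t; rewrite /coord3 /basis3/= add0r /GRing.scale/= mulr1.
  apply: eq_integral => t _; congr (pd _ h _)%:E.
  by rewrite pt3_line /= !(mulr0, mulr1, addr0, add0r).
Qed.

End Integration3.

Lemma continuous_pairf (T U V : topologicalType) (f : T -> U) (g : T -> V) (x : T) :
  {for x, continuous f} -> {for x, continuous g} ->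
  {for x, continuous (fun y => (f y, g y))}.
Proof. by move=> cf cg; exact: (cvg_pair cf cg). Qed.

(** Continuity off 0; the point 0, where the inverse is 0 by convention, is a measurable singleton
    and is treated apart. *)
Lemma measurable_inv (R : realType) : measurable_fun [set: R] (fun x : R => x^-1).
Proof.
rewrite -(setUv [set (0 : R)]); apply/measurable_funU => //; first exact: measurableC.
split; first exact: measurable_fun_set1.
apply: open_continuous_measurable_fun; first by apply: closed_openC; exact: closed_eq.
by move=> x; rewrite inE/= => /eqP x0; exact: inv_continuous.
Qed.

(** * Spherical coordinates, as an inequality *)

Section Spherical.
Variable R : realType.
Local Notation leb := (@lebesgue_measure R).
Local Notation mT := (measurableTypeR R).

Lemma tonelliD (A B : set R) (H : R * R -> \bar R) : measurable A -> measurable B ->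
  measurable_fun [set: mT * mT] H -> (forall z, 0 <= H z)%E ->
  (\int[leb]_(x in A) \int[leb]_(y in B) H (x, y) =
   \int[leb]_(y in B) \int[leb]_(x in A) H (x, y))%E.
Proof.
move=> mA mB mH H0.
pose G : mT * mT -> \bar R := H \_ (A `*` B).
have mG : measurable_fun setT G.
  apply/(measurable_restrictT H); first exact: measurableX.
  exact: measurable_funTS.
have G0 z : (0 <= G z)%E by rewrite /G patchE; case: ifP.
have E1 : (\int[leb]_(x in A) \int[leb]_(y in B) H (x, y) =
           \int[leb]_x \int[leb]_y G (x, y))%E.
  rewrite integral_mkcond; apply: eq_integral => x _; rewrite patchE.
  case: ifPn => xA.
    rewrite integral_mkcond; apply: eq_integral => y _; rewrite /G !patchE.
    by rewrite in_setX /= xA.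
  rewrite integral0_eq// => y _; rewrite /G patchE in_setX /=.
  by rewrite (negbTE xA).
have E2 : (\int[leb]_(y in B) \int[leb]_(x in A) H (x, y) =
           \int[leb]_y \int[leb]_x G (x, y))%E.
  rewrite integral_mkcond; apply: eq_integral => y _; rewrite patchE.
  case: ifPn => yB.
    rewrite integral_mkcond; apply: eq_integral => x _; rewrite /G !patchE.
    by rewrite in_setX /= yB andbT.
  rewrite integral0_eq// => x _; rewrite /G patchE in_setX /=.
  by rewrite (negbTE yB) andbF.
rewrite E1 E2; exact: (@fubini_tonelli _ _ _ _ R leb leb G mG G0).
Qed.

Lemma integralT_le_segments (k : R -> R) (M : \bar R) : continuous k ->
  (forall x, 0 <= k x) ->
  (forall n : nat, (\int[leb]_(x in `[(- n%:R)%R, n%:R]) (k x)%:E <= M)%E) ->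
  (\int[leb]_x (k x)%:E <= M)%E.
Proof.
move=> ck k0 H.
have mk : measurable_fun [set: mT] (EFin \o k).
  by apply/measurable_EFinP; exact: continuous_measurable_fun.
have bigT : \bigcup_n `[(- n%:R)%R, n%:R]%classic = [set: R].
  apply/seteqP; split=> // x _; exists (Num.truncn `|x|).+1 => //=.
  by rewrite in_itv/= -ler_norml ltW// truncnS_gt.
have := @ge0_nondecreasing_set_cvg_integral _ mT R
  (fun n => `[(- n%:R)%R, n%:R]%classic) (EFin \o k) leb.
rewrite bigT => /(_ _ _ _ _) cv; apply: (cvge_le _ (cv _ _ _ _)).
- by near=> n; exact: H.
- move=> m n mn; apply/subsetPset => x /=; rewrite !in_itv/= -!ler_norml => xm.
  by rewrite (le_trans xm)// ler_nat.
- by move=> n; exact: measurable_itv.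
- by move=> n; exact: measurable_funTS.
- by move=> n x _; rewrite lee_fin.
Unshelve. all: by end_near. Qed.

Lemma sin_gt0_0pi (t : R) : t \in `]0, pi[ -> 0 < sin t.
Proof. by rewrite in_itv/= => /andP[a b]; rewrite sin_gt0_pi ?a. Qed.

(** The substitution [x = y * cot t], with inverse [t = pi / 2 - atan (x / y)], replaces a
    horizontal line of the upper half plane by the angles under which it is seen. As only an upper
    bound is wanted, each segment is mapped into []0, pi[] and nonnegativity does the rest. *)
Lemma cot_subst (k : R -> R) (y : R) : 0 < y -> continuous k ->
  (forall x, 0 <= k x) ->
  (\int[leb]_x (k x)%:E <=
   \int[leb]_(t in `]0%R, pi[) (k (y * (cos t / sin t)) * (y / sin t ^+ 2))%:E)%E.
Proof.
move=> y0 ck k0; apply: integralT_le_segments => // n.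
pose F (x : R) := pi / 2 - atan (x / y).
pose h (t : R) := k (y * (cos t / sin t)) * (y / sin t ^+ 2).
have F0pi x : 0 < F x < pi.
  have := (atan_gtNpi2 (x / y), atan_ltpi2 (x / y)); rewrite /F => -[a b].
  by apply/andP; split; lra.
have ch t : t \in `]0, pi[ -> {for t, continuous h}.
  move=> /sin_gt0_0pi /lt0r_neq0 s0; rewrite /h.
  have cs : {for t, continuous (fun t : R => (sin t)^-1)}.
    by apply: continuousV => //; exact: continuous_sin.
  have cc : {for t, continuous (fun t : R => y * (cos t / sin t))}.
    apply: continuousM; first exact: cvg_cst.
    by apply: continuousM => //; exact: continuous_cos.
  apply: continuousM; first exact: (continuous_comp cc (ck _)).
  apply: continuousM; first exact: cvg_cst.
  rewrite (_ : (fun _ => _) = (fun t : R => (sin t)^-1 * (sin t)^-1)).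
    exact: continuousM.
  by apply/funext => u; rewrite expr2 invfM.
have dF (x : R) : is_derive x 1 F (- (y / (y ^+ 2 + x ^+ 2))).
  have d1 : is_derive x 1 (fun x : R => x / y) y^-1.
    rewrite (_ : (fun _ => _) = y^-1 *: id); last by apply/funext => u /=; rewrite mulrC.
    by apply: is_derive_eq; rewrite /GRing.scale/= mulr1.
  have d2 := @is_derive1_comp _ atan (fun x : R => x / y) x _ _ (is_derive1_atan _) d1.
  have d3 := is_deriveB (is_derive_cst (pi / 2 : R) x 1) d2.
  apply: (@is_derive_eq _ _ _ _ _ _ _ _ d3); rewrite sub0r; congr (- _).
  have q0 : 0 < y ^+ 2 + x ^+ 2 by rewrite ltr_pwDl ?exprn_gt0// sqr_ge0.
  by field; rewrite (lt0r_neq0 y0) (lt0r_neq0 q0).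
(* In terms of [x], the factor [y / sin t ^+ 2] is [(y ^+ 2 + x ^+ 2) / y], the inverse of
   [- F']. *)
have FE (x : R) : h (F x) * (y / (y ^+ 2 + x ^+ 2)) = k x.
  rewrite /h /F.
  have -> : sin (pi / 2 - atan (x / y)) = cos (atan (x / y)).
    by rewrite sinB sin_pihalf cos_pihalf mul1r mul0r subr0.
  have -> : cos (pi / 2 - atan (x / y)) = sin (atan (x / y)).
    by rewrite cosB sin_pihalf cos_pihalf mul1r mul0r add0r.
  have -> : sin (atan (x / y)) / cos (atan (x / y)) = x / y by exact: atanK.
  rewrite [y * (x / y)]mulrC divfK ?gt_eqF// cos_atan exprVn sqr_sqrtr ?addr_ge0 ?sqr_ge0//.
  have q0 : 0 < y ^+ 2 + x ^+ 2 by rewrite ltr_pwDl ?exprn_gt0// sqr_ge0.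
  by rewrite invrK; field; rewrite (lt0r_neq0 y0) (lt0r_neq0 q0).
have -> : (\int[leb]_(x in `[(- n%:R)%R, n%:R]) (k x)%:E =
           \int[leb]_(t in `[(F n%:R)%R, (F (- n%:R))%R]) (h t)%:E)%E.
  have dF1 (x : R) : derive1 F x = - (y / (y ^+ 2 + x ^+ 2)).
    by rewrite derive1E; case: (dF x).
  have cdF : continuous (derive1 F).
    rewrite (_ : derive1 F = fun x => - (y / (y ^+ 2 + x ^+ 2))); last exact/funext.
    move=> x; apply: (@continuousN _ R^o R (fun x => y / (y ^+ 2 + x ^+ 2))).
    apply: continuousM; first exact: cvg_cst.
    apply: continuousV; first by rewrite gt_eqF// ltr_pwDl ?exprn_gt0// sqr_ge0.
    by apply: continuousD; [exact: cvg_cst|exact: exprn_continuous].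
  have cF : continuous F.
    by move=> x; apply: differentiable_continuous; apply/derivable1_diffP; case: (dF x).
  rewrite (@integration_by_substitution_decreasing R F h (- n%:R) n%:R).
  - apply: eq_integral => x _; congr EFin.
    by transitivity (h (F x) * - derive1 F x); first by rewrite dF1 opprK FE.
  - by rewrite (@le_trans _ _ 0)// ?oppr_le0 ler0n.
  - move=> u v _ _ uv; rewrite /F ltrD2l ltrN2 lt_atan// ltr_pM2r ?invr_gt0//.
  - by move=> x _; exact: cdF.
  - by apply: cvgP; apply: cvg_at_right_filter; exact: cdF.
  - by apply: cvgP; apply: cvg_at_left_filter; exact: cdF.
  - split; first by move=> x _; case: (dF x).
      by apply: cvg_at_right_filter; exact: cF.
    by apply: cvg_at_left_filter; exact: cF.
  - apply: continuous_in_subspaceT => t; rewrite inE/= in_itv/= => /andP[a b].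
    apply: ch; rewrite in_itv/=.
    have /andP[c _] := F0pi n%:R; have /andP[_ d] := F0pi (- n%:R).
    by rewrite (lt_le_trans c a) (le_lt_trans b d).
apply: ge0_subset_integral => //.
- apply/measurable_EFinP; apply: open_continuous_measurable_fun; first exact: interval_open.
  by move=> t; rewrite inE/=; exact: ch.
- move=> t /= /sin_gt0_0pi s0; rewrite lee_fin mulr_ge0// divr_ge0// ?ltW// exprn_gt0//.
- move=> t /=; rewrite !in_itv/= => /andP[a b].
  have /andP[c _] := F0pi n%:R; have /andP[_ d] := F0pi (- n%:R).
  by rewrite (lt_le_trans c a) (le_lt_trans b d).
Qed.

(** The integral of a nonnegative function is a supremum over simple functions below it, which is
    monotone for arbitrary functions. This matters for the integral in the wavenumber, since the
    hypotheses say nothing about how the boundary data depend on [k]. *)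
Lemma ge0_le_integral_nonmeasurable d (T : measurableType d)
    (mu : {measure set T -> \bar R}) (D : set T) (f g : T -> \bar R) :
  (forall x, D x -> 0 <= f x)%E -> (forall x, D x -> f x <= g x)%E ->
  (\int[mu]_(x in D) f x <= \int[mu]_(x in D) g x)%E.
Proof.
move=> f0 fg; rewrite ge0_integralE// ge0_integralE; last first.
  by move=> x Dx; rewrite (le_trans (f0 x Dx))// fg.
apply: le_ereal_sup => _ [h hf <-]; exists h => // x; apply: (le_trans (hf x)).
by rewrite !patchE; case: ifPn => //; rewrite inE; exact: fg.
Qed.

Lemma polar_integrand_measurable (k : R * R -> R) : continuous k ->
  measurable_fun [set: mT * mT]
    (fun z : mT * mT => k (z.1 * (cos z.2 / sin z.2), z.1) * (`|z.1| / sin z.2 ^+ 2)).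
Proof.
move=> ck.
have m1 : measurable_fun [set: mT] (fun x : mT => sin x).
  exact: continuous_measurable_fun (@continuous_sin R).
have m2 : measurable_fun [set: mT] (fun x : mT => cos x).
  exact: continuous_measurable_fun (@continuous_cos R).
have msin : measurable_fun [set: mT * mT] (fun z : mT * mT => (sin z.2)^-1).
  exact: (measurableT_comp (measurableT_comp (@measurable_inv R) m1) measurable_snd).
have mcos : measurable_fun [set: mT * mT] (fun z : mT * mT => cos z.2).
  exact: (measurableT_comp m2 measurable_snd).
apply: measurable_funM.
  apply: (measurableT_comp (continuous2_measurable ck)).
  apply: measurable_fun_pair; last exact: measurable_fst.
  apply: measurable_funM; first exact: measurable_fst.
  exact: measurable_funM.
apply: measurable_funM.
  by apply: measurableT_comp => //; exact: measurable_fst.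
rewrite (_ : (fun _ => _) = (fun z : mT * mT => (sin z.2)^-1 * (sin z.2)^-1)).
  exact: measurable_funM.
by apply/funext => z; rewrite expr2 invfM.
Qed.

(** Two substitutions in one variable: [x = y * cot t] at fixed height [y], then, after exchanging
    the integrals, [y = p * sin t] at fixed angle [t]. The Jacobians multiply to [p]. *)
Lemma polar_le (k : R * R -> R) : continuous k -> (forall z, 0 <= k z) ->
  (\int[leb]_(y in `]0%R, +oo[) \int[leb]_x (k (x, y))%:E <=
   \int[leb]_(t in `]0%R, pi[) \int[leb]_(p in `]0%R, +oo[)
     (k (p * cos t, p * sin t) * p)%:E)%E.
Proof.
move=> ck k0.
(* The absolute value of [y] keeps the integrand nonnegative on the whole plane, as Tonelli's
   theorem requires. *)
pose H (z : R * R) := (k (z.1 * (cos z.2 / sin z.2), z.1) * (`|z.1| / sin z.2 ^+ 2))%:E.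
have H0 z : (0 <= H z)%E by rewrite lee_fin mulr_ge0// divr_ge0// sqr_ge0.
apply: (@le_trans _ _ (\int[leb]_(y in `]0%R, +oo[) \int[leb]_(t in `]0%R, pi[) H (y, t))%E).
  apply: ge0_le_integral_nonmeasurable => y /=; rewrite in_itv/= andbT => y0.
    by apply: integral_ge0 => x _; rewrite lee_fin.
  rewrite /H /= gtr0_norm//; apply: (cot_subst y0 (k := fun x => k (x, y))) => //.
  by move=> x; apply: continuous_comp (ck _); exact: (cvg_pair cvg_id (cvg_cst _)).
rewrite tonelliD//; last by apply/measurable_EFinP; exact: polar_integrand_measurable.
apply: ge0_le_integral_nonmeasurable => t t0pi.
  by apply: integral_ge0.
have s0 := sin_gt0_0pi t0pi.
pose G y := k (y * (cos t / sin t), y) * (`|y| / sin t ^+ 2).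
have cG : continuous G.
  move=> y; apply: (@continuousM R R (fun y => k (y * (cos t / sin t), y))
    (fun y => `|y| / sin t ^+ 2)).
    apply: (@continuous_comp R (R * R)%type R (fun y => (y * (cos t / sin t), y)) k); last exact: ck.
    by apply: continuous_pairf; [exact: mulrr_continuous|exact: cvg_id].
  exact: (continuousM (@norm_continuous _ _ _) (cvg_cst _)).
have lin (x : R) : is_derive x 1 (fun p : R => p * sin t) (sin t).
  rewrite (_ : (fun _ => _) = sin t *: id); last by apply/funext => u /=; rewrite mulrC.
  by apply: is_derive_eq; rewrite /GRing.scale/= mulr1.
have clin : continuous (fun p : R => p * sin t).
  exact: mulrr_continuous.
have dlin : derive1 (fun p : R => p * sin t) = cst (sin t).
  by apply/funext => x; rewrite derive1E; case: (lin x).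
have mG (D : set R) : measurable D -> measurable_fun D (EFin \o G).
  by move=> mD; apply/measurable_EFinP/measurable_funTS; exact: continuous_measurable_fun.
rewrite (_ : \int[leb]_(y in _) H (y, t) = \int[leb]_(y in `[0%R, +oo[) (G y)%:E)%E; last first.
  by rewrite -integral_itv_obnd_cbnd//; exact: mG.
have := @increasing_ge0_integration_by_substitutiony R (fun p => p * sin t) G 0.
rewrite mul0r => -> //; last first.
- by move=> y _; rewrite mulr_ge0// divr_ge0// sqr_ge0.
- exact: continuous_subspaceT.
- exact: gt0_cvgMly.
- split; first by move=> x _; case: (lin x).
  by apply: cvg_at_right_filter; exact: clin.
- by rewrite dlin; exact: is_cvg_cst.
- by rewrite dlin; exact: is_cvg_cst.
- by move=> x _; rewrite dlin; exact: cst_continuous.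
- by move=> u v _ _ uv; rewrite ltr_pM2r.
rewrite -integral_itv_obnd_cbnd; last first.
  apply/measurable_EFinP/measurable_funTS; rewrite dlin.
  apply: measurable_funM => //; apply: continuous_measurable_fun => x.
  exact: continuous_comp (clin x) (cG _).
rewrite le_eqVlt; apply/orP; left; apply/eqP; apply: eq_integral => p.
rewrite inE/= in_itv/= andbT => p0; congr (_%:E).
transitivity (G (p * sin t) * derive1 (fun p : R => p * sin t) p); first by [].
rewrite dlin /G/= gtr0_norm ?mulr_gt0//.
have -> : p * sin t * (cos t / sin t) = p * cos t by field; exact: lt0r_neq0.
by rewrite -mulrA; congr (_ * _); field; exact: lt0r_neq0.
Qed.

(** The Jacobian on a half line becomes the continuous nonnegative weight [Num.max s 0] on the whole
    line, so that [polar_le] can be applied once more in another pair of variables. *)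
Lemma posweightE (F : R -> R) :
  (\int[leb]_(s in `]0%R, +oo[) (F s * s)%:E = \int[leb]_s (F s * Num.max s 0)%:E)%E.
Proof.
rewrite integral_mkcond; apply: eq_integral => s _; rewrite patchE.
case: ifPn; first by rewrite inE/= in_itv/= andbT => s0; rewrite max_l// ltW.
by rewrite notin_setE/= in_itv/= andbT => /negP; rewrite -leNgt => s0; rewrite max_r// mulr0.
Qed.

Definition sph_integrand (h : pt3 R -> R) (f t p : R) : R :=
  h (sphere_pt p t f) * (p ^+ 2 * sin t).

(** Spherical coordinates are polar coordinates twice: [(x1, x2)] becomes [(s, f)] with azimuth [f];
    then [(x3, s)], again in an upper half plane, becomes [(p, t)]. The Jacobian is
    [s * p = p ^+ 2 * sin t]. *)
Lemma half_space_le (h : pt3 R -> R) : continuous h -> (forall z, 0 <= h z) ->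
  (\int[leb]_x3 \int[leb]_(x2 in `]0%R, +oo[) \int[leb]_x1 (h ((x1, x2), x3))%:E <=
   \int[leb]_(f in `]0%R, pi[) \int[leb]_(t in `]0%R, pi[)
     \int[leb]_(p in `]0%R, +oo[) (sph_integrand h f t p)%:E)%E.
Proof.
move=> ch h0.
pose W (z : R * R * R) : R := h ((z.2 * cos z.1.2, z.2 * sin z.1.2), z.1.1) * Num.max z.2 0.
have cmax : continuous (fun s : R => Num.max s 0).
  by move=> s; apply: continuous_max; [exact: cvg_id|exact: cvg_cst].
have cW : continuous W.
  have c1 (z : R * R * R) : {for z, continuous (fun z : R * R * R => z.2)} by exact: cvg_snd.
  have c2 (z : R * R * R) : {for z, continuous (fun z : R * R * R => z.1.2)}.
    exact: (cvg_comp _ _ cvg_fst cvg_snd).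
  have c3 (z : R * R * R) : {for z, continuous (fun z : R * R * R => z.1.1)}.
    exact: (cvg_comp _ _ cvg_fst cvg_fst).
  move=> z; apply: (@continuousM R _ (fun z : R * R * R =>
     h ((z.2 * cos z.1.2, z.2 * sin z.1.2), z.1.1)) (fun z => Num.max z.2 0)).
    apply: (@continuous_comp _ _ _ (fun z : R * R * R =>
      ((z.2 * cos z.1.2, z.2 * sin z.1.2), z.1.1)) h); last exact: ch.
    apply: continuous_pairf => //; apply: continuous_pairf.
      apply: (@continuousM R _ (fun z : R * R * R => z.2) (fun z => cos z.1.2)) => //.
      exact: (continuous_comp (c2 z) (@continuous_cos _ _)).
    apply: (@continuousM R _ (fun z : R * R * R => z.2) (fun z => sin z.1.2)) => //.
    exact: (continuous_comp (c2 z) (@continuous_sin _ _)).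
  exact: (continuous_comp (c1 z) (cmax _)).
have W0 z : 0 <= W z by rewrite mulr_ge0// le_max lexx orbT.
have mW : measurable_fun [set: mT * mT * mT] (EFin \o W).
  by apply/measurable_EFinP; exact: continuous3_measurable.
pose V (z : R * R) : \bar R := (\int[leb]_s (W (z, s))%:E)%E.
have mV : measurable_fun [set: mT * mT] V.
  by apply: (@measurable_inner_integral _ _ _ leb (EFin \o W)).
have V0 z : (0 <= V z)%E by apply: integral_ge0 => s _; rewrite lee_fin.
apply: (@le_trans _ _ (\int[leb]_x3 \int[leb]_(f in `]0%R, pi[) V (x3, f))%E).
  apply: ge0_le_integral_nonmeasurable => x3 _.
    apply: integral_ge0 => x2 _; apply: integral_ge0 => x1 _; by rewrite lee_fin.
  apply: (le_trans (@polar_le (fun z => h (z, x3)) _ _)) => //.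
    move=> z; apply: (@continuous_comp _ _ _ (fun z => (z, x3)) h); last exact: ch.
    by apply: continuous_pairf; [exact: cvg_id|exact: cvg_cst].
  apply: ge0_le_integral_nonmeasurable => f _.
    apply: integral_ge0 => s; rewrite /= in_itv/= andbT => s0.
    by rewrite lee_fin mulr_ge0// ltW.
  by rewrite (posweightE (fun p => h ((p * cos f, p * sin f), x3))).
rewrite (tonelliD measurableT (measurable_itv `]0%R, pi[) mV V0).
apply: ge0_le_integral_nonmeasurable => f _; first by apply: integral_ge0.
pose k (z : R * R) : R := W ((z.1, f), z.2).
have ck : continuous k.
  move=> z; apply: (@continuous_comp _ _ _ (fun z : R * R => ((z.1, f), z.2)) W); last exact: cW.
  apply: continuous_pairf; last exact: cvg_snd.
  by apply: continuous_pairf; [exact: cvg_fst|exact: cvg_cst].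
have k0 z : 0 <= k z by exact: W0.
have mk : measurable_fun [set: mT * mT] (EFin \o k).
  by apply/measurable_EFinP; exact: continuous2_measurable.
rewrite /V (tonelliD measurableT measurableT mk _); last by move=> z; rewrite lee_fin; exact: k0.
have -> : (\int[leb]_s \int[leb]_x3 (k (x3, s))%:E =
           \int[leb]_(s in `]0%R, +oo[) \int[leb]_x3 (k (x3, s))%:E)%E.
  rewrite [RHS]integral_mkcond; apply: eq_integral => s _; rewrite patchE.
  case: ifPn => //; rewrite notin_setE/= in_itv/= andbT => /negP; rewrite -leNgt => s0.
  by apply: integral0_eq => x _; rewrite /k /W /= max_r// mulr0.
apply: (le_trans (polar_le ck k0)).
apply: ge0_le_integral_nonmeasurable => t t0.
  by apply: integral_ge0 => p; rewrite /= in_itv/= andbT => p0; rewrite lee_fin mulr_ge0// ltW.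
have s0 := sin_gt0_0pi t0.
apply: ge0_le_integral_nonmeasurable => p; rewrite /= in_itv/= andbT => p0.
  by rewrite lee_fin mulr_ge0// ltW.
rewrite /k /W /sph_integrand /sphere_pt /= max_l ?mulr_ge0 ?(ltW p0) ?(ltW s0)//.
by rewrite lee_fin le_eqVlt; apply/orP; left; apply/eqP; ring.
Qed.

Lemma measurable_partial_integral (A : set R) (H : R * R -> \bar R) : measurable A ->
  measurable_fun [set: mT * mT] H -> (forall z, 0 <= H z)%E ->
  measurable_fun [set: mT] (fun y => \int[leb]_(x in A) H (x, y))%E.
Proof.
move=> mA mH H0; pose G : mT * mT -> \bar R := H \_ (A `*` setT).
have mG : measurable_fun setT G.
  apply/(measurable_restrictT H); first exact: measurableX.
  exact: measurable_funTS.
have G0 z : (0 <= G z)%E by rewrite /G patchE; case: ifP.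
have := @measurable_fun_fubini_tonelli_G _ _ _ _ _ leb G mG G0.
congr (measurable_fun _ _); apply/funext => y; rewrite /fubini_G [RHS]integral_mkcond.
by apply: eq_integral => x _; rewrite /G !patchE in_setX /= in_setT andbT.
Qed.

Lemma angle_reflect (B : R -> R) : continuous B ->
  (\int[leb]_(f in `]0%R, pi[) (B (2 * pi - f))%:E =
   \int[leb]_(f in `]pi, (2 * pi)%R]) (B f)%:E)%E.
Proof.
move=> cB.
have mB (D : set R) : measurable D -> measurable_fun D (EFin \o B).
  by move=> mD; apply/measurable_EFinP/measurable_funTS; exact: continuous_measurable_fun.
have lin (x : R) : is_derive x 1 (fun f : R => 2 * pi - f) (-1).
  have := is_deriveB (is_derive_cst (2 * pi : R) x 1) (is_derive_id x (1 : R)).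
  by rewrite sub0r.
have clin : continuous (fun f : R => 2 * pi - f).
  by move=> x; apply: differentiable_continuous; apply/derivable1_diffP; case: (lin x).
have dlin : derive1 (fun f : R => 2 * pi - f) = cst (-1).
  by apply/funext => x; rewrite derive1E; case: (lin x).
have mB' (D : set R) : measurable D -> measurable_fun D (fun f => (B (2 * pi - f))%:E).
  move=> mD; apply/measurable_EFinP/measurable_funTS; apply: continuous_measurable_fun.
  by move=> x; exact: (continuous_comp (clin x) (cB _)).
have := @integration_by_substitution_decreasing R (fun f => 2 * pi - f) B 0 pi.
have -> : 2 * pi - pi = pi :> R by ring.
rewrite subr0 => E.
rewrite integral_itv_obnd_cbnd; last exact: mB.
rewrite E ?pi_ge0//; first last.
- exact: continuous_subspaceT.
- split; first by move=> x _; case: (lin x).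
    by apply: cvg_at_right_filter; exact: clin.
  by apply: cvg_at_left_filter; exact: clin.
- by rewrite dlin; exact: is_cvg_cst.
- by rewrite dlin; exact: is_cvg_cst.
- by move=> x _; rewrite dlin; exact: cst_continuous.
- by move=> u v _ _ uv; rewrite ltrD2l ltrN2.
rewrite integral_itv_obnd_cbnd; last exact: mB'.
rewrite integral_itv_bndo_bndc; last exact: mB'.
apply: eq_integral => f _; congr EFin.
transitivity (B (2 * pi - f) * - derive1 (fun f : R => 2 * pi - f) f); last by [].
by rewrite dlin opprK mulr1.
Qed.

Lemma sphere_pt_continuous2 (p : R) :
  continuous (fun z : R * R => sphere_pt p z.1 z.2).
Proof.
move=> z.
have c1 (k : R -> R) : continuous k -> {for z, continuous (fun z : R * R => k z.1)}.
  by move=> ck; apply: continuous_comp (ck _); exact: cvg_fst.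
have c2 (k : R -> R) : continuous k -> {for z, continuous (fun z : R * R => k z.2)}.
  by move=> ck; apply: continuous_comp (ck _); exact: cvg_snd.
have ps : {for z, continuous (fun z : R * R => p * sin z.1)}.
  apply: (c1 (fun t => p * sin t)) => t.
  exact: (continuous_comp (@continuous_sin _ t) (@mulrl_continuous _ _ _)).
apply: (@continuous_pairf _ _ _
  (fun z : R * R => (p * sin z.1 * cos z.2, p * sin z.1 * sin z.2))
  (fun z : R * R => p * cos z.1)); last first.
  apply: (c1 (fun t => p * cos t)) => t.
  exact: (continuous_comp (@continuous_cos _ t) (@mulrl_continuous _ _ _)).
apply: continuous_pairf.
  exact: (continuousM ps (c2 _ (@continuous_cos _))).
exact: (continuousM ps (c2 _ (@continuous_sin _))).
Qed.

Lemma section_measurable (H : R * R -> \bar R) (A : set R) (y : R) : measurable A ->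
  measurable_fun [set: mT * mT] H -> measurable_fun (A : set mT) (fun x => H (x, y)).
Proof.
move=> mA mH; apply: measurable_funTS.
by have := measurable_fun_pair1 (T1 := mT) (T2 := mT) y mH.
Qed.

Lemma half_order (h : pt3 R -> R) (A : set R) : measurable A ->
  continuous h -> (forall z, 0 <= h z) ->
  measurable_fun [set: mT] (fun x2 => \int[leb]_x3 \int[leb]_x1 (h ((x1, x2), x3))%:E)%E /\
  (\int[leb]_x3 \int[leb]_(x2 in A) \int[leb]_x1 (h ((x1, x2), x3))%:E =
   \int[leb]_(x2 in A) \int[leb]_x3 \int[leb]_x1 (h ((x1, x2), x3))%:E)%E.
Proof.
move=> mA ch h0.
pose W (z : R * R * R) : R := h ((z.2, z.1.2), z.1.1).
have cW : continuous W.
  move=> z; apply: (@continuous_comp _ _ _ (fun z : R * R * R => ((z.2, z.1.2), z.1.1)) h).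
    apply: continuous_pairf; last exact: (cvg_comp _ _ cvg_fst cvg_fst).
    apply: continuous_pairf; first exact: cvg_snd.
    exact: (cvg_comp _ _ cvg_fst cvg_snd).
  exact: ch.
have mW : measurable_fun [set: mT * mT * mT] (EFin \o W).
  by apply/measurable_EFinP; exact: continuous3_measurable.
have W0 z : (0 <= (EFin \o W) z)%E by rewrite lee_fin h0.
have mV := @measurable_inner_integral _ _ _ leb (EFin \o W) mW W0.
have V0 (z : mT * mT) : (0 <= \int[leb]_s (EFin \o W) (z, s))%E.
  by apply: integral_ge0 => s _; exact: W0.
split; first exact: (measurable_partial_integral measurableT mV V0).
exact: (tonelliD measurableT mA mV V0).
Qed.

Lemma sphere_pt_reflect (p t f : R) :
  (((sphere_pt p t f).1.1, - (sphere_pt p t f).1.2), (sphere_pt p t f).2) =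
  sphere_pt p t (2 * pi - f).
Proof.
have -> : 2 * pi = pi *+ 2 :> R by rewrite mulr_natl.
rewrite /sphere_pt/= sinB cosB sin2pi cos2pi.
by rewrite !(mul0r, mul1r, sub0r, addr0) mulrN.
Qed.

Lemma split_line_integral (E : R -> \bar R) :
  measurable_fun [set: mT] E -> (forall x, 0 <= E x)%E ->
  (\int[leb]_x E x = \int[leb]_(x in `]0%R, +oo[) E x +
     \int[leb]_(x in `]0%R, +oo[) E (- x)%R)%E.
Proof.
move=> mE E0.
have mN : measurable_fun [set: mT] (fun x : mT => E (- x)).
  by apply: measurableT_comp => //; exact: (@oppr_measurable R setT).
have U : [set: mT] = `]0, +oo[%classic `|` `]-oo, 0]%classic.
  by rewrite -setCitvl setvU.
have m1 : measurable (`]0, +oo[%classic : set mT) by exact: measurable_itv.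
have m2 : measurable (`]-oo, 0]%classic : set mT) by exact: measurable_itv.
have dj : [disjoint (`]0, +oo[%classic : set mT) & `]-oo, 0]%classic].
  apply/disj_setPS => x /=; rewrite !in_itv/= andbT => -[a b].
  by move: (lt_le_trans a b); rewrite ltxx.
have mU : measurable_fun (`]0, +oo[%classic `|` `]-oo, 0]%classic : set mT) E.
  exact: measurable_funTS.
have := @ge0_integral_setU _ mT R leb _ _ m1 m2 E mU (fun x _ => E0 x) dj.
rewrite -U => ->; congr (_ + _)%E.
rewrite integral_itv_obnd_cbnd; last exact: measurable_funTS.
rewrite (ge0_integration_by_substitution0 mN (fun x => E0 _)).
by apply: eq_integral => x _; rewrite opprK.
Qed.

Lemma disjoint_integral_le (E : R -> \bar R) (A B C : set R) :
  measurable A -> measurable B -> measurable C ->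
  measurable_fun [set: mT] E -> (forall x, 0 <= E x)%E ->
  [disjoint A & B] -> A `|` B `<=` C ->
  (\int[leb]_(x in A) E x + \int[leb]_(x in B) E x <= \int[leb]_(x in C) E x)%E.
Proof.
move=> mA mB mC mE E0 dAB ABC.
have mU : measurable_fun (A `|` B : set mT) E by exact: measurable_funTS.
rewrite -(@ge0_integral_setU _ mT R leb _ _ mA mB E mU (fun x _ => E0 x) dAB).
apply: ge0_subset_integral => //; first exact: measurableU.
exact: measurable_funTS.
Qed.

(** [half_space_le] covers [x2 > 0]; the part [x2 < 0] is reflected, which turns the azimuth [f]
    into [2 * pi - f]. Under the bound by [kap p * g] the radial and angular variables separate; the
    division by [r ^+ 2] compensates the area element contained in [sphere_integral]. *)
Lemma shell_integral_le (h g : pt3 R -> R) (kap : R -> R) (r : R) :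
  0 < r -> continuous h -> (forall z, 0 <= h z) ->
  continuous g -> (forall z, 0 <= g z) ->
  measurable_fun setT kap -> (forall p, 0 <= kap p) ->
  (forall p t f, 0 < p -> h (sphere_pt p t f) <= kap p * g (sphere_pt r t f)) ->
  (\int[leb3 R]_x (h x)%:E <=
   (\int[leb]_(p in `]0%R, +oo[) (kap p * p ^+ 2 / r ^+ 2)%:E) * sphere_integral r g)%E.
Proof.
move=> r0 ch h0 cg g0 mk k0 hkg.
pose refl (x : pt3 R) : pt3 R := ((x.1.1, - x.1.2), x.2).
have crefl : continuous refl.
  move=> x; apply: continuous_pairf; last exact: cvg_snd.
  apply: continuous_pairf; first exact: (cvg_comp _ _ cvg_fst cvg_fst).
  exact: (@continuousN _ R^o _ (fun x : pt3 R => x.1.2) _ (cvg_comp _ _ cvg_fst cvg_snd)).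
set c : \bar R := (\int[leb]_(p in `]0%R, +oo[) (kap p * p ^+ 2 / r ^+ 2)%:E)%E.
have kk0 (p : R) : 0 <= kap p * p ^+ 2 / r ^+ 2.
  by apply: divr_ge0; [apply: mulr_ge0; rewrite ?k0 ?sqr_ge0|rewrite sqr_ge0].
have c0 : (0 <= c)%E by apply: integral_ge0 => p _; rewrite lee_fin.
(* The surface density, with [|sin|] in place of [sin] so that it is nonnegative for all angles. *)
pose B (z : R * R) : R := g (sphere_pt r z.1 z.2) * (r ^+ 2 * `|sin z.1|).
have cB : continuous B.
  move=> z; apply: (@continuousM R _ (fun z : R * R => g (sphere_pt r z.1 z.2))
    (fun z : R * R => r ^+ 2 * `|sin z.1|)).
    exact: (continuous_comp (@sphere_pt_continuous2 r z) (cg _)).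
  apply: (@continuous_comp _ _ _ (fun z : R * R => `|sin z.1|) (fun t => r ^+ 2 * t)).
    apply: (@continuous_comp _ _ _ (fun z : R * R => sin z.1) (fun t => `|t|)).
      exact: (continuous_comp cvg_fst (@continuous_sin _ _)).
    exact: norm_continuous.
  exact: mulrl_continuous.
have BR0 z : 0 <= B z by rewrite mulr_ge0// mulr_ge0// sqr_ge0.
have m0pi : measurable (`]0, pi[%classic : set R) by exact: measurable_itv.
(* [s] is the identity for one half space and the reflection of the azimuth for the other. *)
have half (h' : pt3 R -> R) (s : R -> R) : continuous s -> continuous h' ->
    (forall z, 0 <= h' z) ->
    (forall p t f, 0 < p -> h' (sphere_pt p t f) <= kap p * g (sphere_pt r t (s f))) ->
    (\int[leb]_x3 \int[leb]_(x2 in `]0%R, +oo[) \int[leb]_x1 (h' ((x1, x2), x3))%:E <=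
    c * \int[leb]_(f in `]0%R, pi[) \int[leb]_(t in `]0%R, pi[) (B (t, s f))%:E)%E.
  move=> cs ch' h'0 hkg'; apply: (le_trans (half_space_le ch' h'0)).
  pose Bs (z : R * R) := (B (z.1, s z.2))%:E.
  have mBs : measurable_fun [set: mT * mT] Bs.
    apply/measurable_EFinP; apply: continuous2_measurable => z.
    apply: (@continuous_comp _ _ _ (fun z : R * R => (z.1, s z.2)) B); last exact: cB.
    by apply: continuous_pairf; [exact: cvg_fst|exact: (continuous_comp cvg_snd (cs _))].
  have Bs0 z : (0 <= Bs z)%E by rewrite lee_fin.
  have mI := measurable_partial_integral m0pi mBs Bs0.
  rewrite -ge0_integralZl//; last 2 first.
  - exact: measurable_funTS.
  - by move=> f _; apply: integral_ge0 => t _; exact: (Bs0 (t, f)).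
  apply: ge0_le_integral_nonmeasurable => f _.
    apply: integral_ge0 => t t0; apply: integral_ge0 => p; rewrite /= in_itv/= andbT => p0.
    by rewrite lee_fin /sph_integrand mulr_ge0// mulr_ge0 ?sqr_ge0// ltW// sin_gt0_0pi.
  have mBf := section_measurable f m0pi mBs.
  rewrite -ge0_integralZl//; last by move=> t _; exact: (Bs0 (t, f)).
  apply: ge0_le_integral_nonmeasurable => t t0.
    apply: integral_ge0 => p; rewrite /= in_itv/= andbT => p0.
    by rewrite lee_fin /sph_integrand mulr_ge0// mulr_ge0 ?sqr_ge0// ltW// sin_gt0_0pi.
  have s0 := sin_gt0_0pi t0.
  have mkk : measurable_fun (`]0%R, +oo[%classic : set mT)
      (fun x : mT => (kap x * x ^+ 2 / r ^+ 2)%:E).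
    apply/measurable_EFinP/measurable_funTS; apply: measurable_funM => //.
    by apply: measurable_funM => //; exact: exprn_measurable.
  rewrite /c -ge0_integralZr//; last 2 first.
  - by move=> p _; rewrite lee_fin.
  - exact: (Bs0 (t, f)).
  apply: ge0_le_integral_nonmeasurable => p; rewrite /= in_itv/= andbT => p0.
    by rewrite lee_fin /sph_integrand mulr_ge0// mulr_ge0 ?sqr_ge0// ltW.
  rewrite -EFinM lee_fin /sph_integrand /B /= gtr0_norm//.
  have -> : kap p * p ^+ 2 / r ^+ 2 * (g (sphere_pt r t (s f)) * (r ^+ 2 * sin t)) =
            kap p * g (sphere_pt r t (s f)) * (p ^+ 2 * sin t).
    by field; rewrite gt_eqF.
  apply: ler_wpM2r; last exact: hkg'.
  by apply: mulr_ge0; [exact: sqr_ge0|exact: ltW].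
have mB : measurable_fun [set: mT * mT] (EFin \o B).
  by apply/measurable_EFinP; exact: continuous2_measurable.
have EB0 z : (0 <= (EFin \o B) z)%E by rewrite lee_fin.
pose A (f : R) : \bar R := (\int[leb]_(t in `]0%R, pi[) (B (t, f))%:E)%E.
have mA : measurable_fun [set: mT] A := measurable_partial_integral m0pi mB EB0.
have A0 f : (0 <= A f)%E by apply: integral_ge0 => t _; rewrite lee_fin.
have E1 : (\int[leb3 R]_x (h x)%:E <= c * \int[leb]_(f in `]0%R, pi[) A f +
    c * \int[leb]_(f in `]0%R, pi[) A (2 * pi - f)%R)%E.
  have mh : measurable_fun [set: mT * mT * mT] (EFin \o h).
    by apply/measurable_EFinP; exact: continuous3_measurable.
  have ch' : continuous (h \o refl) by move=> x; exact: continuous_comp (crefl x) (ch _).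
  have h'0 z : 0 <= (h \o refl) z by exact: h0.
  have [mE Eall] := half_order measurableT ch h0.
  have [_ Epos] := half_order (measurable_itv `]0, +oo[) ch h0.
  have [_ Eneg] := half_order (measurable_itv `]0, +oo[) ch' h'0.
  set E := (fun x2 : mT => (\int[leb]_x3 \int[leb]_x1 (h ((x1, x2), x3))%:E)%E) in mE.
  have EE0 x : (0 <= E x)%E.
    by apply: integral_ge0 => y _; apply: integral_ge0 => w _; rewrite lee_fin.
  have -> : (\int[leb3 R]_x (h x)%:E = \int[leb]_(x2 in setT) E x2)%E.
    by rewrite -Eall; apply: (ge0_fubini3_rev mh).
  rewrite (split_line_integral mE EE0).
  apply: leeD.
    rewrite -Epos; exact: (half h id (fun x => cvg_id) ch h0 hkg).
  have crf : continuous (fun f : R => 2 * pi - f).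
    by move=> x; apply: differentiable_continuous.
  have hkg' p t f : 0 < p -> (h \o refl) (sphere_pt p t f) <=
      kap p * g (sphere_pt r t (2 * pi - f)).
    move=> p0; have reflE : refl (sphere_pt p t f) = sphere_pt p t (2 * pi - f).
      exact: sphere_pt_reflect.
    by have := hkg p t (2 * pi - f) p0; rewrite -reflE.
  apply: (le_trans _ (half (h \o refl) _ crf ch' h'0 hkg')).
  by rewrite Eneg.
have E2 : (\int[leb]_(f in `]0%R, pi[) A (2 * pi - f)%R =
    \int[leb]_(f in `]pi, (2 * pi)%R]) A f)%E.
  pose B' (z : R * R) := (B (z.1, 2 * pi - z.2))%:E.
  have mB' : measurable_fun [set: mT * mT] B'.
    apply/measurable_EFinP; apply: continuous2_measurable => z.
    apply: (@continuous_comp _ _ _ (fun z : R * R => (z.1, 2 * pi - z.2)) B); last exact: cB.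
    apply: continuous_pairf; [exact: cvg_fst|].
    apply: (@continuous_comp _ _ _ (fun z : R * R => z.2) (fun f => 2 * pi - f)).
      exact: cvg_snd.
    by apply: differentiable_continuous.
  have B'0 z : (0 <= B' z)%E by rewrite lee_fin.
  rewrite /A -(tonelliD m0pi m0pi mB' B'0).
  rewrite -(tonelliD m0pi (measurable_itv `]pi, (2 * pi)]) mB EB0).
  apply: eq_integral => t _; apply: (@angle_reflect (fun f => B (t, f))) => f.
  apply: (@continuous_comp _ _ _ (fun f : R => (t, f)) B); last exact: cB.
  by apply: continuous_pairf; [exact: cvg_cst|exact: cvg_id].
(* The two ranges of the azimuth are disjoint and miss only the angles 0 and [pi]. *)
have E3 : (\int[leb]_(f in `]0%R, pi[) A f + \int[leb]_(f in `]pi, (2 * pi)%R]) A f <=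
    \int[leb]_(f in `[0%R, (2 * pi)%R]) A f)%E.
  have := pi_gt0 R => pi0; apply: (disjoint_integral_le m0pi (measurable_itv _) (measurable_itv _) mA A0).
  - apply/disj_setPS => x /=; rewrite !in_itv/= => -[/andP[_ a] /andP[b _]].
    by move: (lt_trans a b); rewrite ltxx.
  - move=> x /=; rewrite !in_itv/= => -[/andP[a b]|/andP[a b]]; apply/andP; split; lra.
have E4 : (\int[leb]_(f in `[0%R, (2 * pi)%R]) A f <= sphere_integral r g)%E.
  rewrite -(tonelliD m0pi (measurable_itv `[0, (2 * pi)]) mB EB0).
  pose Br (z : R * R) := (B (z.2, z.1))%:E.
  have mBr : measurable_fun [set: mT * mT] Br.
    apply/measurable_EFinP; apply: continuous2_measurable => z.
    apply: (@continuous_comp _ _ _ (fun z : R * R => (z.2, z.1)) B); last exact: cB.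
    by apply: continuous_pairf; [exact: cvg_snd|exact: cvg_fst].
  have Br0 z : (0 <= Br z)%E by rewrite lee_fin.
  have mX := measurable_partial_integral (measurable_itv `[0, (2 * pi)]) mBr Br0.
  apply: (@le_trans _ _ (\int[leb]_(t in `[0%R, pi])
      \int[leb]_(f in `[0%R, (2 * pi)%R]) (B (t, f))%:E)%E).
    apply: (@ge0_subset_integral _ mT R leb _ _ m0pi (measurable_itv _)).
    - exact: measurable_funTS.
    - by move=> t _; apply: integral_ge0 => f _; exact: EB0.
    - by move=> t /=; rewrite !in_itv/= => /andP[a b]; rewrite !ltW.
  rewrite le_eqVlt; apply/orP; left; apply/eqP; apply: eq_integral => t.
  rewrite inE/= in_itv/= => t0; apply: eq_integral => f _.
  by rewrite /B/= ger0_norm// sin_ge0_pi.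
rewrite E2 -ge0_muleDr in E1; last 2 first.
- by apply: integral_ge0 => f _; exact: A0.
- by apply: integral_ge0 => f _; exact: A0.
apply: (le_trans E1).
exact: (lee_wpmul2l c0 (le_trans E3 E4)).
Qed.

End Spherical.

(** * Plane waves and the boundary functional *)

Section PlaneWaves.
Variable R : realType.
Implicit Types (d x : pt3 R) (s : R[i]) (i : 'I_3).

Definition dot3 d x : R := \sum_(i < 3) coord3 i d * coord3 i x.

Lemma sm_dot3 U d : open U -> sm U (dot3 d).
Proof.
move=> oU.
have H n (F : 'I_n -> pt3 R -> R) : (forall j, sm U (F j)) -> sm U (fun x => \sum_j F j x).
  elim: n F => [|n IH] F sF.
    by apply: (sm_ext oU _ (sm_cst U 0)) => x _; rewrite big_ord0.
  apply: (sm_ext oU _ (smD oU (sF ord0) (IH (fun j => F (lift ord0 j)) (fun j => sF _)))).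
  by move=> x _; rewrite big_ord_recl.
by apply: H => i; apply: smZ => //; apply: sm_coord3.
Qed.

Lemma pd_dot3 i d x : pd i (dot3 d) x = coord3 i d.
Proof.
have -> : dot3 d = (fun y => coord3 ord0 d * coord3 ord0 y +
   (coord3 (lift ord0 ord0) d * coord3 (lift ord0 ord0) y +
    coord3 (lift ord0 (lift ord0 ord0)) d * coord3 (lift ord0 (lift ord0 ord0)) y)).
  by apply/funext => y; rewrite /dot3 !big_ord_recl big_ord0 addr0.
have dZ (c : R) j : differentiable (fun y => c * coord3 j y) x.
  by apply: (@differentiableZ _ _ _ (coord3 j) c x); exact: coord3_differentiable.
have pZ (c : R) j : pd i (fun y => c * coord3 j y) x = c * (i == j)%:R.
  rewrite -(pd_coord3 i j x) /pd -[RHS]/(c *: _) -deriveZ//.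
  by apply: diff_derivable; exact: coord3_differentiable.
rewrite (pdD i (dZ _ _)); last by apply: differentiableD; exact: dZ.
rewrite (pdD i (dZ _ _) (dZ _ _)) !pZ.
by clear pZ; case: i => [[|[|[|//]]] Hi]; rewrite /coord3 /= /bump/=; ring.
Qed.

(* The plane wave exp(i s d.x) for a complex wavenumber s; for |d| = 1 it solves
   Laplace^2 w = s^4 w. *)
Definition pw s d x : R[i] :=
  (expR (- complex.Im s * dot3 d x) * cos (complex.Re s * dot3 d x)
     +i* (expR (- complex.Im s * dot3 d x) * sin (complex.Re s * dot3 d x)))%C.

Lemma csm_pw U s d : open U -> csm U (pw s d).
Proof.
move=> oU.
have h1 (c : R) : sm U (fun x => c * dot3 d x) by apply: smZ => //; exact: sm_dot3.
split; apply: smM => //.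
- exact: (sm_expR oU (h1 (- complex.Im s))).
- exact: (sm_cos oU (h1 (complex.Re s))).
- exact: (sm_expR oU (h1 (- complex.Im s))).
- exact: (sm_sin oU (h1 (complex.Re s))).
Qed.

Lemma partial3_pw i s d x :
  partial3 i (pw s d) x = ((0 +i* 1) * s * (coord3 i d)%:C * pw s d x)%C.
Proof.
pose e y := expR (- complex.Im s * dot3 d y).
pose c y := cos (complex.Re s * dot3 d y).
pose n y := sin (complex.Re s * dot3 d y).
have h1 (a : R) : sm setT (fun x => a * dot3 d x) by apply: smZ; [exact: openT|exact: sm_dot3 openT].
have dh (a : R) : differentiable (fun x => a * dot3 d x) x by apply: sm_diff (h1 a) _.
have ph (a : R) : pd i (fun x => a * dot3 d x) x = a * coord3 i d.
  rewrite -(pd_dot3 i d x) /pd -[RHS]/(a *: _) -deriveZ//.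
  by apply: diff_derivable; apply: sm_diff (sm_dot3 d openT) _.
have pe : pd i e x = e x * (- complex.Im s * coord3 i d).
  by rewrite -(ph (- complex.Im s)); apply: (@pd_comp _ i _ expR).
have pc : pd i c x = - n x * (complex.Re s * coord3 i d).
  by rewrite -(ph (complex.Re s)); apply: (@pd_comp _ i _ cos).
have pn : pd i n x = c x * (complex.Re s * coord3 i d).
  by rewrite -(ph (complex.Re s)); apply: (@pd_comp _ i _ sin).
have de : differentiable e x by apply: sm_diff (sm_expR openT (h1 _)) _.
have dc : differentiable c x by apply: sm_diff (sm_cos openT (h1 _)) _.
have dn : differentiable n x by apply: sm_diff (sm_sin openT (h1 _)) _.
apply: complex_eq.
  rewrite -[LHS]/(pd i (e \* c) x) (pdM i de dc) pe pc !(ReM, ImM) /=.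
  by rewrite -/(e x) -/(c x) -/(n x); ring.
rewrite -[LHS]/(pd i (e \* n) x) (pdM i de dn) pe pn !(ReM, ImM) /=.
by rewrite -/(e x) -/(c x) -/(n x); ring.
Qed.

(** The second derivatives bring the factors [- s ^+ 2 * d_i ^+ 2], whose sum is [- s ^+ 2] because
    the direction is a real unit vector; the wavenumber may be complex. *)
Lemma laplacian_pw s d x : enorm d = 1 -> laplacian (pw s d) x = - s ^+ 2 * pw s d x.
Proof.
move=> d1; have E i : partial3 i (partial3 i (pw s d)) x =
    - s ^+ 2 * (coord3 i d ^+ 2)%:C%C * pw s d x.
  have -> : partial3 i (pw s d) = fun x => ((0 +i* 1) * s * (coord3 i d)%:C)%C * pw s d x.
    by apply/funext => y; exact: partial3_pw.
  rewrite partial3Z; last exact: (csm_cdiff (csm_pw s d openT)).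
  rewrite partial3_pw rmorphXn/= !mulrA; congr (_ * _).
  have II : ((0 +i* 1) * (0 +i* 1) = -1 :> R[i])%C by exact: sqr_i.
  set I := (0 +i* 1)%C in II *; set c := (coord3 i d)%:C%C.
  by transitivity ((I * I) * s ^+ 2 * c * c); [ring|rewrite II; ring].
rewrite /laplacian (eq_bigr _ (fun i _ => E i)) -mulr_suml -mulr_sumr; congr (_ * _).
rewrite -rmorph_sum /= (_ : \sum_(i < 3) _ = 1) ?mulr1//.
rewrite -[RHS](expr1n _ 2) -d1 enorm2 !big_ord_recl big_ord0.
by rewrite /coord3 /= addr0 addrA.
Qed.

Lemma bilaplacian_pw s d x : enorm d = 1 ->
  laplacian (laplacian (pw s d)) x = s ^+ 4 * pw s d x.
Proof.
move=> d1; have -> : laplacian (pw s d) = fun y => - s ^+ 2 * pw s d y.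
  by apply/funext => y; exact: laplacian_pw.
have cd := fun y => csm_cdiff (csm_pw s d openT) (I : setT y).
have -> : laplacian (fun y => - s ^+ 2 * pw s d y) x = - s ^+ 2 * laplacian (pw s d) x.
  rewrite /laplacian mulr_sumr; apply: eq_bigr => i _.
  have -> : partial3 i (fun y => - s ^+ 2 * pw s d y) = fun y => - s ^+ 2 * partial3 i (pw s d) y.
    by apply/funext => y; rewrite partial3Z.
  rewrite partial3Z//.
  exact: (csm_cdiff (csm_partial3 i (csm_pw s d openT)) I).
by rewrite laplacian_pw//; ring.
Qed.

End PlaneWaves.

(** * Green's identity for the bilaplacian *)

Section Green.
Variable R : realType.
Implicit Types (A B u w : pt3 R -> R[i]) (c : pt3 R -> R).

Definition cross_diff (a b c e : pt3 R -> R[i]) : pt3 R -> R[i] :=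
  fun x => a x * b x - c x * e x.

(* The field whose divergence is A (Laplace^2 B) - B (Laplace^2 A). *)
Definition green_field A B (i : 'I_3) : pt3 R -> R[i] := fun x =>
  cross_diff A (partial3 i (laplacian B)) (laplacian B) (partial3 i A) x
  + cross_diff (laplacian A) (partial3 i B) B (partial3 i (laplacian A)) x.

Lemma csm_cross (a b c e : pt3 R -> R[i]) : csm setT a -> csm setT b -> csm setT c -> csm setT e ->
  csm setT (cross_diff a b c e).
Proof.
move=> sa sb sc se; have o := @openT (pt3 R).
exact: (csmD o (csmM o sa sb) (csmN o (csmM o sc se))).
Qed.

Lemma partial3_cross i (a b c e : pt3 R -> R[i]) x :
  csm setT a -> csm setT b -> csm setT c -> csm setT e ->
  partial3 i (cross_diff a b c e) x =
  partial3 i a x * b x + a x * partial3 i b x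
  - (partial3 i c x * e x + c x * partial3 i e x).
Proof.
move=> sa sb sc se; have o := @openT (pt3 R).
have cd g : csm setT g -> cdiff g x by move=> sg; exact: csm_cdiff sg I.
have s1 := csmM o sa sb; have s2 := csmM o sc se.
transitivity (partial3 i (fun y => a y * b y) x + partial3 i (fun y => - (c y * e y)) x).
  by apply: partial3D; apply: cd => //; exact: csmN.
congr (_ + _); first by apply: partial3M; exact: cd.
transitivity (- partial3 i (fun y => c y * e y) x); first by apply: partial3N; exact: cd.
by congr (- _); apply: partial3M; exact: cd.
Qed.

Lemma csm_green_field A B i : csm setT A -> csm setT B -> csm setT (green_field A B i).
Proof.
move=> sA sB; have o := @openT (pt3 R).
have lA := csm_laplacian o sA; have lB := csm_laplacian o sB.
exact: (csmD o (csm_cross sA (csm_partial3 i lB) lB (csm_partial3 i sA))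
               (csm_cross lA (csm_partial3 i sB) sB (csm_partial3 i lA))).
Qed.

(** Products of two gradients cancel within each cross difference, and the two products
    [laplacian A * laplacian B] cancel between them. *)
Lemma green_div A B x : csm setT A -> csm setT B ->
  \sum_i partial3 i (green_field A B i) x =
  A x * laplacian (laplacian B) x - B x * laplacian (laplacian A) x.
Proof.
move=> sA sB; have o := @openT (pt3 R).
have cd g : csm setT g -> cdiff g x by move=> sg; exact: csm_cdiff sg I.
have pA i := csm_partial3 i sA; have pB i := csm_partial3 i sB.
have lA := csm_laplacian o sA; have lB := csm_laplacian o sB.
have plA i := csm_partial3 i lA; have plB i := csm_partial3 i lB.
have E i : partial3 i (green_field A B i) x =
    A x * partial3 i (partial3 i (laplacian B)) x
    - laplacian B x * partial3 i (partial3 i A) x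
    + laplacian A x * partial3 i (partial3 i B) x
    - B x * partial3 i (partial3 i (laplacian A)) x.
  rewrite (partial3D i (cd _ (csm_cross sA (plB i) lB (pA i)))
                       (cd _ (csm_cross lA (pB i) sB (plA i)))).
  rewrite (partial3_cross i x sA (plB i) lB (pA i)).
  rewrite (partial3_cross i x lA (pB i) sB (plA i)).
  have ringE (a b c e a1 b1 c1 e1 p q r t : R[i]) :
      a * b + c * p - (b * a + e * q) + (a1 * b1 + c1 * r - (b1 * a1 + e1 * t)) =
      c * p - e * q + c1 * r - e1 * t by ring.
  exact: ringE.
rewrite (eq_bigr _ (fun i _ => E i)).
have sumE (a b c e : R[i]) (F G H J : 'I_3 -> R[i]) :
    \sum_j (a * F j - b * G j + c * H j - e * J j) =
    a * (\sum_j F j) - b * (\sum_j G j) + c * (\sum_j H j) - e * (\sum_j J j).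
  by rewrite !mulr_sumr -!sumrN -!big_split.
transitivity (A x * laplacian (laplacian B) x - laplacian B x * laplacian A x
  + laplacian A x * laplacian B x - B x * laplacian (laplacian A) x).
  exact: sumE.
have ringE (p q b c : R[i]) : p - b * c + c * b - q = p - q by ring.
exact: ringE.
Qed.

(** The divergence of [green_field u phi] brings in [phi] times the bilaplacian of [u], and that of
    [c * green_field w u] removes it, since [phi = c * w]. Apart from a divergence, what remains
    carries exactly one derivative of [c]. A direct expansion of the bilaplacian of [c * w] would
    have up to four, each costing the inverse thickness of the layer. *)
Lemma green_identity u w c (Z : R[i]) x : csm setT u -> csm setT w -> sm setT c ->
  laplacian (laplacian w) x = Z * w x ->
  let phi := fun y => cplx c y * w y in
  u x * (laplacian (laplacian phi) x - Z * phi x) =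
  \sum_i partial3 i (fun y => green_field u phi i y + cplx c y * green_field w u i y) x
  - \sum_i partial3 i (cplx c) x * green_field w u i x.
Proof.
move=> su sw sc Zw phi; have o := @openT (pt3 R).
have scc : csm setT (cplx c) by exact: csm_cplx.
have sphi : csm setT phi by exact: csmM.
have cd g : csm setT g -> cdiff g x by move=> sg; exact: csm_cdiff sg I.
have E i : partial3 i (fun y => green_field u phi i y + cplx c y * green_field w u i y) x =
    partial3 i (green_field u phi i) x + partial3 i (cplx c) x * green_field w u i x +
    cplx c x * partial3 i (green_field w u i) x.
  have s1 := csm_green_field i su sphi; have s2 := csm_green_field i sw su.
  rewrite partial3D; [|exact: cd|exact: cd (csmM o scc s2)].
  by rewrite partial3M; [rewrite addrA|exact: cd..].
rewrite (eq_bigr _ (fun i _ => E i)).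
have sumE (b : R[i]) (F G H : 'I_3 -> R[i]) :
    \sum_j (F j + G j + b * H j) = \sum_j F j + \sum_j G j + b * (\sum_j H j).
  by rewrite mulr_sumr -!big_split.
have ringE (a b d p q t z l g1 g2 : R[i]) : l = z * d -> g1 = a * p - (b * d) * q ->
    g2 = d * q - a * l -> a * (p - z * (b * d)) = (g1 + t + b * g2) - t.
  by move=> -> -> ->; ring.
transitivity ((\sum_i partial3 i (green_field u phi i) x +
  \sum_i partial3 i (cplx c) x * green_field w u i x +
  cplx c x * \sum_i partial3 i (green_field w u i) x) -
  \sum_i partial3 i (cplx c) x * green_field w u i x).
  exact: (ringE _ _ _ _ _ _ _ _ _ _ Zw (green_div x su sphi) (green_div x sw su)).
by congr (_ - _); symmetry; exact: sumE.
Qed.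

End Green.

(** * Cutoffs across the sphere and estimates in a thin shell *)

Section BoundaryEstimate.
Variable R : realType.
Implicit Types (x d : pt3 R) (s : R[i]) (c : pt3 R -> R).

(** The derivative of [stp]: for a quotient [p / (p + q)] with [q] evaluated at [1 - t], the
    numerator [p' (p + q) - p (p' - q')] simplifies to [p' q + p q']. *)
Definition stp_slope (t : R) : R :=
  (flat (flat_next 1) t * flat 1 (1 - t) + flat 1 t * flat (flat_next 1) (1 - t))
    / (flat 1 t + flat 1 (1 - t)) ^+ 2.

Lemma stp_derive (t : R) : is_derive t 1 (@stp R) (stp_slope t).
Proof.
have d1 := @flat_derive R 1 t.
have d2 : is_derive t 1 (fun x : R => flat 1 (1 - x)) (- flat (flat_next 1) (1 - t)).
  have d3 : is_derive t 1 (fun x : R => 1 - x) (-1).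
    by apply: is_derive_eq (is_deriveB (is_derive_cst (1 : R) t 1) (is_derive_id t 1)) _; rewrite sub0r.
  have := @is_derive1_comp R (flat 1) (fun x : R => 1 - x) t _ _ (@flat_derive R 1 (1 - t)) d3.
  by rewrite mulrN1.
have D0 : flat 1 t + flat 1 (1 - t) != 0 by rewrite gt_eqF// stp_den_gt0.
have d4 := is_deriveD d1 d2.
have d5 := @is_deriveV R (flat 1 + (fun x : R => flat 1 (1 - x))) t _ 1 D0 d4.
apply: is_derive_eq (is_deriveM d1 d5) _.
rewrite /GRing.scale/= fctE /stp_slope; move: D0.
move: (flat 1 t) (flat 1 (1 - t)) (flat (flat_next 1) t) (flat (flat_next 1) (1 - t)) => p q p' q' D0.
by field.
Qed.

Lemma stp_slope_eq0 (t : R) : t <= 0 \/ 1 <= t -> stp_slope t = 0.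
Proof.
have f0 p (z : R) : z <= 0 -> flat p z = 0 by rewrite /flat ltNge => ->.
case=> H; rewrite /stp_slope.
  by rewrite !(f0 _ t)// !mul0r addr0 mul0r.
by rewrite !(f0 _ (1 - t)) ?subr_le0// !mulr0 addr0 mul0r.
Qed.

(** The slope is continuous and vanishes off [[0, 1]], so its maximum on that segment is a bound; 1
    is added to make it positive. *)
Lemma stp_slope_bounded : exists2 C : R, 0 < C & forall t, `|stp_slope t| <= C.
Proof.
have cf p : continuous (@flat R p).
  by move=> t; apply/differentiable_continuous/derivable1_diffP; have [] := @flat_derive R p t.
have cf1 p : continuous (fun t : R => flat p (1 - t)).
  move=> t; apply: (@continuous_comp _ _ _ (fun t : R => 1 - t) (flat p)); last exact: cf.
  by apply: continuousB; [exact: cst_continuous|exact: id].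
have ca : continuous (fun t : R => `|stp_slope t|).
  move=> t; apply: (@continuous_comp _ _ _ stp_slope Num.norm); last exact: norm_continuous.
  apply: (@continuousM R _ (fun t => _) (fun t => _)).
    apply: (@continuousD R _ _ (fun t => _) (fun t => _)).
      by apply: (@continuousM R _ (fun t => _) (fun t => _)); [exact: cf|exact: cf1].
    by apply: (@continuousM R _ (fun t => _) (fun t => _)); [exact: cf|exact: cf1].
  apply: (@continuousV R _ (fun t => _)); first by rewrite gt_eqF// exprn_gt0// stp_den_gt0.
  have cD : {for t, continuous (fun t : R => flat 1 t + flat 1 (1 - t))}.
    by apply: (@continuousD R _ _ (fun t => _) (fun t => _)); [exact: cf|exact: cf1].
  exact: (@continuousM R _ _ _ _ cD cD).
have [t0 _ H] := @EVT_max R (fun t => `|stp_slope t|) 0 1 ler01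
  (continuous_subspaceT ca).
exists (`|stp_slope t0| + 1) => [|t]; first by rewrite ltr_wpDl.
have [/andP[t1 t2]|] := boolP (0 <= t <= 1).
  by rewrite (le_trans (H t _)) ?lerDl// in_itv/= t1.
rewrite negb_and -!ltNge => /orP H'; rewrite stp_slope_eq0 ?normr0 ?addr_ge0//.
by case: H' => /ltW; [left|right].
Qed.

(** The divergence integrates to zero by [integral_pd_eq0], so that only [g] contributes. *)
Lemma Rintegral_div_le (a M : R) (y : 'I_3 -> pt3 R -> R) (g : pt3 R -> R) :
  (forall i, sm setT (y i)) -> (forall i x, ~ cube a x -> y i x = 0) ->
  continuous g -> (forall x, ~ cube a x -> g x = 0) ->
  (\int[leb3 R]_x `|g x|%:E <= M%:E)%E ->
  `|\int[leb3 R]_x (\sum_i pd i (y i) x - g x)| <= M.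
Proof.
move=> sy y0 cg g0 gM.
have p0 i x : ~ cube a x -> pd i (y i) x = 0.
  move=> xa; rewrite -[RHS](@pd_cst R i 0 x); apply: (@eq_on_pd R (~` cube a)) => //.
    by apply: closed_openC; exact: cube_closed.
  by move=> z za; rewrite y0.
have cp i : continuous (pd i (y i)).
  by move=> x; apply: differentiable_continuous; exact: sm_diff (sm_pd i (sy i)) I.
have zp i : \int[leb3 R]_x pd i (y i) x = 0.
  by rewrite /Rintegral (integral_pd_eq0 (fun x => sm_diff (sy i) I) (cp i) (y0 i)).
have cD (h k : pt3 R -> R) : continuous h -> continuous k -> continuous (fun x => h x + k x).
  by move=> ch ck x; apply: (@continuousD R _ _ h k); [exact: ch|exact: ck].
have z0 (h k : pt3 R -> R) : (forall x, ~ cube a x -> h x = 0) ->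
    (forall x, ~ cube a x -> k x = 0) -> forall x, ~ cube a x -> h x + k x = 0.
  by move=> h0 k0 x xa; rewrite h0// k0// addr0.
have -> : (fun x => \sum_i pd i (y i) x - g x) = (fun x => (pd ord0 (y ord0) x +
    (pd (lift ord0 ord0) (y (lift ord0 ord0)) x +
     pd (lift ord0 (lift ord0 ord0)) (y (lift ord0 (lift ord0 ord0))) x)) - g x).
  by apply/funext => x; rewrite !big_ord_recl big_ord0 addr0.
have ip i := continuous_csupp_integrable3 (cp i) (p0 i).
have ic := continuous_csupp_integrable3.
rewrite RintegralB//; [|exact: (ic _ a _ (cD _ _ (cp _) (cD _ _ (cp _) (cp _))) (z0 _ _ (p0 _) (z0 _ _ (p0 _) (p0 _))))|exact: (ic _ a _ cg g0)].
rewrite RintegralD//; last exact: (ic _ a _ (cD _ _ (cp _) (cp _)) (z0 _ _ (p0 _) (p0 _))).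
rewrite RintegralD// !zp !add0r normrN.
have ig := ic _ a _ cg g0.
rewrite (le_trans (le_normr_Rintegral measurableT ig))//.
rewrite -lee_fin /Rintegral fineK//.
by apply: integrable_fin_num => //; exact: integrable_norm.
Qed.

Lemma smn_setU N (U V : set (pt3 R)) g : smn N U g -> smn N V g -> smn N (U `|` V) g.
Proof.
elim: N g => [|N IH] g [dU sU] [dV sV]; split => //; try by move=> x [/dU|/dV].
by move=> i; apply: IH; [exact: sU|exact: sV].
Qed.

Lemma csm_setU (U V : set (pt3 R)) g : csm U g -> csm V g -> csm (U `|` V) g.
Proof. by move=> [u1 u2] [v1 v2]; split=> N; exact: smn_setU. Qed.

Lemma sm_enorm2 (U : set (pt3 R)) : open U -> sm U (fun x => enorm x ^+ 2).
Proof.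
move=> oU; have s2 i : sm U (fun x => coord3 i x * coord3 i x).
  by apply: smM => //; exact: sm_coord3.
apply: (sm_ext oU _ (smD oU (smD oU (s2 ord0) (s2 (lift ord0 ord0)))
  (s2 (lift ord0 (lift ord0 ord0))))) => x _.
by rewrite enorm2.
Qed.

Lemma sm_continuous (g : pt3 R -> R) : sm setT g -> continuous g.
Proof. by move=> sg x; apply: differentiable_continuous; exact: sm_diff sg I. Qed.

Lemma pd_enorm2 i x : pd i (fun x => enorm x ^+ 2) x = 2 * coord3 i x.
Proof.
have -> : (fun x : pt3 R => enorm x ^+ 2) = (fun y =>
   coord3 ord0 y * coord3 ord0 y + (coord3 (lift ord0 ord0) y * coord3 (lift ord0 ord0) y +
   coord3 (lift ord0 (lift ord0 ord0)) y * coord3 (lift ord0 (lift ord0 ord0)) y)).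
  by apply/funext => y; rewrite enorm2 addrA.
have dc j := @coord3_differentiable R j x.
have dM j : differentiable (fun y => coord3 j y * coord3 j y) x.
  exact: (differentiableM (dc j) (dc j)).
have pM j : pd i (fun y => coord3 j y * coord3 j y) x = 2 * coord3 j x * (i == j)%:R.
  by rewrite (pdM i (dc j) (dc j)) pd_coord3; ring.
rewrite (pdD i (dM _)); last by apply: differentiableD; exact: dM.
rewrite (pdD i (dM _) (dM _)) !pM; clear.
by case: i => [[|[|[|//]]] Hi]; rewrite /coord3 /= /bump/=; ring.
Qed.

Lemma enorm2_open (P : R -> Prop) : open [set t | P t] -> open [set x : pt3 R | P (enorm x ^+ 2)].
Proof.
move=> oP; have /continuousP := sm_continuous (sm_enorm2 (@openT (pt3 R))).
exact.
Qed.

(** Compactness of the cube: a point of the sphere has a neighbourhood inside [U], and near any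
    other point the premise fails for small [e]. Distances to the sphere are measured through
    [enorm x ^+ 2], which is a polynomial. *)
Lemma shell_near (a r : R) (U : set (pt3 R)) : open U -> 0 < r -> sphere3 r `<=` U ->
  \forall e \near 0^'+, forall x, cube a x -> `|enorm x ^+ 2 - r ^+ 2| <= e -> U x.
Proof.
move=> oU r0 rU.
pose P (e : R) x := `|enorm x ^+ 2 - r ^+ 2| <= e -> U x.
have : near_covering (cube a) by apply/compact_near_coveringP; exact: cube_compact.
move=> /(_ R 0^'+ P _) H; apply: H => x _.
have [xr|xr] := eqVneq (enorm x ^+ 2) (r ^+ 2).
  have Ux : U x.
    by apply: rU; rewrite /sphere3/=; apply/eqP; rewrite -(@eqrXn2 _ 2)// ?enorm_ge0 ?ltW// xr.
  exists (U, setT) => [|[y e] [/= Uy _] _ //].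
  by split => //=; [apply: open_nbhs_nbhs|exact: filterT].
pose q := `|enorm x ^+ 2 - r ^+ 2|; have q0 : 0 < q by rewrite normr_gt0 subr_eq0.
have oV : open [set y : pt3 R | q / 2 < `|enorm y ^+ 2 - r ^+ 2|].
  apply: (@enorm2_open (fun t => q / 2 < `|t - r ^+ 2|)).
  have cn : continuous (fun t : R => `|t - r ^+ 2|).
    move=> t; apply: (@continuous_comp _ _ _ (fun t : R => t - r ^+ 2) Num.norm); last exact: norm_continuous.
    by apply: continuousB; [exact: id|exact: cst_continuous].
  by move/continuousP : cn => /(_ [set z | q / 2 < z]); apply; exact: open_gt.
exists ([set y : pt3 R | q / 2 < `|enorm y ^+ 2 - r ^+ 2|], [set e : R | e < q / 2]).
  split => /=; last by apply: nbhs_right_lt; rewrite divr_gt0.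
  by apply: open_nbhs_nbhs; split => //=; rewrite -/q; lra.
by move=> [y e] /= [ye eq]; rewrite /P leNgt (lt_trans eq).
Qed.

(** The solution is smooth only near the sphere. Multiplied by a cutoff it becomes smooth everywhere
    and keeps its values in a thin shell, so that Green's identity can be used on the whole
    space. *)
Lemma csm_extension (r : R) (U : set (pt3 R)) (v : pt3 R -> R[i]) :
  open U -> 0 < r -> sphere3 r `<=` U -> csm U v ->
  exists2 u : pt3 R -> R[i], csm setT u &
    \forall e \near 0^'+, forall x, `|enorm x ^+ 2 - r ^+ 2| <= e -> u x = v x.
Proof.
move=> oU r0 rU sv.
have [e [e0 er eU]] : exists e, [/\ 0 < e, e <= r ^+ 2 &
    forall x, `|enorm x ^+ 2 - r ^+ 2| <= 2 * e -> U x].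
  have /filter_ex [e [H e1 e2]] : \forall e \near 0^'+, [/\ forall x, cube (2 * r) x ->
      `|enorm x ^+ 2 - r ^+ 2| <= e -> U x, 0 < e & e <= r ^+ 2].
    near=> e; split; near: e; first exact: shell_near.
      exact: nbhs_right_gt.
    by apply: nbhs_right_le; rewrite exprn_gt0.
  exists (e / 2); split; [lra|lra|move=> x xe]; apply: H; last by rewrite (le_trans xe)//; lra.
  apply: ball_cube; rewrite -(@ler_pXn2r _ 2) ?nnegrE ?enorm_ge0 ?mulr_ge0 ?(ltW r0)//.
  by move: xe; rewrite ler_norml => /andP[_]; rewrite exprMn => ?; nra.
(* The cutoff is 1 while the ratio is at most 1 in modulus and 0 once its square exceeds 2. Squaring
   avoids a nonsmooth modulus; [sqrt 2 < 2] explains why [U] was required to contain the shell of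
   size [2 * e]. *)
pose th x := stp (2 - ((enorm x ^+ 2 - r ^+ 2) / e) ^+ 2).
pose V := [set x : pt3 R | 2 < ((enorm x ^+ 2 - r ^+ 2) / e) ^+ 2].
have sth W : open W -> sm W th.
  move=> oW; apply: (@sm_stp R W (fun x => 2 - ((enorm x ^+ 2 - r ^+ 2) / e) ^+ 2)) => //.
  apply: smB => //; first exact: sm_cst.
  have sq : sm W (fun x => (enorm x ^+ 2 - r ^+ 2) / e).
    by apply: smM => //; [apply: smB => //; [exact: sm_enorm2|exact: sm_cst]|exact: sm_cst].
  exact: smM.
have oV : open V.
  apply: (@enorm2_open (fun t => 2 < ((t - r ^+ 2) / e) ^+ 2)).
  have cn : continuous (fun t : R => ((t - r ^+ 2) / e) ^+ 2).
    move=> t; apply: (@continuous_comp _ _ _ (fun t : R => (t - r ^+ 2) / e) (fun z => z ^+ 2)); last exact: exprn_continuous.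
    apply: continuousM; last exact: cst_continuous.
    by apply: continuousB; [exact: id|exact: cst_continuous].
  by move/continuousP : cn => /(_ [set z | 2 < z]); apply; exact: open_gt.
have UV : U `|` V = setT.
  apply/seteqP; split=> // x _; have [Vx|Vx] := pselect (V x); [by right|left].
  apply: eU; move/negP: Vx; rewrite -leNgt => Vx; rewrite -ler_pdivrMr// -(gtr0_norm e0).
  rewrite -normf_div; move: Vx; move: (_ / e) => t t2.
  by rewrite ler_norml; apply/andP; split; nra.
exists (fun x => cplx th x * v x).
  rewrite -UV; apply: csm_setU; first by apply: csmM => //; apply: csm_cplx; exact: sth.
  apply: (csm_ext oV _ (csm_cst V 0)) => x Vx.
  by rewrite /cplx /th stp0 ?mul0r// subr_le0 ltW.
near=> e1 => x xe; have {}xe : `|enorm x ^+ 2 - r ^+ 2| <= e.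
  by rewrite (le_trans xe)//; near: e1; apply: nbhs_right_le.
rewrite /cplx /th stp1 ?mul1r//.
have : `|(enorm x ^+ 2 - r ^+ 2) / e| <= 1.
  by rewrite normf_div (gtr0_norm e0) ler_pdivrMr// mul1r.
move: (_ / e) => t; rewrite ler_norml => /andP[t1 t2]; nra.
Unshelve. all: by end_near.
Qed.

(** For [p = r] the scaled point is [x] itself and [lam] is slack; compactness of the cube makes the
    admissible range of [p] uniform in [x]. The energy on nearby spheres is thereby compared with
    that on the sphere of radius [r]. *)
Lemma ray_uniform (r lam : R) (E : pt3 R -> R) : 0 < r -> continuous E -> 0 < lam ->
  \forall p \near r, forall x, cube r x -> E (p / r * x.1.1, p / r * x.1.2, p / r * x.2) <= E x + lam.
Proof.
move=> r0 cE l0.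
pose P (p : R) x := E (p / r * x.1.1, p / r * x.1.2, p / r * x.2) <= E x + lam.
have : near_covering (cube r) by apply/compact_near_coveringP; exact: cube_compact.
move=> /(_ R (nbhs r) P _) H; apply: H => x _.
pose F (z : pt3 R * R) := E (z.2 / r * z.1.1.1, z.2 / r * z.1.1.2, z.2 / r * z.1.2) - E z.1.
have cF : {for (x, r), continuous F}.
  apply: (@continuousB _ R^o _ (fun z : pt3 R * R => E (z.2 / r * z.1.1.1, z.2 / r * z.1.1.2, z.2 / r * z.1.2)) (fun z => E z.1)).
    have cM (k : pt3 R -> R) : continuous k ->
        {for (x, r), continuous (fun z : pt3 R * R => z.2 / r * k z.1)}.
      move=> ck; apply: (@continuousM R _ (fun z : pt3 R * R => z.2 / r) (fun z => k z.1)).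
        by apply: continuousM; [exact: cvg_snd|exact: cst_continuous].
      exact: (continuous_comp cvg_fst (ck _)).
    apply: (@continuous_comp _ _ _ (fun z : pt3 R * R =>
      (z.2 / r * z.1.1.1, z.2 / r * z.1.1.2, z.2 / r * z.1.2)) E); last exact: cE.
    apply: continuous_pairf; last exact: (cM (fun x => x.2) (fun x => cvg_snd)).
    apply: continuous_pairf.
      exact: (cM (fun x => x.1.1) (fun x => cvg_comp _ _ cvg_fst cvg_fst)).
    exact: (cM (fun x => x.1.2) (fun x => cvg_comp _ _ cvg_fst cvg_snd)).
  exact: (continuous_comp cvg_fst (cE _)).
have F0 : F (x, r) < lam by rewrite /F/= divff ?gt_eqF// !mul1r -!surjective_pairing subrr.
have := cF _ (@open_nbhs_nbhs _ _ [set t | t < lam] (conj (@open_lt _ _) F0)).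
apply: (@filterS _ (nbhs (x, r)) _ (F @^-1` [set t | t < lam])) => -[y p].
by rewrite /= /F/P/= => ?; lra.
Unshelve. all: by end_near.
Qed.

Local Notation leb := (@lebesgue_measure R).
Local Notation mT := (measurableTypeR R).

Lemma sphere_integral_mono (r : R) (g h : pt3 R -> R) : (forall x, 0 <= g x) ->
  (forall t f, g (sphere_pt r t f) <= h (sphere_pt r t f)) ->
  (sphere_integral r g <= sphere_integral r h)%E.
Proof.
move=> g0 gh; have s0 (t : R) : `[0, pi]%classic t -> 0 <= r ^+ 2 * sin t.
  by move=> /sin_ge0_pi ?; rewrite mulr_ge0 ?sqr_ge0.
apply: ge0_le_integral_nonmeasurable => t /s0 t0.
  by apply: integral_ge0 => f _; rewrite lee_fin mulr_ge0.
apply: ge0_le_integral_nonmeasurable => f _; rewrite lee_fin; first by rewrite mulr_ge0.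
by rewrite ler_wpM2r.
Qed.

(** For the constant term [sin t] is replaced by 1, hence the area [2 * pi * pi] instead of
    [4 * pi]. *)
Lemma sphere_integral_affine (r al be : R) (g : pt3 R -> R) : continuous g ->
  (forall x, 0 <= g x) -> 0 <= al -> 0 <= be ->
  (sphere_integral r (fun x => (al * g x + be)%R) <=
   al%:E * sphere_integral r g + (be * r ^+ 2 * (2 * pi) * pi)%:E)%E.
Proof.
move=> cg g0 al0 be0.
pose B (z : R * R) : R := g (sphere_pt r z.2 z.1) * (r ^+ 2 * `|sin z.2|).
have cB : continuous B.
  move=> z; apply: (@continuousM R _ (fun z : R * R => g (sphere_pt r z.2 z.1))
    (fun z : R * R => r ^+ 2 * `|sin z.2|)).
    apply: (@continuous_comp _ _ _ (fun z : R * R => sphere_pt r z.2 z.1) g); last exact: cg.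
    apply: (@continuous_comp _ _ _ (fun z : R * R => (z.2, z.1)) (fun z : R * R => sphere_pt r z.1 z.2)).
      by apply: continuous_pairf; [exact: cvg_snd|exact: cvg_fst].
    exact: sphere_pt_continuous2.
  apply: (@continuous_comp _ _ _ (fun z : R * R => `|sin z.2|) (fun t => r ^+ 2 * t)).
    apply: (@continuous_comp _ _ _ (fun z : R * R => sin z.2) (fun t => `|t|)).
      exact: (continuous_comp cvg_snd (@continuous_sin _ _)).
    exact: norm_continuous.
  exact: mulrl_continuous.
pose H (z : R * R) := (B z)%:E.
have mH : measurable_fun [set: mT * mT] H.
  by apply/measurable_EFinP; exact: continuous2_measurable.
have H0 z : (0 <= H z)%E by rewrite lee_fin mulr_ge0// mulr_ge0 ?sqr_ge0.
have mA : measurable (`[0, 2 * pi]%classic : set R) by exact: measurable_itv.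
have mP : measurable (`[0, pi]%classic : set R) by exact: measurable_itv.
pose J (y : R) : \bar R := (\int[leb]_(x in `[0%R, (2 * pi)%R]) H (x, y))%E.
have mJ : measurable_fun (`[0, pi]%classic : set mT) J.
  by apply: measurable_funTS; exact: (measurable_partial_integral mA mH H0).
have J0 y : (0 <= J y)%E by apply: integral_ge0 => x _; exact: (H0 (x, y)).
have p0 := pi_gt0 R.
have JE t : `[0, pi]%classic t ->
    J t = (\int[leb]_(f in `[0%R, (2 * pi)%R]) (g (sphere_pt r t f) * (r ^+ 2 * sin t))%:E)%E.
  move=> /sin_ge0_pi t0; apply: eq_integral => f _.
  by rewrite /H /B/= ger0_norm.
have -> : sphere_integral r g = (\int[leb]_(t in `[0%R, pi]) J t)%E.
  by apply: eq_integral => t; rewrite inE => /JE ->.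
have cstE (A : set R) (y : R) : measurable A ->
    (\int[leb]_(x in A) y%:E = y%:E * leb A)%E.
  by move=> mA'; exact: (@integral_cst _ mT R leb A mA' y%:E).
have br : 0 <= be * r ^+ 2 by exact: mulr_ge0 be0 (sqr_ge0 r).
have bpi : 0 <= be * r ^+ 2 * (2 * pi) by apply: mulr_ge0 => //; apply: mulr_ge0 => //; exact: ltW.
apply: (@le_trans _ _ (\int[leb]_(t in `[0%R, pi]) (al%:E * J t + (be * r ^+ 2 * (2 * pi))%:E))%E).
  apply: ge0_le_integral_nonmeasurable => t t0; have s0 := sin_ge0_pi t0.
    apply: integral_ge0 => f _; rewrite lee_fin; apply: mulr_ge0; first by rewrite addr_ge0// mulr_ge0.
    exact: mulr_ge0 (sqr_ge0 r) s0.
  apply: (@le_trans _ _ (\int[leb]_(f in `[0%R, (2 * pi)%R]) (al%:E * H (f, t) + (be * r ^+ 2)%:E))%E).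
    apply: ge0_le_integral_nonmeasurable => f _.
      rewrite lee_fin; apply: mulr_ge0; first by rewrite addr_ge0// mulr_ge0.
      exact: mulr_ge0 (sqr_ge0 r) s0.
    rewrite /H /B/= -EFinM -EFinD lee_fin ger0_norm// mulrDl -[al * _ * _]mulrA lerD2l.
    by rewrite ler_wpM2l// ler_piMr ?sqr_ge0// sin_le1.
  have mHt := section_measurable t mA mH.
  rewrite ge0_integralD//; last 2 first.
  - by move=> f _; apply: mule_ge0; [rewrite lee_fin|exact: (H0 (f, t))].
  - by apply: emeasurable_funM => //; exact: measurable_cst.
  rewrite (@ge0_integralZl_EFin _ mT R leb _ mA _ (fun f _ => H0 (f, t)) mHt _ al0) leeD2l//.
  rewrite (cstE _ _ mA) lebesgue_measure_itv/= lte_fin mulr_gt0//.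
  by rewrite -EFinD -EFinM subr0.
rewrite ge0_integralD//; last 2 first.
- by move=> t _; apply: mule_ge0; [rewrite lee_fin|exact: J0].
- by apply: emeasurable_funM => //; exact: measurable_cst.
rewrite (@ge0_integralZl_EFin _ mT R leb _ mP _ (fun t _ => J0 t) mJ _ al0) leeD2l//.
rewrite (cstE _ _ mP) lebesgue_measure_itv/= lte_fin p0.
by rewrite -EFinD -EFinM subr0.
Qed.

Lemma enorm_sphere_pt (p t f : R) : 0 <= p -> enorm (sphere_pt p t f) = p.
Proof.
move=> p0; apply/eqP; rewrite -(@eqrXn2 _ 2)// ?enorm_ge0// enorm2 /sphere_pt/=.
have st := cos2Dsin2 t; have sf := cos2Dsin2 f; apply/eqP.
transitivity (p ^+ 2 * (sin t ^+ 2 * (cos f ^+ 2 + sin f ^+ 2) + cos t ^+ 2)); first by ring.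
by rewrite sf mulr1 [_ + cos t ^+ 2]addrC st mulr1.
Qed.

(** The radial variable is [enorm x ^+ 2] rather than [enorm x], so that no square root is
    differentiated; in the radius the transition layer has width of order [e / r]. *)
Definition shell_cut (r e : R) x : R := stp ((r ^+ 2 + e - enorm x ^+ 2) / (2 * e)).

Lemma shell_cut1 (r e : R) x : 0 < e -> enorm x ^+ 2 <= r ^+ 2 - e -> shell_cut r e x = 1.
Proof.
by move=> e0 xe; rewrite /shell_cut stp1// ler_pdivlMr ?mulr_gt0//; lra.
Qed.

Lemma shell_cut0 (r e : R) x : 0 < e -> r ^+ 2 + e <= enorm x ^+ 2 -> shell_cut r e x = 0.
Proof.
by move=> e0 xe; rewrite /shell_cut stp0// ler_pdivrMr ?mulr_gt0//; lra.
Qed.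

Lemma sm_shell_cut (r e : R) : sm setT (shell_cut r e).
Proof.
have oT := @openT (pt3 R).
apply: (@sm_stp R setT (fun x => (r ^+ 2 + e - enorm x ^+ 2) / (2 * e)) oT).
apply: smM => //; last exact: sm_cst.
by apply: smB => //; [exact: sm_cst|exact: sm_enorm2].
Qed.

Lemma pd_shell_cut (r e : R) i x : 0 < e -> pd i (shell_cut r e) x =
  - (stp_slope ((r ^+ 2 + e - enorm x ^+ 2) / (2 * e)) * coord3 i x / e).
Proof.
move=> e0; pose h (t : R) := stp ((r ^+ 2 + e - t) / (2 * e)).
have dh (t : R) : is_derive t 1 h (- (stp_slope ((r ^+ 2 + e - t) / (2 * e)) / (2 * e))).
  have d1 := is_deriveB (is_derive_cst (r ^+ 2 + e : R) t 1) (is_derive_id t 1).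
  have d2 := @is_deriveZ R R R _ ((2 * e)^-1) t 1 _ d1.
  have := @is_derive1_comp R (@stp R) (fun t => (r ^+ 2 + e - t) / (2 * e)) t _ (- (2 * e)^-1)
    (stp_derive _).
  rewrite mulrN; apply.
  rewrite (_ : (fun _ => _) = (2 * e)^-1 *: (cst (r ^+ 2 + e) - id)); last first.
    by apply/funext => z; rewrite /= mulrC.
  by apply: is_derive_eq d2 _; rewrite /GRing.scale/= sub0r mulrN1.
have := @pd_comp R i (fun x => enorm x ^+ 2) h _ x
  (sm_diff (sm_enorm2 (@openT (pt3 R))) I) (dh _).
rewrite pd_enorm2 => ->.
by field; rewrite gt_eqF.
Qed.

Lemma pd_shell_cut_eq0 (r e : R) i x : 0 < e -> e < `|enorm x ^+ 2 - r ^+ 2| ->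
  pd i (shell_cut r e) x = 0.
Proof.
move=> e0 xe; rewrite pd_shell_cut// stp_slope_eq0 ?mul0r ?oppr0//.
by move: xe; rewrite lter_normr ler_pdivrMr ?mulr_gt0// ler_pdivlMr ?mulr_gt0// => /orP[]?;
  [left|right]; lra.
Qed.

(** Each derivative multiplies the wave by a factor of modulus at most [S], and at most three
    derivatives occur; [3 * a] bounds [dot3 d x] coordinate by coordinate. *)
Lemma pw_bounds (S a : R) s d x i : enorm d = 1 -> cmod s <= S -> enorm x <= a ->
  let W := expR (3 * a * S) * (1 + S) ^+ 3 in
  [/\ cmod (pw s d x) <= W, cmod (partial3 i (pw s d) x) <= W,
     cmod (laplacian (pw s d) x) <= W & cmod (partial3 i (laplacian (pw s d)) x) <= W].
Proof.
move=> d1 sS xa W; pose e := expR (3 * a * S).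
have S0 : 0 <= S := le_trans (cmod_ge0 _) sS.
have a0 : 0 <= a := le_trans (enorm_ge0 _) xa.
have e0 : 0 < e by exact: expR_gt0.
have cd j : `|coord3 j d| <= 1 by rewrite -d1 enorm_coord3.
have dx : `|dot3 d x| <= 3 * a.
  rewrite /dot3 (le_trans (ler_norm_sum _ _ _))// (le_trans (@ler_sum _ _ _ _ _ (fun=> a) _))//.
    move=> j _; rewrite normrM -[leRHS]mul1r ler_pM//.
    exact: (le_trans (enorm_coord3 _ _)).
  by rewrite !big_ord_recl big_ord0; lra.
have w0 : cmod (pw s d x) <= e.
  rewrite /cmod /= !exprMn -mulrDr cos2Dsin2 mulr1 sqrtr_sqr ger0_norm ?expR_ge0//.
  rewrite ler_expR (le_trans (ler_norm _))// normrM normrN mulrC.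
  by rewrite ler_pM// (le_trans (normIm_cmod _)).
have pE j y : partial3 j (pw s d) y = (0 +i* 1)%C * s * (coord3 j d)%:C%C * pw s d y.
  exact: partial3_pw.
have lE : laplacian (pw s d) = fun y => - s ^+ 2 * pw s d y.
  by apply/funext => y; exact: laplacian_pw.
have i1 : cmod ((0 +i* 1)%C : R[i]) = 1 by rewrite /cmod/= expr0n expr1n add0r sqrtr1.
have W1 : forall m, (m <= 3)%N -> S ^+ m * e <= W.
  move=> m m3; rewrite /W mulrC ler_wpM2l ?(ltW e0)//.
  rewrite (@le_trans _ _ ((1 + S) ^+ m))// ?lerXn2r ?nnegrE ?addr_ge0 ?lerDr//.
  by rewrite ler_weXn2l// lerDl.
have pb : cmod (partial3 i (pw s d) x) <= S * e.
  rewrite pE !cmodM i1 mul1r cmod_cplx ler_pM ?mulr_ge0 ?cmod_ge0//.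
  by rewrite -[leRHS]mulr1 ler_pM ?cmod_ge0.
have s2 : cmod (- s ^+ 2) <= S ^+ 2.
  by rewrite cmodN expr2 cmodM -expr2 lerXn2r ?nnegrE ?cmod_ge0.
split.
- by have := W1 0%N isT; rewrite expr0 mul1r; exact: le_trans.
- by have := W1 1%N isT; rewrite expr1; exact: le_trans.
- by rewrite lE cmodM (le_trans _ (W1 2%N isT))// ler_pM ?cmod_ge0.
- rewrite lE partial3Z; last exact: (csm_cdiff (csm_pw s d (@openT _)) I).
  by rewrite cmodM (le_trans _ (W1 3%N isT))// (exprSr S 2) -mulrA ler_pM ?cmod_ge0.
Qed.

Lemma Re_sum N (F : 'I_N -> R[i]) : complex.Re (\sum_i F i) = \sum_i complex.Re (F i).
Proof. exact: (big_morph (@complex.Re R) (@ReD R) erefl). Qed.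

Lemma Im_sum N (F : 'I_N -> R[i]) : complex.Im (\sum_i F i) = \sum_i complex.Im (F i).
Proof. exact: (big_morph (@complex.Im R) (@ImD R) erefl). Qed.

(** The density of [boundary_norm2] with all weights in [k] set to 1; the two are comparable from
    one side once [k] is bounded below. *)
Definition energy (u : pt3 R -> R[i]) x : R :=
  cmod (u x) ^+ 2 + grad_norm2 u x + cmod (laplacian u x) ^+ 2 + grad_norm2 (laplacian u) x.

Lemma energy_ge0 u x : 0 <= energy u x.
Proof.
have g0 g : 0 <= grad_norm2 g x by apply: sumr_ge0 => i _; exact: sqr_ge0.
by rewrite /energy !addr_ge0 ?sqr_ge0.
Qed.

Lemma energy_continuous u : csm setT u -> continuous (energy u).
Proof.
move=> su; have oT := @openT (pt3 R).
have sum3 (F : 'I_3 -> R) :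
    F ord0 + (F (lift ord0 ord0) + F (lift ord0 (lift ord0 ord0))) = \sum_i F i.
  by rewrite !big_ord_recl big_ord0 addr0.
have s2 (g : pt3 R -> R[i]) : csm setT g -> sm setT (fun x => cmod (g x) ^+ 2).
  move=> [sr si]; apply: (sm_ext oT _ (smD oT (smM oT sr sr) (smM oT si si))) => x _.
  by rewrite cmod2 !expr2.
have sg (g : pt3 R -> R[i]) : csm setT g -> sm setT (grad_norm2 g).
  move=> cg; have sp i := s2 _ (csm_partial3 i cg).
  apply: (sm_ext oT _ (smD oT (sp ord0) (smD oT (sp (lift ord0 ord0))
    (sp (lift ord0 (lift ord0 ord0)))))) => x _.
  exact: sum3 (fun i => cmod (partial3 i g x) ^+ 2).
have sl := csm_laplacian oT su.
exact: sm_continuous (smD oT (smD oT (smD oT (s2 _ su) (sg _ su)) (s2 _ sl)) (sg _ sl)).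
Qed.

(** The field is linear in [u] and the energy quadratic; [t <= t ^+ 2 / lam + lam] passes from one
    to the other, and [lam = eta] is the balanced choice for an energy of order [eta ^+ 2]. The 12
    counts four terms in three directions, the 3 the terms that do not depend on the direction. *)
Lemma green_field_bound (lam W : R) u w x : 0 < lam -> 0 <= W ->
  (forall i, [/\ cmod (w x) <= W, cmod (partial3 i w x) <= W,
     cmod (laplacian w x) <= W & cmod (partial3 i (laplacian w) x) <= W]) ->
  \sum_i cmod (green_field w u i x) <= W * (3 * (energy u x / lam) + 12 * lam).
Proof.
move=> l0 W0 wW.
pose sq (z : R[i]) := cmod z ^+ 2 / lam + lam.
have am z : cmod z <= sq z.
  rewrite /sq -(ler_pM2r l0) mulrDl divfK ?gt_eqF//.
  have := cmod_ge0 z; move: (cmod z) => t; nra.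
have b1 i : cmod (green_field w u i x) <= W * (sq (partial3 i (laplacian u) x) +
    sq (laplacian u x) + sq (partial3 i u x) + sq (u x)).
  have [h1 h2 h3 h4] := wW i.
  rewrite /green_field /cross_diff.
  rewrite (le_trans (cmodD _ _))//.
  apply: (@le_trans _ _ ((cmod (w x) * cmod (partial3 i (laplacian u) x) +
    cmod (laplacian u x) * cmod (partial3 i w x)) +
    (cmod (laplacian w x) * cmod (partial3 i u x) + cmod (u x) * cmod (partial3 i (laplacian w) x)))).
    by apply: lerD; rewrite (le_trans (cmodD _ _))// cmodN !cmodM.
  have m1 (a : R) z : 0 <= a -> a <= W -> a * cmod z <= W * sq z.
    by move=> a0 aW; rewrite ler_pM ?cmod_ge0.
  have adds (a b c e A B C D : R) : a <= W * A -> b <= W * B -> c <= W * C -> e <= W * D ->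
    a + b + (c + e) <= W * (A + B + C + D) by rewrite !mulrDr; lra.
  apply: adds; first by apply: m1 h1; exact: cmod_ge0.
  - by rewrite mulrC; apply: m1 h2; exact: cmod_ge0.
  - by apply: m1 h3; exact: cmod_ge0.
  - by rewrite mulrC; apply: m1 h4; exact: cmod_ge0.
apply: (@le_trans _ _ (\sum_i W * (sq (partial3 i (laplacian u) x) +
    sq (laplacian u x) + sq (partial3 i u x) + sq (u x)))); first by apply: ler_sum => i _; exact: b1.
rewrite -mulr_sumr ler_wpM2l//.
have sumE (F G : 'I_3 -> R) (A B : R) : 0 <= A -> 0 <= B -> (forall i, 0 <= F i) ->
    (forall i, 0 <= G i) -> \sum_i ((F i / lam + lam) + (A / lam + lam) + (G i / lam + lam)
      + (B / lam + lam)) <= 3 * ((B + \sum_i G i + A + \sum_i F i) / lam) + 12 * lam.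
  move=> A0 B0 F0 G0; rewrite !big_ord_recl !big_ord0 !addr0.
  have d0 t : 0 <= t -> 0 <= t / lam by move=> t0; rewrite divr_ge0// ltW.
  have := (d0 _ (F0 ord0), d0 _ (F0 (lift ord0 ord0)), d0 _ (F0 (lift ord0 (lift ord0 ord0))),
    d0 _ (G0 ord0), d0 _ (G0 (lift ord0 ord0)), d0 _ (G0 (lift ord0 (lift ord0 ord0)))).
  move=> [[[[[p1 p2] p3] p4] p5] p6]; rewrite !mulrDl; lra.
by apply: sumE => *; exact: sqr_ge0.
Qed.

(** The layer [|p ^+ 2 - r ^+ 2| <= e] lies in [|p - r| <= e / r], because [p + r >= r]. *)
Definition shell_weight (r e k0 p : R) : R :=
  k0 * \1_(`[(r - e / r)%R, (r + e / r)%R]%classic : set R) p.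

Lemma shell_weight_ge0 (r e k0 p : R) : 0 <= k0 -> 0 <= shell_weight r e k0 p.
Proof. by move=> k00; rewrite /shell_weight indicE mulr_ge0. Qed.

(** An interval of length [2 * e / r] on which [p <= 2 * r], so that [p ^+ 2 / r ^+ 2 <= 4]. For
    [k0] of order [1 / e] the bound is independent of [e]. *)
Lemma shell_weight_integral (r e k0 : R) : 0 < r -> 0 < e -> e <= r ^+ 2 -> 0 <= k0 ->
  (\int[leb]_(p in `]0%R, +oo[) (shell_weight r e k0 p * p ^+ 2 / r ^+ 2)%:E <=
   (8 * k0 * e / r)%:E)%E.
Proof.
move=> r0 e0 er k00; pose A : set R := `[(r - e / r)%R, (r + e / r)%R]%classic.
have mA : measurable A by exact: measurable_itv.
have m1 : measurable (`]0%R, +oo[%classic : set R) by exact: measurable_itv.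
have m1A : measurable_fun [set: mT] (fun p : mT => (\1_A p : R)%:E).
  by apply/measurable_EFinP; exact: measurable_indic.
have mI : measurable_fun [set: mT] (fun p : mT => ((4 * k0)%:E * (\1_A p : R)%:E)%E).
  by apply: emeasurable_funM => //; exact: measurable_cst.
have err : e / r <= r by rewrite ler_pdivrMr// -expr2.
have d0 : 0 < e / r by rewrite divr_gt0.
apply: (@le_trans _ _ (\int[leb]_(p in setT) ((4 * k0)%:E * (\1_A p : R)%:E))%E).
  apply: (@le_trans _ _ (\int[leb]_(p in `]0%R, +oo[) ((4 * k0)%:E * (\1_A p : R)%:E))%E).
    apply: ge0_le_integral_nonmeasurable => p; rewrite /= in_itv/= andbT => p0.
      rewrite lee_fin; apply: divr_ge0; last exact: sqr_ge0.
      by apply: mulr_ge0; [exact: shell_weight_ge0|exact: sqr_ge0].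
    rewrite -EFinM lee_fin /shell_weight indicE; case: (boolP (p \in A)); last by rewrite !(mulr0, mul0r).
    rewrite inE /A/= in_itv/= => /andP[p1 p2]; rewrite !mulr1.
    have p2r : p ^+ 2 <= (2 * r) ^+ 2 by rewrite lerXn2r ?nnegrE; lra.
    rewrite ler_pdivrMr ?exprn_gt0// [4 * k0]mulrC -mulrA ler_wpM2l//.
    by rewrite (le_trans p2r)// exprMn; lra.
  apply: (@ge0_subset_integral _ mT R leb _ _ m1 measurableT _ mI) => // p _.
  by rewrite -EFinM lee_fin mulr_ge0 ?mulr_ge0// indicE.
rewrite (@ge0_integralZl_EFin _ mT R leb _ measurableT _ _ m1A) ?mulr_ge0//.
have lebA : leb A = (2 * e / r)%:E.
  rewrite /A lebesgue_measure_itv/= lte_fin ifT; last by lra.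
  by rewrite -EFinD; congr (_%:E); field; rewrite gt_eqF.
have -> : (\int[leb]_x (\1_A x)%:E = (2 * e / r)%:E)%E.
  by rewrite (@integral_indic _ mT R leb setT measurableT A mA) setIT.
rewrite -EFinM lee_fin le_eqVlt; apply/orP; left; apply/eqP; field.
by rewrite gt_eqF.
Qed.

End BoundaryEstimate.

(** * From the boundary data to the transform of the source *)

Section BoundaryFunctional.
Variable R : realType.
Implicit Types (x d : pt3 R) (s : R[i]).
Local Notation leb := (@lebesgue_measure R).

(** Testing the equation against the cut-off wave leaves an integral over the shell, where one
    derivative of the cutoff costs [1 / e] and the volume gains [e]. The thickness can therefore be
    chosen after [f], [v] and [eta], and [C] is uniform in all of them as well as in [k], [s] and
    [d]. *)
Lemma boundary_functional (rhat r sigma K S0 : R) : 0 < rhat -> rhat < r -> 0 < K -> 0 <= S0 ->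
  exists2 C : R, 0 < C & forall (f : pt3 R -> R) (v : pt3 R -> R[i]) (k eta : R) s d,
    K / 2 <= k -> is_solution r sigma k f v ->
    closure [set x | extend0 r f x != 0] `<=` ball3 rhat ->
    s ^+ 4 = (k ^+ 2)%:C%C + (0 +i* (k * sigma))%C -> enorm d = 1 -> cmod s <= S0 ->
    0 < eta -> (boundary_norm2 r k v <= (eta ^+ 2)%:E)%E ->
    `|\int[leb3 R]_x (extend0 r f x * complex.Re (pw s d x))| <= C * eta /\
    `|\int[leb3 R]_x (extend0 r f x * complex.Im (pw s d x))| <= C * eta.
Proof.
move=> rh0 rhr K0 S00; have r0 : 0 < r := lt_trans rh0 rhr.
have [C0 C00 HC0] := stp_slope_bounded R.
pose W := expR (3 * (2 * r) * S0) * (1 + S0) ^+ 3.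
have W0 : 0 < W by rewrite mulr_gt0 ?expR_gt0// exprn_gt0// ltr_wpDr.
(* A common lower bound for all weights of the boundary norm, which are at least [k ^+ 2] or 1; here
   the condition [K / 2 <= k] enters. *)
pose cK := Num.min 1 ((K / 2) ^+ 2).
have cK0 : 0 < cK by rewrite lt_min ltr01/= exprn_gt0// divr_gt0.
have p0 := pi_gt0 R.
pose A := r ^+ 2 * (2 * pi) * pi.
have A0 : 0 < A by rewrite /A; apply: mulr_gt0 => //; apply: mulr_gt0; [exact: exprn_gt0|exact: mulr_gt0].
(* The factor 48 is 6 from the height [k0] of the shell weight times 8 from [shell_weight_integral];
   [cK^-1] pays for the boundary norm and [5 * A] for the additive part of [g]. *)
pose C := 48 * C0 * W * (cK^-1 + 5 * A).
have C_gt0 : 0 < C.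
  apply: mulr_gt0; first by apply: mulr_gt0 => //; apply: mulr_gt0.
  by apply: addr_gt0; [rewrite invr_gt0|apply: mulr_gt0].
exists C => // f v k eta s d kK [Hsol _ _ [U oU [rU /smooth_onP sv]]] supp s4 d1 sS eta0 Hb.
have [u su uv] := csm_extension oU r0 rU sv.
have oT := @openT (pt3 R).
have cE := energy_continuous su.
have E0 := energy_ge0 u.
(* The shell must stay outside [ball3 rhat], lie where [u] and [v] agree, and be so thin that the
   energy varies along rays by at most [eta ^+ 2]. *)
have [e [e0 er eh ev eE]] : exists e, [/\ 0 < e, e <= r ^+ 2, e <= r ^+ 2 - rhat ^+ 2,
    (forall x, `|enorm x ^+ 2 - r ^+ 2| <= e -> u x = v x) &
    forall p x, `|p - r| <= e / r -> cube r x ->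
      energy u (p / r * x.1.1, p / r * x.1.2, p / r * x.2) <= energy u x + eta ^+ 2].
  have /nbhs_ballP[b /= b0 Hb'] := ray_uniform r0 cE (exprn_gt0 2 eta0).
  have /filter_ex [e [H1 H2 H3 H4 H5]] : \forall e \near 0^'+, [/\ 0 < e, e <= r ^+ 2,
      e <= r ^+ 2 - rhat ^+ 2, (forall x, `|enorm x ^+ 2 - r ^+ 2| <= e -> u x = v x) &
      e < b * r].
    near=> e; split; near: e => //; first exact: nbhs_right_gt.
    - by apply: nbhs_right_le; rewrite exprn_gt0.
    - by apply: nbhs_right_le; rewrite subr_gt0 ltrXn2r ?nnegrE ?ltW.
    - by apply: nbhs_right_lt; rewrite mulr_gt0.
  exists e; split=> // p x pr xr; apply: Hb' => //.
  by rewrite /ball/= distrC (le_lt_trans pr)// ltr_pdivrMr.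
pose a := 2 * r.
have big x : ~ cube a x -> r ^+ 2 + e < enorm x ^+ 2.
  move=> xa; rewrite ltNge; apply/negP => xe; apply: xa; apply: ball_cube.
  rewrite -(@ler_pXn2r _ 2) ?nnegrE ?enorm_ge0 ?mulr_ge0 ?(ltW r0)// (le_trans xe)//.
  by rewrite /a exprMn; nra.
pose c := shell_cut r e; pose w := pw s d; pose phi x := cplx c x * w x.
pose Z : R[i] := (k ^+ 2)%:C%C + (0 +i* (k * sigma))%C.
have sc : sm setT c := sm_shell_cut r e.
have scc : csm setT (cplx c) by exact: csm_cplx.
have sw : csm setT w by exact: csm_pw.
have sphi : csm setT phi by exact: csmM.
have oC : open (~` cube a) by apply: closed_openC; exact: cube_closed.
have c0 x : ~ cube a x -> cplx c x = 0.
  by move=> /big /ltW xa; rewrite /cplx /c shell_cut0.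
have phi0 x : ~ cube a x -> phi x = 0 by move=> xa; rewrite /phi c0// mul0r.
have lap_w x : laplacian (laplacian w) x = Z * w x by rewrite /w bilaplacian_pw// s4.
pose G x := \sum_i partial3 i (cplx c) x * green_field w u i x.
pose Y i x := green_field u phi i x + cplx c x * green_field w u i x.
have sG : csm setT G.
  by apply: csm_sum => // j; apply: csmM => //; [exact: csm_partial3|exact: csm_green_field].
have sY i : csm setT (Y i).
  by apply: csmD => //; [exact: csm_green_field|apply: csmM => //; exact: csm_green_field].
have zero_p i (V : set (pt3 R)) (g : pt3 R -> R[i]) : open V -> (forall x, V x -> g x = 0) ->
    forall x, V x -> partial3 i g x = 0.
  move=> oV g0 x Vx; rewrite (eq_on_partial3 i oV (h := fun=> 0) g0 Vx).
  by apply: complex_eq; exact: pd_cst.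
have zero_l (V : set (pt3 R)) (g : pt3 R -> R[i]) : open V -> (forall x, V x -> g x = 0) ->
    forall x, V x -> laplacian g x = 0.
  move=> oV g0 x Vx; rewrite /laplacian big1// => i _.
  by apply: (zero_p i V) => // y Vy; exact: (zero_p i V).
have Y0 i x : ~ cube a x -> Y i x = 0.
  move=> xa; have l0 := zero_l _ _ oC phi0.
  have zE (z1 z2 z3 z4 z5 p l pp pl cx : R[i]) : p = 0 -> l = 0 -> pp = 0 -> pl = 0 -> cx = 0 ->
      z1 * pl - l * z2 + (z3 * pp - p * z4) + cx * z5 = 0.
    by move=> -> -> -> -> ->; rewrite !(mul0r, mulr0, subr0, addr0).
  exact: (zE _ _ _ _ _ _ _ _ _ _ (phi0 x xa) (l0 x xa) (zero_p i _ _ oC phi0 x xa)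
    (zero_p i _ _ oC l0 x xa) (c0 x xa)).
have G0 x : e < `|enorm x ^+ 2 - r ^+ 2| -> G x = 0.
  move=> xe; rewrite /G big1// => i _.
  by rewrite partial3_cplx /cplx pd_shell_cut_eq0// mul0r.
(* Off the shell, [phi] is locally either 0 or the wave [w], both annihilated by the operator, so
   the values of [v] there, on which no pointwise information exists, drop out. *)
have LE x : v x * biharmonic_op sigma k phi x = \sum_i partial3 i (Y i) x - G x.
  rewrite -(@green_identity R u w c Z x su sw sc (lap_w x)).
  have -> : biharmonic_op sigma k phi x = laplacian (laplacian phi) x - Z * phi x.
    by rewrite /biharmonic_op /Z mulrDl opprD addrA.
  have [xe|xe] := leP `|enorm x ^+ 2 - r ^+ 2| e; first by rewrite (ev x xe).
  suff -> : laplacian (laplacian phi) x - Z * phi x = 0 by rewrite !mulr0.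
  move: xe; rewrite lter_normr => /orP[xe|xe].
    pose V := [set x : pt3 R | r ^+ 2 + e < enorm x ^+ 2].
    have oV : open V by apply: (@enorm2_open _ (fun t => r ^+ 2 + e < t)); exact: open_gt.
    have V0 y : V y -> phi y = 0.
      by move=> Vy; rewrite /phi /cplx /c shell_cut0 ?mul0r// ltW.
    have Vx : V x by rewrite /V/=; lra.
    by rewrite (zero_l _ _ oV (zero_l _ _ oV V0) x Vx) V0// mulr0 subr0.
  pose V := [set x : pt3 R | enorm x ^+ 2 < r ^+ 2 - e].
  have oV : open V by apply: (@enorm2_open _ (fun t => t < r ^+ 2 - e)); exact: open_lt.
  have V1 y : V y -> phi y = w y.
    by move=> Vy; rewrite /phi /cplx /c shell_cut1 ?mul1r// ltW.
  have Vx : V x by rewrite /V/=; lra.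
  by rewrite (eq_on_laplacian oV (eq_on_laplacian oV V1) Vx) lap_w V1// subrr.
(* The cutoff equals 1 on [ball3 rhat], which contains the support of the source. *)
have FE x : cplx (extend0 r f) x * phi x = (extend0 r f x)%:C%C * w x.
  have [f0|f0] := eqVneq (extend0 r f x) 0; first by rewrite /cplx f0 !mul0r.
  have : ball3 rhat x by apply: supp; apply: subset_closure.
  rewrite /ball3/= => xr; rewrite /phi {2}/cplx /c shell_cut1 ?mul1r//.
  have : enorm x ^+ 2 <= rhat ^+ 2 by rewrite lerXn2r ?nnegrE ?enorm_ge0 ?ltW.
  by move=> ?; lra.
have bound (h : pt3 R -> R) : continuous h -> (forall x, 0 <= h x) -> (forall x, h x <= cmod (G x)) ->
    (\int[leb3 R]_x (h x)%:E <= (C * eta)%:E)%E.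
  move=> ch h0 hG.
  (* The cutoff has partial derivatives at most [C0 * (2 * r) / e], and [green_field_bound]
     contributes the factor [3 * W]. *)
  pose k0 := 6 * r * C0 * W / e.
  have k00 : 0 <= k0 by rewrite ltW//; apply: divr_gt0 => //; do 3! apply: mulr_gt0 => //.
  pose al := (cK * eta)^-1; pose gg x := cK * energy u x.
  have al0 : 0 <= al by rewrite invr_ge0 ltW// mulr_gt0.
  have gg0 x : 0 <= gg x by rewrite mulr_ge0// ltW.
  have cgg : continuous gg by move=> x; apply: (continuous_comp (cE x)); exact: mulrl_continuous.
  (* In the 5, 4 is [12 / 3] from [green_field_bound] and 1 comes from moving the energy from radius
     [p] to radius [r]. *)
  pose g x := al * gg x + 5 * eta.
  have gE x : g x = energy u x / eta + 5 * eta.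
    by rewrite /g /al /gg; congr (_ + _); field; rewrite !gt_eqF.
  have g0 x : 0 <= g x by rewrite addr_ge0// mulr_ge0// ltW.
  have cg : continuous g.
    move=> x; apply: (@continuousD R _ _ (fun x => al * gg x) (fun=> 5 * eta)).
      by apply: (continuous_comp (cgg x)); exact: mulrl_continuous.
    exact: cst_continuous.
  have mk : measurable_fun setT (shell_weight r e k0).
    apply: measurable_funM; first exact: measurable_cst.
    by apply: measurable_indic; exact: measurable_itv.
  have hkg p t f' : 0 < p ->
      h (sphere_pt p t f') <= shell_weight r e k0 p * g (sphere_pt r t f').
    move=> pp; apply: (le_trans (hG _)); set x := sphere_pt p t f'; set y := sphere_pt r t f'.
    have xp : enorm x = p by rewrite enorm_sphere_pt// ltW.
    have yr : enorm y = r by rewrite enorm_sphere_pt// ltW.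
    have [xe|xe] := leP `|enorm x ^+ 2 - r ^+ 2| e; last first.
      rewrite (G0 x xe) cmod_cplx normr0; apply: mulr_ge0 (g0 y).
      exact: shell_weight_ge0.
    have pe : `|p - r| <= e / r.
      rewrite ler_pdivlMr// (le_trans _ xe)// xp subr_sqr normrM ler_wpM2l//.
      by rewrite gtr0_norm ?addr_gt0// lerDr ltW.
    have -> : shell_weight r e k0 p = k0.
      rewrite /shell_weight indicE mem_set ?mulr1//=.
      by move: pe; rewrite in_itv/= ler_distl.
    have Ex : energy u x <= energy u y + eta ^+ 2.
      have -> : x = (p / r * y.1.1, p / r * y.1.2, p / r * y.2).
        by rewrite /x /y /sphere_pt /=; congr (_, _, _); field; rewrite gt_eqF.
      by apply: eE => //; apply: ball_cube; rewrite yr.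
    have p2 : p <= 2 * r.
      rewrite -(@ler_pXn2r _ 2) ?nnegrE ?mulr_ge0 ?(ltW r0) ?(ltW pp)// exprMn.
      have r2 := exprn_gt0 2 r0; move: xe er r2; rewrite xp ler_norml => /andP[_].
      by clear; move: (p ^+ 2) (r ^+ 2) => *; lra.
    have xa : enorm x <= 2 * r by rewrite xp.
    pose q := C0 * (2 * r) / e.
    have q0 : 0 <= q by rewrite ltW//; apply: divr_gt0 => //; apply: mulr_gt0 => //; exact: mulr_gt0.
    apply: (@le_trans _ _ (\sum_i q * cmod (green_field w u i x))).
      rewrite /G (le_trans (cmod_sum _ _ _))//; apply: ler_sum => i _.
      rewrite cmodM ler_wpM2r ?cmod_ge0// partial3_cplx cmod_cplx pd_shell_cut// normrN.
      rewrite normf_div (gtr0_norm e0) normrM /q ler_wpM2r ?invr_ge0 ?(ltW e0)//.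
      by rewrite ler_pM// (le_trans (enorm_coord3 _ _)).
    rewrite -mulr_sumr.
    have wB i : [/\ cmod (w x) <= W, cmod (partial3 i w x) <= W,
      cmod (laplacian w x) <= W & cmod (partial3 i (laplacian w) x) <= W].
      exact: (pw_bounds i d1 sS xa).
    have GB := green_field_bound u eta0 (ltW W0) wB.
    apply: (le_trans (ler_wpM2l q0 GB)); rewrite gE.
    have Exy : energy u x / eta <= energy u y / eta + eta.
      have divE (m1 m2 : R) : m1 <= m2 + eta ^+ 2 -> m1 / eta <= m2 / eta + eta.
        by move=> h'; rewrite ler_pdivrMr// mulrDl divfK ?gt_eqF// -expr2.
      exact: divE Ex.
    have -> : k0 = q * W * 3 by rewrite /k0 /q; field; rewrite gt_eqF.
    have fin (m1 m2 q' z : R) : 0 <= q' -> m1 <= m2 + z ->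
        q' * (3 * m1 + 12 * z) <= q' * 3 * (m2 + 5 * z).
      by clear; move=> q'0 m12; rewrite -mulrA ler_wpM2l//; lra.
    by rewrite (mulrA q W); exact: (fin _ _ (q * W) eta (mulr_ge0 q0 (ltW W0)) Exy).
  apply: (le_trans (shell_integral_le r0 ch h0 cg g0 mk (fun p => shell_weight_ge0 _ _ p k00) hkg)).
  have -> : C * eta = 8 * k0 * e / r * (al * eta ^+ 2 + 5 * eta * r ^+ 2 * (2 * pi) * pi).
    by rewrite /C /k0 /al /A; field; rewrite !gt_eqF.
  rewrite EFinM; apply: lee_pmul.
  - apply: integral_ge0 => p _; rewrite lee_fin; apply: divr_ge0; last exact: sqr_ge0.
    by apply: mulr_ge0; [exact: shell_weight_ge0|exact: sqr_ge0].
  - apply: integral_ge0 => t /sin_ge0_pi t0; apply: integral_ge0 => f' _; rewrite lee_fin.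
    by apply: mulr_ge0 => //; apply: mulr_ge0 => //; exact: sqr_ge0.
  - exact: shell_weight_integral.
  apply: (le_trans (sphere_integral_affine r cgg gg0 al0 (mulr_ge0 (ler0n _ 5) (ltW eta0)))).
  rewrite EFinD (EFinM al); apply: leeD2r; apply: lee_wpmul2l; first by rewrite lee_fin.
  apply: (le_trans _ Hb).
  apply: sphere_integral_mono => // t f'; set y := sphere_pt r t f'.
  (* Agreement of [u] and [v] on an open shell around the sphere carries over to the derivatives in
     the boundary norm. *)
  pose V := [set x : pt3 R | `|enorm x ^+ 2 - r ^+ 2| < e].
  have oV : open V.
    apply: (@enorm2_open _ (fun t => `|t - r ^+ 2| < e)).
    have cn : continuous (fun t : R => `|t - r ^+ 2|).
      move=> z; apply: (@continuous_comp _ _ _ (fun t : R => t - r ^+ 2) Num.norm); last exact: norm_continuous.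
      by apply: continuousB; [exact: id|exact: cst_continuous].
    by move/continuousP : cn => /(_ [set z | z < e]); apply; exact: open_lt.
  have uV z : V z -> v z = u z by move=> /ltW Vz; rewrite ev.
  have Vy : V y by rewrite /V/= enorm_sphere_pt ?(ltW r0)// subrr normr0.
  have lV := eq_on_laplacian oV uV.
  have gV (g1 g2 : pt3 R -> R[i]) : (forall z, V z -> g1 z = g2 z) -> grad_norm2 g1 y = grad_norm2 g2 y.
    by move=> g12; apply: eq_bigr => i _; rewrite (eq_on_partial3 i oV g12 Vy).
  rewrite (uV y Vy) (lV y Vy) (gV _ _ uV) (gV _ _ lV) /gg /energy.
  have gn0 g' : 0 <= grad_norm2 g' y by apply: sumr_ge0 => i _; exact: sqr_ge0.
  have k2 : cK <= k ^+ 2.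
    by rewrite ge_min; apply/orP; right; rewrite lerXn2r ?nnegrE ?divr_ge0 ?(ltW K0)// (le_trans _ kK)// divr_ge0// ltW.
  have k1 : cK <= 1 by rewrite ge_min lexx.
  have fin (b1 b2 b3 b4 m l : R) : 0 <= b1 -> 0 <= b2 -> 0 <= b3 -> 0 <= b4 ->
      0 <= l -> m <= 1 -> m <= l ->
      m * (b1 + b2 + b3 + b4) <= (l ^+ 2 + l) * b1 + l * b2 + (l + 1) * b3 + b4.
    clear; move=> b10 b20 b30 b40 l0 m1 ml.
    have := (ler_wpM2r b10 ml, ler_wpM2r b20 ml, ler_wpM2r b30 m1, ler_wpM2r b40 m1,
      mulr_ge0 (sqr_ge0 l) b10, mulr_ge0 l0 b30).
    by move=> [[[[[h1 h2] h3] h4] h5] h6]; rewrite !mulrDr !mulrDl; lra.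
  rewrite (_ : k ^+ 4 = (k ^+ 2) ^+ 2); last by rewrite -exprM.
  by apply: fin => //; exact: sqr_ge0.
have sch : schwartz phi by exact: (csm_schwartz sphi phi0).
have := Hsol phi sch; rewrite /cintegral => -[eRe eIm].
(* [P] is the real or the imaginary part; only additivity, commutation with derivatives and
   [|P z| <= cmod z] are used of it. *)
have part (P : R[i] -> R) (PG : forall z, `|P z| <= cmod z)
    (Pp : forall i (g : pt3 R -> R[i]) x, P (partial3 i g x) = pd i (fun y => P (g y)) x)
    (Ps : forall F : 'I_3 -> R[i], P (\sum_i F i) = \sum_i P (F i))
    (PB : forall z1 z2, P (z1 - z2) = P z1 - P z2) (P0 : P 0 = 0)
    (smP : forall g, csm setT g -> sm setT (fun x => P (g x))) :
    `|\int[leb3 R]_x P (v x * biharmonic_op sigma k phi x)| <= C * eta.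
  rewrite (_ : (fun _ => _) = (fun x => \sum_i pd i (fun y => P (Y i y)) x - P (G x))); last first.
    by apply/funext => x; rewrite LE PB Ps; congr (_ - _); apply: eq_bigr => i _; exact: Pp.
  have cPG := sm_continuous (smP _ sG).
  have Pz i x : ~ cube a x -> P (Y i x) = 0 by move=> /(Y0 i) ->.
  have Gz x : ~ cube a x -> P (G x) = 0.
    move=> /big xa; rewrite G0//; rewrite lter_normr ltrBrDr [e + _]addrC xa//.
  have aB : (\int[leb3 R]_x (`|P (G x)|)%:E <= (C * eta)%:E)%E.
    apply: (bound (fun x => `|P (G x)|)) => [x|x|x]; last exact: PG.
      exact: (continuous_comp (cPG x) (@norm_continuous _ _ _)).
    exact: normr_ge0.
  exact: (@Rintegral_div_le R a _ (fun i y => P (Y i y)) (fun x => P (G x))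
    (fun i => smP _ (sY i)) Pz cPG Gz aB).
split.
  rewrite (_ : (fun _ => _) = (fun x => complex.Re (cplx (extend0 r f) x * phi x))); last first.
    by apply/funext => x; rewrite FE ReM /= mul0r subr0.
  rewrite -eRe; apply: part => //; [exact: normRe_cmod|exact: Re_sum| |by move=> g []].
  by move=> z1 z2; rewrite ReD ReN.
rewrite (_ : (fun _ => _) = (fun x => complex.Im (cplx (extend0 r f) x * phi x))); last first.
  by apply/funext => x; rewrite FE ImM /= mul0r addr0.
rewrite -eIm; apply: part => //; [exact: normIm_cmod|exact: Im_sum| |by move=> g []].
by move=> z1 z2; rewrite ImD ImN.
Unshelve. all: by end_near.
Qed.

End BoundaryFunctional.

(** * Cosine series on a cube *)

Section NullIntegral.
Context d (T : measurableType d) (R : realType) (mu : {measure set T -> \bar R}).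

(** Dynkin induction. Complements are handled by the vanishing of the total integral, disjoint
    unions by countable additivity, so a generating family stable under intersection suffices. *)
Lemma preimage_integral_eq0 d' (T' : measurableType d') (c : T -> T') (C : set (set T'))
    (g : T -> \bar R) : measurable_fun setT c -> @measurable d' T' = <<s C >> ->
  setI_closed C -> mu.-integrable setT g -> (\int[mu]_x g x = 0)%E ->
  (forall A, C A -> \int[mu]_(x in c @^-1` A) g x = 0)%E ->
  forall A, measurable A -> (\int[mu]_(x in c @^-1` A) g x = 0)%E.
Proof.
move=> mc CE IC ig gT gC A mA.
have mpre B : measurable B -> measurable (c @^-1` B).
  by move=> mB; rewrite -[_ @^-1` _]setTI; exact: mc.
suff : <<s C >> A -> (\int[mu]_(x in c @^-1` A) g x = 0)%E by apply; rewrite -CE.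
apply: (dynkin_induction CE IC (P := fun A => (\int[mu]_(x in c @^-1` A) g x = 0)%E)) => //.
- move=> S mS S0; rewrite preimage_setC; have mS' := mpre _ mS.
  move: gT; rewrite -(setUv (c @^-1` S)) integral_setU ?S0 ?add0e ?setUv//.
  + exact: measurableC.
  + exact: measurable_int ig.
  + by rewrite disj_set2E setICr.
- move=> F mF tF F0; rewrite preimage_bigcup integral_bigcup//.
  + by rewrite eseries0// => n _ _; exact: F0.
  + by move=> i j _ _ [x [xi xj]]; apply: tF => //; exists (c x).
  + by move=> k; exact: mpre.
  + apply: (integrableS measurableT) => //; apply: bigcupT_measurable => k; exact: mpre.
Qed.

Definition bounded_mfun (h : T -> R) := measurable_fun setT h /\ exists B, forall x, `|h x| <= B.

Lemma bounded_mfun_cst (a : R) : bounded_mfun (fun=> a).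
Proof. by split; [exact: measurable_cst|exists `|a|]. Qed.

Lemma bounded_mfunD h k : bounded_mfun h -> bounded_mfun k -> bounded_mfun (fun x => h x + k x).
Proof.
move=> [mh [B hB]] [mk [B' kB]]; split; first exact: measurable_funD.
by exists (B + B') => x; rewrite (le_trans (ler_normD _ _))// lerD.
Qed.

Lemma bounded_mfunM h k : bounded_mfun h -> bounded_mfun k -> bounded_mfun (fun x => h x * k x).
Proof.
move=> [mh [B hB]] [mk [B' kB]]; split; first exact: measurable_funM.
by exists (B * B') => x; rewrite normrM ler_pM.
Qed.

Lemma integrable_bounded_mul (G h : T -> R) : mu.-integrable setT (EFin \o G) ->
  bounded_mfun h -> mu.-integrable setT (EFin \o (fun x => G x * h x)).
Proof.
move=> iG [mh [B hB]].
have mG : measurable_fun setT G by apply/measurable_EFinP; exact: measurable_int iG.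
apply: (@le_integrable _ _ _ mu setT measurableT _ (fun x => B%:E * (EFin \o G) x)%E).
- by apply/measurable_EFinP; exact: measurable_funM.
- move=> x _; rewrite /= lee_fin !normrM mulrC ler_wpM2r//.
  by rewrite (le_trans (hB x))// ler_norm.
- exact: integrableZl.
Qed.

End NullIntegral.

Section CosineSystem.
Variable R : realType.

(* Applied to an affine image z of a cosine, this makes the indicator of a ray a
   limit of cosine polynomials. *)
Lemma step_limit (z : R) : 0 <= z <= 1 ->
  (fun N => (1 - z ^+ N) ^+ (N * 2 ^ N)) @ \oo --> ((z < 2^-1)%R%:R : R).
Proof.
move=> /andP[z0 z1].
have zN N : 0 <= 1 - z ^+ N <= 1.
  by rewrite subr_ge0 lerBlDr lerDl exprn_ge0 ?exprn_ile1//.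
have [z2|z2] := ltP z 2^-1; last first.
  apply: (@squeeze_cvgr _ _ _ _ (fun=> 0) (fun N : nat => N.+1%:R^-1)).
  - near=> N; have /andP[h0 h1] := zN N; rewrite exprn_ge0//=.
    (* The exponent is chosen to give [M * t = N * (2 * z) ^+ N], which is at least [N] here and
       tends to 0 when [z < 1/2]. Bernoulli's inequality for [(1 + t) ^+ M] bounds [(1 - t) ^+ M] by
       [1 / (N + 1)]. *)
    pose t := z ^+ N; pose M := (N * 2 ^ N)%N.
    have t0 : 0 <= t by rewrite exprn_ge0.
    have a1 : (1 - t) ^+ M * (1 + t) ^+ M <= 1.
      have t1 : t <= 1 by rewrite -subr_ge0.
      rewrite -exprMn -subr_sqr expr1n; apply: exprn_ile1; last by rewrite lerBlDr lerDl sqr_ge0.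
      by rewrite subr_ge0 exprn_ile1.
    have a2 : 1 + M%:R * t <= (1 + t) ^+ M.
      elim: (M) => [|m IH]; first by rewrite mul0r addr0 expr0.
      rewrite exprS (le_trans _ (ler_wpM2l _ IH)) ?addr_ge0//.
      rewrite mulrDl mul1r mulrDr mulr1 -natr1 mulrDl mul1r.
      have : 0 <= t * (m%:R * t) by rewrite !mulr_ge0.
      by move=> ?; lra.
    have a3 : N%:R <= M%:R * t.
      rewrite /M natrM -mulrA ler_peMr// natrX -exprMn exprn_ege1// mulrC.
      by rewrite -ler_pdivrMr// mul1r.
    rewrite -[leRHS]mul1r ler_pdivlMr// (le_trans _ a1)// ler_wpM2l ?exprn_ge0//.
    by rewrite (le_trans _ a2)// -natr1 addrC lerD2l.
  - exact: cvg_cst.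
  - exact: cvg_harmonic.
have s0 : 0 <= 2 * z < 1 by apply/andP; split; [rewrite mulr_ge0|lra].
have key : (fun N : nat => N%:R * (2 * z) ^+ N) @ \oo --> (0 : R).
  move: (2 * z) s0 => w /andP[w0 w1].
  have [s [q1 q2 q3]] : exists s : R, [/\ 0 < s, s < 1 & w <= s * s].
    (* By the inequality of means this [s] satisfies [w <= s ^+ 2]; one factor [s ^+ N] absorbs [N],
       the other tends to 0. *)
    exists ((w + 1) / 2); split; [lra|lra|nra].
  apply: (@squeeze_cvgr _ _ _ _ (fun=> 0) (fun N : nat => s / (1 - s) * s ^+ N)).
  - near=> N; rewrite mulr_ge0 ?exprn_ge0//=.
    apply: (@le_trans _ _ (N%:R * s ^+ N * s ^+ N)).
      by rewrite -mulrA ler_wpM2l// -exprMn lerXn2r// nnegrE mulr_ge0// ltW.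
    rewrite ler_wpM2r ?exprn_ge0 ?(ltW q1)//.
    rewrite ler_pdivlMr ?subr_gt0//.
    elim: (N) => [|m IH]; first by rewrite !mul0r ltW.
    have sm : s ^+ m.+1 <= s by rewrite exprS ler_piMr ?(ltW q1)// exprn_ile1 ?ltW.
    have s1 : 0 <= s ^+ m.+1 by rewrite exprn_ge0// ltW.
    rewrite -natr1 mulrDl mul1r.
    have e1 : m%:R * s ^+ m.+1 * (1 - s) = s * (m%:R * s ^+ m * (1 - s)) by rewrite exprS; ring.
    rewrite mulrDl e1.
    have : s * (m%:R * s ^+ m * (1 - s)) <= s * s by rewrite ler_wpM2l// ltW.
    by move=> ?; nra.
  - exact: cvg_cst.
  - rewrite -[0](mulr0 (s / (1 - s))); apply: cvgMr; apply: cvg_expr.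
    by rewrite gtr0_norm.
apply: (@squeeze_cvgr _ _ _ _ (fun N : nat => 1 - N%:R * (2 * z) ^+ N) (fun=> 1)).
- near=> N; have /andP[h0 h1] := zN N; rewrite exprn_ile1// andbT.
  rewrite exprMn mulrA -natrX -natrM.
  have t1 : z ^+ N <= 1 by rewrite exprn_ile1.
  have t0 : 0 <= z ^+ N by rewrite exprn_ge0.
  elim: (N * 2 ^ N)%N => [|m IH]; first by rewrite mul0r subr0 expr0.
  rewrite exprS (le_trans _ (ler_wpM2l h0 IH))//.
  rewrite -natr1 mulrDl mul1r mulrBl mul1r mulrBr mulr1.
  have : 0 <= z ^+ N * (m%:R * z ^+ N) by rewrite !mulr_ge0.
  by move=> ?; lra.
- rewrite -[X in _ --> X](subr0 1); apply: cvgB => //; exact: cvg_cst.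
- exact: cvg_cst.
Unshelve. all: by end_near.
Qed.

(** The Neumann eigenfunctions of the segment [[- r, r]]. With half the frequency step of the
    periodic system, cosines alone are complete there. *)
Definition cosm (r : R) (m : nat) (t : R) : R := cos (m%:R * (pi / (2 * r) * (t + r))).

Lemma cosm0 (r t : R) : cosm r 0 t = 1.
Proof. by rewrite /cosm mul0r cos0. Qed.

(** The product formula for cosines; for [m = 0] the index [m - 1] becomes 1 by evenness. *)
Lemma cosm1M (r t : R) m : cosm r 1 t * cosm r m t =
  2^-1 * cosm r m.+1 t + 2^-1 * cosm r (if m is m'.+1 then m' else 1%N) t.
Proof.
case: m => [|m]; first by rewrite cosm0 mulr1; move: (cosm r 1 t) => z; lra.
rewrite /cosm mul1r; set th := pi / _ * _.
rewrite -[m.+2%:R]natr1 mulrDl mul1r cosD -[m.+1%:R]natr1 mulrDl mul1r !cosD sinD.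
have h := cos2Dsin2 th; have : cos (m%:R * th) * (cos th ^+ 2 + sin th ^+ 2) = cos (m%:R * th).
  by rewrite h mulr1.
move: (cos th) (sin th) (cos (m%:R * th)) (sin (m%:R * th)) => a b p q.
by move=> ?; lra.
Qed.

Lemma cosm_continuous (r : R) m : continuous (cosm r m).
Proof.
move=> t; apply: (@continuous_comp _ _ _ (fun t : R => m%:R * (pi / (2 * r) * (t + r))) cos);
  last exact: continuous_cos.
apply: (@continuousM R _ (fun=> m%:R) (fun t : R => pi / (2 * r) * (t + r))); first exact: cst_continuous.
apply: (@continuousM R _ (fun=> pi / (2 * r)) (fun t : R => t + r)); first exact: cst_continuous.
by apply: continuousD; [exact: id|exact: cst_continuous].
Qed.

(** On the segment the argument of the first cosine runs through [[0, pi]], where the cosine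
    decreases; it thus serves as an order-reversing coordinate. *)
Lemma cosm_ltr (r b t : R) : 0 < r -> - r <= b <= r -> - r <= t <= r ->
  (cosm r 1 t < cosm r 1 b) = (b < t).
Proof.
move=> r0 /andP[b1 b2] /andP[t1 t2]; rewrite /cosm !mul1r.
have c0 : 0 < pi / (2 * r) by rewrite divr_gt0 ?pi_gt0 ?mulr_gt0.
have rng x : - r <= x -> x <= r -> pi / (2 * r) * (x + r) \in `[0, pi].
  move=> x1 x2; rewrite in_itv/= mulr_ge0 ?(ltW c0)//=; last by lra.
  rewrite mulrAC ler_pdivrMr ?mulr_gt0// ler_wpM2l ?(ltW (pi_gt0 R))//; lra.
by rewrite ltr_cos ?rng// ltr_pM2l// ltrD2r.
Qed.

End CosineSystem.

(** * Completeness of the cosine system *)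

Section CosineUniqueness.
Variable R : realType.
Local Notation mT := (measurableTypeR R).
Local Notation T3 := (mT * mT * mT)%type.
Local Notation mu := (leb3 R).

Lemma bounded_mfun_cont (h : R -> R) i : continuous h -> (exists B, forall t, `|h t| <= B) ->
  bounded_mfun (T := T3) (fun x : pt3 R => h (coord3 i x)).
Proof.
move=> ch [B hB]; split; last by exists B.
apply: continuous3_measurable => x.
exact: (@continuous_comp _ _ _ (@coord3 R i) h _ (@coord3_continuous R i x) (ch _)).
Qed.

Lemma bounded_mfun_cosm (r : R) m i : bounded_mfun (T := T3) (fun x : pt3 R => cosm r m (coord3 i x)).
Proof.
by apply: bounded_mfun_cont; [exact: cosm_continuous|exists 1 => t; exact: cos_max].
Qed.

Lemma coord3_measurable i : measurable_fun [set: T3] (@coord3 R i : T3 -> mT).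
Proof. by apply: continuous3_measurable; exact: coord3_continuous. Qed.

Lemma bounded_mfun_indic (A : set R) i : measurable A ->
  bounded_mfun (T := T3) (fun x : pt3 R => \1_A (coord3 i x) : R).
Proof.
move=> mA; split.
  apply: (@measurable_comp _ _ _ _ _ _ setT (\1_A : mT -> R) _ (coord3 i : T3 -> mT)) => //.
  exact: coord3_measurable.
by exists 1 => x; rewrite indicE; case: (_ \in _); rewrite ?normr1 ?normr0.
Qed.

Section OneCoordinate.
Variables (r : R) (i : 'I_3) (G : pt3 R -> R).
Hypothesis r0 : 0 < r.
Hypothesis iG : (mu : {measure set T3 -> \bar R}).-integrable setT (EFin \o G).
Hypothesis G0 : forall x, ~ cube r x -> G x = 0.
Hypothesis Gc : forall m, \int[mu]_x (G x * cosm r m (coord3 i x)) = 0.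

Let y x := cosm r 1 (coord3 i x).

Lemma poly_cosm_bounded (p : {poly R}) : bounded_mfun (T := T3) (fun x : pt3 R => p.[y x]).
Proof.
elim/poly_ind: p => [|p c IH].
  by rewrite (_ : (fun _ => _) = (fun=> 0)); [exact: bounded_mfun_cst|apply/funext => x; rewrite horner0].
rewrite (_ : (fun _ => _) = (fun x => p.[y x] * y x + c)); last first.
  by apply/funext => x; rewrite hornerMXaddC.
apply: bounded_mfunD; last exact: bounded_mfun_cst.
by apply: bounded_mfunM => //; exact: bounded_mfun_cosm.
Qed.

(** Multiplication by the first cosine stays within the span of the cosines by [cosm1M]. The extra
    factor of index [m] makes the induction on the polynomial close. *)
Lemma poly_cosm_integral (p : {poly R}) m :
  \int[mu]_x (G x * (p.[y x] * cosm r m (coord3 i x))) = 0.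
Proof.
have iM h : bounded_mfun h -> (mu : {measure set T3 -> \bar R}).-integrable setT (EFin \o (fun x => G x * h x)).
  exact: (@integrable_bounded_mul _ T3 R mu G h iG).
elim/poly_ind: p m => [|p c IH] m.
  rewrite (_ : (fun _ => _) = (fun=> 0)); first by rewrite /Rintegral integral0.
  by apply/funext => x; rewrite horner0 mul0r mulr0.
pose m' := if m is m'.+1 then m' else 1%N.
have bp := poly_cosm_bounded p.
have bc k := bounded_mfun_cosm r k i.
have b1 k : bounded_mfun (T := T3) (fun x : pt3 R => p.[y x] * cosm r k (coord3 i x)).
  exact: bounded_mfunM bp (bc k).
have b2 (a : R) h : bounded_mfun (T := T3) h -> bounded_mfun (T := T3) (fun x => a * h x).
  by move=> bh; exact: bounded_mfunM (bounded_mfun_cst _ a) bh.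
rewrite (_ : (fun _ => _) = (fun x =>
   (2^-1 * (G x * (p.[y x] * cosm r m.+1 (coord3 i x))) + 2^-1 * (G x * (p.[y x] * cosm r m' (coord3 i x))))
   + c * (G x * cosm r m (coord3 i x)))); last first.
  apply/funext => x; rewrite hornerMXaddC mulrDl -[p.[y x] * y x * _]mulrA cosm1M -/m'.
  by move: (cosm r m.+1 _) (cosm r m' _) (cosm r m _) p.[y x] => *; ring.
have iZ (a : R) h : (mu : {measure set T3 -> \bar R}).-integrable setT (EFin \o h) ->
   (mu : {measure set T3 -> \bar R}).-integrable setT (EFin \o (fun x => a * h x)).
  by move=> ih; apply: (integrableZl measurableT a ih).
have i1 k := iM _ (b1 k); have i2 k := iM _ (bc k).
have iD h k : (mu : {measure set T3 -> \bar R}).-integrable setT (EFin \o h) ->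
   (mu : {measure set T3 -> \bar R}).-integrable setT (EFin \o k) ->
   (mu : {measure set T3 -> \bar R}).-integrable setT (EFin \o (fun x => h x + k x)).
  by move=> ih ik; exact: (integrableD measurableT ih ik).
rewrite (@RintegralD _ T3 R mu) //; [|by apply: iD; apply: iZ; exact: i1|by apply: iZ; exact: i2].
rewrite (@RintegralD _ T3 R mu) //; [|by apply: iZ; exact: i1|by apply: iZ; exact: i1].
rewrite !(@RintegralZl _ T3 R mu) //.
by rewrite !IH Gc !mulr0 !addr0.
Qed.

(** On the segment the ray [t > b] is the set where an affine image of the first cosine is below
    1/2. By [step_limit] its indicator is a bounded limit of polynomials in that cosine, and
    dominated convergence applies. The cases of [b] off the segment are immediate. *)
Lemma ray_integral (b : R) : \int[mu]_x (G x * \1_(`]b, +oo[%classic : set R) (coord3 i x)) = 0.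
Proof.
have G1 : \int[mu]_x G x = 0.
  rewrite -[RHS](Gc 0); congr (Rintegral _ _ _); apply/funext => x.
  by rewrite cosm0 mulr1.
have [br|br] := ltP r b.
  rewrite (_ : (fun _ => _) = (fun=> 0)); first by rewrite /Rintegral integral0.
  apply/funext => x; have [xr|/G0 ->] := pselect (cube r x); last by rewrite mul0r.
  rewrite indicE memNset ?mulr0//= in_itv/= andbT; apply/negP; rewrite -leNgt.
  by rewrite (le_trans _ (ltW br))// (le_trans (ler_norm _)).
have [rb|rb] := ltP b (- r).
  rewrite -[RHS]G1; congr (Rintegral _ _ _); apply/funext => x.
  have [xr|/G0 ->] := pselect (cube r x); last by rewrite mul0r.
  rewrite indicE mem_set ?mulr1//= in_itv/= andbT (lt_le_trans rb)//.
  by have := xr i; rewrite ler_norml => /andP[].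
pose a := cosm r 1 b.
(* The difference of two cosines lies in [[-2, 2]]; this rescaling maps it to [[0, 1]] with
   threshold 1/2 at [b]. *)
pose z x := 4^-1 * (y x - a) + 2^-1.
have z01 x : 0 <= z x <= 1.
  have := (cos_geN1 (1%:R * (pi / (2 * r) * (coord3 i x + r))), cos_le1 (1%:R * (pi / (2 * r) * (coord3 i x + r))),
    cos_geN1 (1%:R * (pi / (2 * r) * (b + r))), cos_le1 (1%:R * (pi / (2 * r) * (b + r)))).
  rewrite /z /y /a /cosm; move: (cos _) (cos _) => u v [[[h1 h2] h3] h4].
  by apply/andP; split; lra.
pose q N : {poly R} := (1 - ((4^-1)%:P * ('X - a%:P) + (2^-1)%:P) ^+ N) ^+ (N * 2 ^ N).
have qE N x : (q N).[y x] = (1 - z x ^+ N) ^+ (N * 2 ^ N) by rewrite /q !hornerE.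
have bq N := poly_cosm_bounded (q N).
have iM h : bounded_mfun h -> (mu : {measure set T3 -> \bar R}).-integrable setT (EFin \o (fun x => G x * h x)).
  exact: (@integrable_bounded_mul _ T3 R mu G h iG).
have q0 N : (\int[mu]_x (G x * (q N).[y x])%:E = 0)%E.
  have := poly_cosm_integral (q N) 0; rewrite /Rintegral.
  rewrite (_ : (fun x => (G x * _)%:E) = (fun x => (G x * (q N).[y x])%:E)); last first.
    by apply/funext => x; rewrite cosm0 mulr1.
  move=> h; have := integrable_fin_num measurableT (iM _ (bq N)).
  by move=> /fineK <-; rewrite h.
have mb : measurable (`]b, +oo[%classic : set R) by exact: measurable_itv.
have b1 := bounded_mfun_indic i mb.
have mq N : measurable_fun [set: T3] (fun x => (G x * (q N).[y x])%:E) := measurable_int _ (iM _ (bq N)).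
have m1 : measurable_fun [set: T3] (fun x => (G x * \1_(`]b, +oo[%classic : set R) (coord3 i x))%:E)
  := measurable_int _ (iM _ b1).
have := @dominated_convergence _ T3 R mu setT measurableT
  (fun N x => (G x * (q N).[y x])%:E)
  (fun x => (G x * \1_(`]b, +oo[%classic : set R) (coord3 i x))%:E)
  (fun x => `|G x|%:E) mq m1.
case.
- apply: aeW => x _; apply: cvg_EFin; first by apply: nearW => N.
  have [xr|/G0 Gx] := pselect (cube r x); last first.
    rewrite (_ : fine \o _ = fun=> 0); last by apply/funext => N /=; rewrite Gx mul0r.
    by rewrite Gx mul0r; exact: cvg_cst.
  rewrite (_ : fine \o _ = fun N => G x * (1 - z x ^+ N) ^+ (N * 2 ^ N)); last first.
    by apply/funext => N /=; rewrite qE.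
  apply: cvgMr; rewrite (_ : \1_ _ _ = (z x < 2^-1)%R%:R); first exact: step_limit.
  have xr' : - r <= coord3 i x <= r by have := xr i; rewrite ler_norml.
  have -> : (z x < 2^-1) = (b < coord3 i x).
    rewrite -(@cosm_ltr _ r b)// ?rb ?br// -/(y x) -/a /z; apply/idP/idP => ?; lra.
  rewrite indicE; have [bx|bx] := ltP b (coord3 i x).
    by rewrite mem_set//= in_itv/= andbT.
  by rewrite memNset//= in_itv/= andbT; apply/negP; rewrite -leNgt.
- exact: (integrable_norm iG).
- apply: aeW => x N _; rewrite abse_EFin lee_fin normrM ler_piMr//.
  have /andP[z0 z1] := z01 x.
  have z2 : z x ^+ N <= 1 by rewrite exprn_ile1.
  by rewrite qE ger0_norm ?exprn_ge0 ?exprn_ile1// ?subr_ge0// lerBlDr lerDl exprn_ge0.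
move=> _ _; rewrite (_ : (fun N => _) = (fun=> 0%E)); last by apply/funext => N; exact: q0.
by move=> /(cvg_unique _ (cvg_cst 0%E)) e; rewrite /Rintegral -e.
Qed.

(** Rays generate the Borel sets and are stable under intersection, so [preimage_integral_eq0]
    extends [ray_integral] to all measurable sets. *)
Lemma coord_integral (A : set R) : measurable A -> \int[mu]_x (G x * \1_A (coord3 i x)) = 0.
Proof.
move=> mA.
have iM h : bounded_mfun h -> (mu : {measure set T3 -> \bar R}).-integrable setT (EFin \o (fun x => G x * h x)).
  exact: (@integrable_bounded_mul _ T3 R mu G h iG).
have setE (B : set R) : (\int[mu]_(x in (coord3 i : T3 -> mT) @^-1` B) (EFin \o G) x =
    \int[mu]_x (G x * \1_B (coord3 i x))%:E)%E.
  rewrite integral_mkcond; apply: eq_integral => x _; rewrite patchE indicE.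
  case: ifPn; rewrite ?inE/= => h; first by rewrite mem_set ?mulr1.
  by rewrite memNset ?mulr0//; apply: contraNnot h => ?; rewrite inE.
have fin0 h : bounded_mfun h -> \int[mu]_x (G x * h x) = 0 -> (\int[mu]_x (G x * h x)%:E = 0)%E.
  by move=> bh; rewrite /Rintegral => e; have /fineK <- := integrable_fin_num measurableT (iM _ bh); rewrite e.
have G1 : (\int[mu]_x (EFin \o G) x = 0)%E.
  have := fin0 _ (bounded_mfun_cosm r 0 i) (Gc 0).
  by move=> <-; apply: eq_integral => x _; rewrite cosm0 mulr1.
rewrite /Rintegral -setE.
rewrite (@preimage_integral_eq0 _ T3 R mu _ mT (coord3 i) (@RGenOInfty.G R) (EFin \o G) (coord3_measurable i)
  (RGenOInfty.measurableE R))//.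
- move=> _ _ [a ->] [b ->]; exists (Num.max a b); apply/seteqP; split=> t/=; rewrite !in_itv/= !andbT.
    by move=> [h1 h2]; rewrite gt_max h1.
  by rewrite gt_max => /andP[].
- move=> _ [b ->]; rewrite setE; apply: fin0; last exact: ray_integral.
  by apply: bounded_mfun_indic; exact: measurable_itv.
Qed.

End OneCoordinate.

End CosineUniqueness.

Section CosineComplete.
Variable R : realType.
Local Notation mT := (measurableTypeR R).
Local Notation T3 := (mT * mT * mT)%type.
Local Notation mu := (leb3 R).

Lemma integrable_mulC (G h : pt3 R -> R) :
  (mu : {measure set T3 -> \bar R}).-integrable setT (EFin \o G) -> bounded_mfun (T := T3) h ->
  (mu : {measure set T3 -> \bar R}).-integrable setT (EFin \o (fun x => G x * h x)).
Proof. exact: (@integrable_bounded_mul _ T3 R mu G h). Qed.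

Lemma Rintegral_eq0 (G : pt3 R -> R) :
  (mu : {measure set T3 -> \bar R}).-integrable setT (EFin \o G) ->
  \int[mu]_x G x = 0 -> (\int[mu]_x (G x)%:E = 0)%E.
Proof. by move=> iG; rewrite /Rintegral => e; have /fineK <- := integrable_fin_num measurableT iG; rewrite e. Qed.

(** The cosine factors are exchanged for indicators of Borel sets one coordinate at a time, the two
    other factors being absorbed in the integrable weight. Boxes generate the product sigma-algebra,
    so [g] has integral 0 over every measurable set. *)
Lemma cos_unique (r : R) (g : pt3 R -> R) : 0 < r ->
  (mu : {measure set T3 -> \bar R}).-integrable setT (EFin \o g) ->
  (forall x, ~ cube r x -> g x = 0) ->
  (forall i j k, \int[mu]_x (g x * (cosm r i x.1.1 * cosm r j x.1.2 * cosm r k x.2)) = 0) ->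
  ae_eq mu (setT : set T3) (EFin \o g) (fun=> 0%E).
Proof.
move=> r0 ig g0 gc.
pose o0 : 'I_3 := ord0; pose o1 : 'I_3 := lift ord0 ord0; pose o2 : 'I_3 := lift ord0 (lift ord0 ord0).
have bc m i := bounded_mfun_cosm r m i; have bi := @bounded_mfun_indic R.
have z0 (h : pt3 R -> R) x : ~ cube r x -> g x * h x = 0 by move=> /g0 ->; rewrite mul0r.
have S1 A j k : measurable A ->
    \int[mu]_x (g x * (\1_A x.1.1 * cosm r j x.1.2 * cosm r k x.2)) = 0.
  move=> mA; have b1 := bounded_mfunM (bc j o1) (bc k o2).
  rewrite -[RHS](@coord_integral R r o0 _ r0 (integrable_mulC ig b1) (z0 _) _ A mA).
    by congr (Rintegral _ _ _); apply/funext => x; rewrite /= -/(coord3 o0 x); ring.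
  move=> m; rewrite -[RHS](gc m j k).
  by congr (Rintegral _ _ _); apply/funext => x; rewrite /coord3 /=; ring.
have S2 A B k : measurable A -> measurable B ->
    \int[mu]_x (g x * (\1_A x.1.1 * \1_B x.1.2 * cosm r k x.2)) = 0.
  move=> mA mB; have b1 := bounded_mfunM (bi A o0 mA) (bc k o2).
  rewrite -[RHS](@coord_integral R r o1 _ r0 (integrable_mulC ig b1) (z0 _) _ B mB).
    by congr (Rintegral _ _ _); apply/funext => x; rewrite /coord3 /=; ring.
  move=> m; rewrite -[RHS](S1 A m k mA).
  by congr (Rintegral _ _ _); apply/funext => x; rewrite /coord3 /=; ring.
have S3 A B C : measurable A -> measurable B -> measurable C ->
    \int[mu]_x (g x * (\1_A x.1.1 * \1_B x.1.2 * \1_C x.2)) = 0.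
  move=> mA mB mC; have b1 := bounded_mfunM (bi A o0 mA) (bi B o1 mB).
  rewrite -[RHS](@coord_integral R r o2 _ r0 (integrable_mulC ig b1) (z0 _) _ C mC).
    by congr (Rintegral _ _ _); apply/funext => x; rewrite /coord3 /=; ring.
  move=> m; rewrite -[RHS](S2 A B m mA mB).
  by congr (Rintegral _ _ _); apply/funext => x; rewrite /coord3 /=; ring.
have b3 A B C (mA : measurable A) (mB : measurable B) (mC : measurable C) :
   bounded_mfun (T := T3) (fun x : pt3 R => \1_A x.1.1 * \1_B x.1.2 * \1_C x.2 : R).
  exact: bounded_mfunM (bounded_mfunM (bi A o0 mA) (bi B o1 mB)) (bi C o2 mC).
have T3' A B C : measurable A -> measurable B -> measurable C ->
    (\int[mu]_x (g x * (\1_A x.1.1 * \1_B x.1.2 * \1_C x.2))%:E = 0)%E.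
  by move=> mA mB mC; apply: Rintegral_eq0; [exact: integrable_mulC (b3 _ _ _ mA mB mC)|exact: S3].
have ind1 (t : R) : \1_[set: R] t = 1 :> R by rewrite indicE in_setT.
have prodC d1 d2 (T1 : measurableType d1) (T2 : measurableType d2) :
    setI_closed [set A `*` B | A in @measurable _ T1 & B in @measurable _ T2].
  move=> _ _ [A mA [B mB <-]] [A' mA' [B' mB' <-]]; exists (A `&` A'); first exact: measurableI.
  by exists (B `&` B'); [exact: measurableI|rewrite setXI].
have indX (D : set T3) (h k : pt3 R -> R) : (forall x, k x = \1_D x * h x) ->
    (\int[mu]_(x in D) (h x)%:E = \int[mu]_x (k x)%:E)%E.
  move=> kh; rewrite [LHS]integral_mkcond; apply: eq_integral => x _.
  by rewrite patchE kh indicE; case: ifP => _; rewrite ?mul1r ?mul0r.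
have in2 (A B : set R) (z : R * R) : \1_(A `*` B) z = \1_A z.1 * \1_B z.2 :> R.
  by case: z => a b; rewrite !indicE in_setX -natrM mulnb.
(* The space is an iterated product, so Dynkin's argument is used twice: for the pair of the first
   two coordinates with [C] fixed, then for the outer product. *)
have S4 (E : set (mT * mT)) C : measurable E -> measurable C ->
    (\int[mu]_(x in E `*` C) (g x)%:E = 0)%E.
  move=> mE mC.
  have bC : bounded_mfun (T := T3) (fun x : pt3 R => \1_C x.2 : R) := bi C o2 mC.
  have := @preimage_integral_eq0 _ T3 R mu _ (mT * mT)%type fst _ (EFin \o (fun x => g x * \1_C x.2))
    measurable_fst (measurable_prod_measurableType mT mT) (prodC _ _ _ _) (integrable_mulC ig bC).
  move=> H; rewrite (indX _ g (fun x => \1_(E `*` C) x * g x))//.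
  transitivity (\int[mu]_(x in fst @^-1` E) (g x * \1_C x.2)%:E)%E.
    symmetry; apply: indX => x; rewrite mulrCA [LHS]mulrC; congr (_ * _).
    by case: x => a b; rewrite !indicE in_setX -natrM mulnb.
  apply: H => //.
    rewrite -[RHS](T3' setT setT C measurableT measurableT mC); apply: eq_integral => x _ /=.
    by rewrite !ind1 !mul1r.
  move=> _ [A mA [B mB <-]]; rewrite (indX _ _ (fun x => g x * (\1_A x.1.1 * \1_B x.1.2 * \1_C x.2))).
    exact: T3'.
  move=> x; have -> : \1_(fst @^-1` (A `*` B)) x = \1_A x.1.1 * \1_B x.1.2 :> R.
    by rewrite -in2 !indicE.
  by rewrite mulrCA.
have S5 (E : set T3) : measurable E -> (\int[mu]_(x in E) (g x)%:E = 0)%E.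
  move=> mE; have := @preimage_integral_eq0 _ T3 R mu _ T3 id _ (EFin \o g)
    (@measurable_id _ _ _) (measurable_prod_measurableType (mT * mT)%type mT) (prodC _ _ _ _) ig.
  move=> H; have := H _ _ E mE; rewrite preimage_id; apply.
    by have := S4 setT setT measurableT measurableT; rewrite setXTT.
  by move=> _ [A mA [B mB <-]]; exact: S4.
apply: (@integral_ae_eq _ T3 R mu setT measurableT) => // E _ mE.
by rewrite integral0; exact: S5.
Qed.

End CosineComplete.

(** * Partial sums over cubes of indices, orthogonality of the cosines *)

Section CubeSum.
Variable R : realType.

Definition cube_sum (t : nat -> nat -> nat -> R) (N : nat) : R :=
  \sum_(i < N) \sum_(j < N) \sum_(k < N) t i j k.

Lemma cube_sumS t N : cube_sum t N.+1 - cube_sum t N =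
  \sum_(i < N) \sum_(j < N) t i j N + \sum_(i < N) \sum_(k < N.+1) t i N k
  + \sum_(j < N.+1) \sum_(k < N.+1) t N j k.
Proof.
rewrite /cube_sum big_ord_recr/=.
have -> : \sum_(i < N) \sum_(j < N.+1) \sum_(k < N.+1) t i j k =
    \sum_(i < N) \sum_(j < N) \sum_(k < N) t i j k + \sum_(i < N) \sum_(j < N) t i j N
    + \sum_(i < N) \sum_(k < N.+1) t i N k.
  rewrite -!big_split; apply: eq_bigr => i _ /=; rewrite big_ord_recr/=; congr (_ + _).
  by rewrite -big_split; apply: eq_bigr => j _ /=; rewrite big_ord_recr.
by move: (\sum_(i < N) \sum_(j < N) \sum_(k < N) t i j k) => z; ring.
Qed.

(** Passing from [N + 1] to [N + 2] adds three faces of at most [(N + 2)^2] terms, each bounded by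
    [B / (N + 2)^4]. The increment is below [3 B / ((N + 1) (N + 2))], which telescopes to
    [3 B / (N + 1)]. *)
Lemma cube_sum_cvg (t : nat -> nat -> nat -> R) (B : R) : 0 <= B ->
  (forall i j k m, (m <= maxn i (maxn j k))%N -> `|t i j k| <= B / m.+1%:R ^+ 4) ->
  exists2 s : R, cube_sum t @ \oo --> s & forall N, `|s - cube_sum t N.+1| <= 3 * B / N.+1%:R.
Proof.
move=> B0 tB.
have step N : `|cube_sum t N.+2 - cube_sum t N.+1| <= 3 * B / N.+1%:R - 3 * B / N.+2%:R.
  have n1 : (0 : R) < N.+1%:R by [].
  have n2 : (0 : R) < N.+2%:R by [].
  have b2 (n m : nat) (F : 'I_n -> 'I_m -> R) : (n <= N.+2)%N -> (m <= N.+2)%N ->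
      (forall i j, `|F i j| <= B / N.+2%:R ^+ 4) ->
      `|\sum_i \sum_j F i j| <= B / N.+2%:R ^+ 2.
    move=> nN mN FB; apply: (@le_trans _ _ (\sum_(i < n) \sum_(j < m) B / N.+2%:R ^+ 4)).
      apply: (le_trans (ler_norm_sum _ _ _)); apply: ler_sum => i _.
      by apply: (le_trans (ler_norm_sum _ _ _)); apply: ler_sum => j _.
    rewrite (_ : \sum_(i < n) _ = B / N.+2%:R ^+ 4 * (n * m)%:R); last first.
      by rewrite !sumr_const !card_ord -mulrnA mulr_natr mulnC.
    rewrite natrM.
    have fE (q : R) : 0 < q -> B / q ^+ 2 = B / q ^+ 4 * (q * q) by move=> q0; field; rewrite gt_eqF.
    rewrite (fE _ n2).
    rewrite ler_wpM2l ?divr_ge0 ?exprn_ge0// mulrC ler_pM// ler_nat//.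
  rewrite cube_sumS; apply: (@le_trans _ _ (3 * (B / N.+2%:R ^+ 2))).
    have -> : 3 * (B / N.+2%:R ^+ 2) = B / N.+2%:R ^+ 2 + B / N.+2%:R ^+ 2 + B / N.+2%:R ^+ 2 :> R by ring.
    apply: (le_trans (ler_normD _ _)); apply: lerD.
      apply: (le_trans (ler_normD _ _)); apply: lerD; apply: b2 => // i j; apply: tB.
        by rewrite !leq_max leqnn !orbT.
      by rewrite !leq_max leqnn !orbT.
    by apply: b2 => // i j; apply: tB; rewrite !leq_max leqnn.
  have -> : 3 * B / N.+1%:R - 3 * B / N.+2%:R = 3 * (B / (N.+1%:R * N.+2%:R)) :> R.
    have fE (p : R) : 0 < p -> 3 * B / p - 3 * B / (p + 1) = 3 * (B / (p * (p + 1))).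
      move=> p0; have p1 : p + 1 != 0 by rewrite gt_eqF// ltr_wpDl// ltW.
      by field; rewrite ?p1 ?gt_eqF.
    by rewrite -[N.+2%:R]natr1 fE.
  rewrite ler_wpM2l// ler_wpM2l// lef_pV2 ?posrE ?mulr_gt0 ?exprn_gt0//.
  by rewrite expr2 ler_wpM2r// ler_nat.
pose a M := cube_sum t M.+1; pose e M : R := 3 * B / M.+1%:R.
(* Partial sums plus and minus the tail bound are monotone and enclose each other; this gives the
   limit and the error estimate at once. *)
pose v M := a M + e M; pose w M := a M - e M.
have e0 M : 0 <= e M by rewrite /e divr_ge0// mulr_ge0.
have st M : `|a M.+1 - a M| <= e M - e M.+1 := step M.
have nv : nonincreasing_seq v.
  by apply/nonincreasing_seqP => M; have := st M; rewrite ler_norml /v => /andP[]; lra.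
have nw : nondecreasing_seq w.
  by apply/nondecreasing_seqP => M; have := st M; rewrite ler_norml /w => /andP[]; lra.
have wv M : w M <= v M by have := e0 M; rewrite /w /v; lra.
have wvv M M' : w M <= v M'.
  rewrite (le_trans (nw M (maxn M M') (leq_maxl _ _)))// (le_trans (wv _))//.
  by rewrite nv// leq_maxr.
have lbv : has_lbound (range v) by exists (w 0%N) => _ [M _ <-].
have cv := nonincreasing_is_cvgn nv lbv.
have ce : e @ \oo --> (0 : R).
  rewrite -[0](mulr0 (3 * B)) /e; apply: cvgMr; exact: cvg_harmonic.
pose s := limn v.
have ca : a @ \oo --> s.
  rewrite (_ : a = fun M => v M - e M); last by apply/funext => M; rewrite /v addrK.
  by rewrite -[s]subr0; apply: cvgB.
exists s; first by rewrite -(cvg_shiftS (cube_sum t)).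
move=> N; rewrite -/(a N) -/(e N) ler_norml; apply/andP; split.
  have : w N <= s by apply: limr_ge => //; apply: nearW => M.
  by rewrite /w; lra.
have : s <= v N by apply: limr_le => //; near=> M; apply: nv; near: M; exact: nbhs_infty_ge.
by rewrite /v; lra.
Unshelve. all: by end_near.
Qed.

Lemma sum_delta (N a : nat) (F D : nat -> R) : (a < N)%N -> (forall i, i != a -> D i = 0) ->
  \sum_(i < N) F i * D i = F a * D a.
Proof.
move=> aN D0; rewrite (bigD1 (Ordinal aN))//= big1 ?addr0// => i ia.
by rewrite D0 ?mulr0.
Qed.

End CubeSum.

Section CosineOrthogonality.
Variable R : realType.
Local Notation leb := (@lebesgue_measure R).
Local Notation mT := (measurableTypeR R).
Local Notation T3 := (mT * mT * mT)%type.
Local Notation mu := (leb3 R).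

(** One of the two truncated differences is 0, so their sum is the distance of [m] and [l]. *)
Lemma cosmM (r t : R) (m l : nat) : cosm r m t * cosm r l t =
  2^-1 * cosm r (m + l) t + 2^-1 * cosm r ((m - l) + (l - m)) t.
Proof.
have H a b : (b <= a)%N -> cosm r a t * cosm r b t =
    2^-1 * cosm r (a + b) t + 2^-1 * cosm r (a - b) t.
  move=> ba; rewrite /cosm natrD natrB// !mulrDl !cosD mulNr cosN sinN.
  by move: (cos _) (sin _) (cos _) (sin _) => *; lra.
have [ml|lm] := leqP m l.
  by rewrite mulrC H// addnC (eqP ml) add0n.
by rewrite H ?(ltnW lm)// (eqP (ltnW lm : (l - m == 0)%N)) addn0.
Qed.

(** The squared L2 norm of the [m]-th cosine on the segment, twice as large for the constant one. *)
Definition cos_norm (r : R) (m : nat) : R := if m == 0%N then 2 * r else r.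

Lemma cosm_integral (r : R) (m : nat) : 0 < r ->
  (\int[leb]_(t in `[(- r)%R, r]) (cosm r m t)%:E = (if m == 0%N then 2 * r else 0)%:E)%E.
Proof.
move=> r0; have rr : - r < r by lra.
have [->|m0] := eqVneq m 0%N.
  rewrite (eq_integral (fun=> 1%:E)); last by move=> t _; rewrite cosm0.
  rewrite (@integral_cst _ mT R leb) ?mul1e//.
  have E : leb (`[(- r)%R, r]%classic : set R) = (2 * r)%:E.
    by rewrite lebesgue_measure_itv/= lte_fin rr -EFinD; congr (_%:E); ring.
  exact: E.
pose w : R := m%:R * (pi / (2 * r)).
have w0 : w != 0 by rewrite mulf_neq0 ?pnatr_eq0// gt_eqF// divr_gt0 ?pi_gt0 ?mulr_gt0.
pose F (t : R) := w^-1 * sin (w * (t + r)).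
have dF (t : R) : is_derive t 1 F (cosm r m t).
  have d1 : is_derive t 1 (fun t : R => w * (t + r)) w.
    have d := is_deriveZ w (is_deriveD (is_derive_id t 1) (is_derive_cst (r : R) t 1)).
    by apply: is_derive_eq d _; rewrite /GRing.scale/= addr0 mulr1.
  have d2 := @is_derive1_comp R sin (fun t : R => w * (t + r)) t _ _ (is_derive_sin _) d1.
  have d3 := @is_deriveZ R R R _ w^-1 t 1 _ d2.
  apply: is_derive_eq d3 _; rewrite /GRing.scale/= mulrCA mulVf// mulr1 /cosm /w.
  by congr cos; ring.
have dF' (t : R) : differentiable F t by apply/derivable1_diffP; have [] := dF t.
rewrite (@continuous_FTC2 _ (cosm r m) F (- r) r rr).
- rewrite -EFinB; congr (_%:E); rewrite /F addNr mulr0 sin0 mulr0 subr0.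
  rewrite (_ : w * (r + r) = m%:R * pi); last by rewrite /w; field; rewrite gt_eqF.
  have -> : sin (m%:R * pi) = 0 :> R; last by rewrite mulr0.
  elim: (m) => [|n IH]; first by rewrite mul0r sin0.
  by rewrite -natr1 mulrDl mul1r sinD IH sinpi mul0r mulr0 addr0.
- exact: continuous_subspaceT (@cosm_continuous R r m).
- split; first by move=> t _; have [] := dF t.
    by apply: cvg_at_right_filter; exact: differentiable_continuous.
  by apply: cvg_at_left_filter; exact: differentiable_continuous.
- by move=> t _; rewrite derive1E; have [_ ->] := dF t.
Qed.

(** Truncating one factor of each product to the segment lets all integrals run over the whole
    space. *)
Definition cosb (r : R) (m : nat) (t : R) : R := \1_(`[(- r)%R, r]%classic : set R) t * cosm r m t.

Lemma cosb_measurable r m : measurable_fun [set: mT] (cosb r m).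
Proof.
apply: measurable_funM; first by apply: measurable_indic; exact: measurable_itv.
exact: continuous_measurable_fun (@cosm_continuous R r m).
Qed.

Lemma cosb_le1 r m t : `|cosb r m t| <= 1.
Proof.
rewrite /cosb indicE normrM -[leRHS]mulr1 ler_pM//; last exact: cos_max.
by case: (_ \in _); rewrite ?normr1 ?normr0.
Qed.

Lemma cosb_out r m t : ~ (- r <= t <= r) -> cosb r m t = 0.
Proof. by move=> h; rewrite /cosb indicE memNset ?mul0r//= in_itv/=. Qed.

Lemma segment_measure_lty (r : R) : (leb (`[(- r)%R, r]%classic : set R) < +oo)%E.
Proof. by rewrite lebesgue_measure_itv/=; case: ifP; rewrite -?EFinD ltry. Qed.

Lemma square_measure_lty (r : R) :
  ((leb \x leb)%E ((`[(- r)%R, r]%classic `*` `[(- r)%R, r]%classic) : set (mT * mT)) < +oo)%E.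
Proof.
have mI : measurable (`[(- r)%R, r]%classic : set mT) by exact: measurable_itv.
rewrite product_measure1E//; apply: lte_mul_pinfty => //; last exact: segment_measure_lty.
by rewrite ge0_fin_numE//; exact: segment_measure_lty.
Qed.

Lemma cosb_cosm_integrable r m l : leb.-integrable [set: mT] (EFin \o (fun t => cosb r m t * cosm r l t)).
Proof.
apply: (@bounded_support_integrable _ mT R leb `[(- r)%R, r]%classic 1) => //.
- exact: segment_measure_lty.
- apply: measurable_funM; first exact: cosb_measurable.
  exact: continuous_measurable_fun (@cosm_continuous R r l).
- by move=> t _; rewrite normrM -[leRHS]mulr1 ler_pM//; [exact: cosb_le1|exact: cos_max].
- by move=> t h; rewrite cosb_out ?mul0r//; move: h; rewrite /= in_itv.
Qed.

Lemma cosb_cosm_integral r m l : 0 < r ->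
  \int[leb]_(t in [set: mT]) (cosb r m t * cosm r l t) = if m == l then cos_norm r m else 0.
Proof.
move=> r0; pose I : set mT := `[(- r)%R, r]%classic.
have mI : measurable I by exact: measurable_itv.
have -> : \int[leb]_(t in [set: mT]) (cosb r m t * cosm r l t) =
    \int[leb]_(t in I) (2^-1 * cosm r (m + l) t + 2^-1 * cosm r ((m - l) + (l - m)) t).
  rewrite /Rintegral [in RHS]integral_mkcond; congr fine; apply: eq_integral => t _.
  rewrite patchE /cosb indicE -/I; case: ifPn => _; last by rewrite !mul0r.
  by rewrite mul1r cosmM.
have ic k : leb.-integrable I (EFin \o cosm r k).
  apply: continuous_compact_integrable; first exact: segment_compact.
  exact: continuous_subspaceT (@cosm_continuous R r k).
have iz k : leb.-integrable I (EFin \o (fun t => 2^-1 * cosm r k t)).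
  exact: (@integrableZl _ mT R leb I mI 2^-1 _ (ic k)).
rewrite (@RintegralD _ mT R leb I) // !(@RintegralZl _ mT R leb I)//.
have E k : \int[leb]_(t in I) cosm r k t = if k == 0%N then 2 * r else 0.
  by rewrite /Rintegral cosm_integral.
rewrite !E /cos_norm.
have -> : ((m - l) + (l - m) == 0)%N = (m == l) by rewrite addn_eq0 !subn_eq0 -eqn_leq.
have [<-|ml] := eqVneq m l.
  by rewrite addn_eq0 andbb; case: ifP => _; lra.
rewrite addn_eq0; case: (m == 0%N) / eqP ml => [->|_] ml; last by rewrite !mulr0 addr0.
by rewrite eq_sym (negbTE ml) !mulr0 addr0.
Qed.

Lemma Rintegral_prod d1 d2 (T1 : measurableType d1) (T2 : measurableType d2)
    (m1 : {sigma_finite_measure set T1 -> \bar R}) (m2 : {sigma_finite_measure set T2 -> \bar R})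
    (h1 : T1 -> R) (h2 : T2 -> R) : m1.-integrable setT (EFin \o h1) ->
  m2.-integrable setT (EFin \o h2) ->
  (m1 \x m2)%E.-integrable setT (EFin \o (fun z => h1 z.1 * h2 z.2)) ->
  \int[(m1 \x m2)%E]_z (h1 z.1 * h2 z.2) = \int[m1]_x h1 x * \int[m2]_y h2 y.
Proof.
move=> i1 i2 i12; rewrite /Rintegral -(@integral12_prod_meas1 _ _ _ _ R m1 m2 _ i12).
have f1 := integrable_fin_num measurableT i1; have f2 := integrable_fin_num measurableT i2.
rewrite /fubini_F/=.
have -> : (\int[m1]_x \int[m2]_y (h1 x * h2 y)%:E = \int[m1]_x ((fine (\int[m2]_y (h2 y)%:E))%:E * (h1 x)%:E))%E.
  apply: eq_integral => x _; rewrite fineK//.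
  under eq_integral do rewrite EFinM.
  by rewrite integralZl// muleC.
by rewrite integralZl// -(fineK f1) -EFinM/= mulrC.
Qed.

Definition cos3 (r : R) i j k (x : pt3 R) : R := cosm r i x.1.1 * cosm r j x.1.2 * cosm r k x.2.
Definition cosb3 (r : R) i j k (x : pt3 R) : R := cosb r i x.1.1 * cosb r j x.1.2 * cosb r k x.2.

Lemma cos3_orthogonal r i j k a b c : 0 < r ->
  \int[mu]_x (cosb3 r i j k x * cos3 r a b c x) =
  (if i == a then cos_norm r i else 0) * (if j == b then cos_norm r j else 0) *
  (if k == c then cos_norm r k else 0).
Proof.
move=> r0; rewrite -!cosb_cosm_integral//.
pose h m l t := cosb r m t * cosm r l t.
have ih m l := cosb_cosm_integrable r m l.
have mh m l : measurable_fun [set: mT] (h m l) by apply/measurable_EFinP; exact: measurable_int (ih m l).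
have hb m l t : `|h m l t| <= 1.
  by rewrite normrM -[leRHS]mulr1 ler_pM//; [exact: cosb_le1|exact: cos_max].
have ho m l t : ~ (- r <= t <= r) -> h m l t = 0 by move=> ?; rewrite /h cosb_out ?mul0r.
have i2 : (prodm leb leb).-integrable [set: mT * mT] (EFin \o (fun z => h i a z.1 * h j b z.2)).
  apply: (@bounded_support_integrable _ (mT * mT)%type R (prodm leb leb)
    (`[(- r)%R, r]%classic `*` `[(- r)%R, r]%classic) 1) => //.
  - by apply: measurableX; exact: measurable_itv.
  - exact: square_measure_lty.
  - apply: measurable_funM; first exact: (measurableT_comp (mh i a) measurable_fst).
    exact: (measurableT_comp (mh j b) measurable_snd).
  - by move=> z _; rewrite normrM -[leRHS]mulr1 ler_pM.
  - move=> [z1 z2] /not_andP[] /= hz; first by rewrite ho ?mul0r//; move: hz; rewrite in_itv.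
    by rewrite [X in _ * X]ho ?mulr0//; move: hz; rewrite in_itv.
have i3 : (prodm leb leb \x leb)%E.-integrable [set: T3]
    (EFin \o (fun z => (h i a z.1.1 * h j b z.1.2) * h k c z.2)).
  apply: (@bounded_support_integrable _ T3 R (leb3 R) (cube r) 1) => //.
  - exact: cube_measurable.
  - exact: cube_measure_lty.
  - apply: measurable_funM; last exact: (measurableT_comp (mh k c) measurable_snd).
    apply: measurable_funM.
      exact: (measurableT_comp (mh i a) (measurableT_comp measurable_fst measurable_fst)).
    exact: (measurableT_comp (mh j b) (measurableT_comp measurable_snd measurable_fst)).
  - by move=> z _; rewrite normrM -[leRHS]mulr1 ler_pM// normrM -[leRHS]mulr1 ler_pM.
  - move=> [[z1 z2] z3] hz /=.
    have [q1|/negP q1] := boolP (- r <= z1 <= r); last by rewrite (ho _ _ z1)// !mul0r.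
    have [q2|/negP q2] := boolP (- r <= z2 <= r); last by rewrite (ho _ _ z2)// mulr0 mul0r.
    have [q3|/negP q3] := boolP (- r <= z3 <= r); last by rewrite (ho _ _ z3)// mulr0.
    by exfalso; apply: hz; rewrite cubeE /= !in_itv.
transitivity (\int[(prodm leb leb \x leb)%E]_z ((h i a z.1.1 * h j b z.1.2) * h k c z.2)).
  by congr (Rintegral _ _ _); apply/funext => z; rewrite /cosb3 /cos3 /h; ring.
rewrite (@Rintegral_prod _ _ _ _ (prodm leb leb) leb (fun z => h i a z.1 * h j b z.2) (h k c) i2 (ih k c) i3).
by congr (_ * _); exact: (@Rintegral_prod _ _ _ _ leb leb (h i a) (h j b) (ih i a) (ih j b) i2).
Qed.

End CosineOrthogonality.

(** * Truncation of the cosine series *)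

Section FourierBound.
Variable R : realType.
Local Notation mT := (measurableTypeR R).
Local Notation T3 := (mT * mT * mT)%type.
Local Notation mu := (leb3 R).
Local Notation integrable3 h :=
  ((mu : {measure set T3 -> \bar R}).-integrable [set: T3] (EFin \o h)).

Lemma integrable3D (h k : pt3 R -> R) : integrable3 h -> integrable3 k ->
  integrable3 (fun x => h x + k x).
Proof. by move=> ih ik; exact: (integrableD measurableT ih ik). Qed.

Lemma integrable3Z (a : R) (h : pt3 R -> R) : integrable3 h -> integrable3 (fun x => a * h x).
Proof. by move=> ih; exact: (integrableZl measurableT a ih). Qed.

Lemma integrable3_sum n (h : 'I_n -> pt3 R -> R) : (forall i, integrable3 (h i)) ->
  integrable3 (fun x => \sum_i h i x).
Proof.
elim: n h => [|n IH] h ih.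
  rewrite (_ : (fun _ => _) = (fun=> 0)); first exact: integrable0.
  by apply/funext => x; rewrite big_ord0.
rewrite (_ : (fun _ => _) = (fun x => h ord0 x + \sum_i h (lift ord0 i) x)).
  by apply: integrable3D => //; exact: IH.
by apply/funext => x; rewrite big_ord_recl.
Qed.

Lemma Rintegral3D (f g : pt3 R -> R) : integrable3 f -> integrable3 g ->
  \int[mu]_x (f x + g x) = \int[mu]_x f x + \int[mu]_x g x.
Proof. by move=> *; exact: (@RintegralD _ T3 R mu). Qed.

Lemma Rintegral3B (f g : pt3 R -> R) : integrable3 f -> integrable3 g ->
  \int[mu]_x (f x - g x) = \int[mu]_x f x - \int[mu]_x g x.
Proof. by move=> *; exact: (@RintegralB _ T3 R mu). Qed.

Lemma Rintegral3Z (a : R) (f : pt3 R -> R) : integrable3 f ->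
  \int[mu]_x (a * f x) = a * \int[mu]_x f x.
Proof. by move=> *; exact: (@RintegralZl _ T3 R mu). Qed.

Lemma Rintegral3_sum n (h : 'I_n -> pt3 R -> R) : (forall i, integrable3 (h i)) ->
  \int[mu]_x (\sum_i h i x) = \sum_i \int[mu]_x h i x.
Proof.
elim: n h => [|n IH] h ih.
  rewrite big_ord0 (_ : (fun _ => _) = (fun=> 0)); first by rewrite /Rintegral integral0.
  by apply/funext => x; rewrite big_ord0.
rewrite (_ : (fun _ => _) = (fun x => h ord0 x + \sum_i h (lift ord0 i) x)); last first.
  by apply/funext => x; rewrite big_ord_recl.
rewrite Rintegral3D//; last by apply: integrable3_sum.
by rewrite IH// big_ord_recl.
Qed.

Lemma bounded_mfun_cos3 r i j k : bounded_mfun (T := T3) (cos3 r i j k).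
Proof.
have b m c := @bounded_mfun_cosm R r m c.
exact: bounded_mfunM (bounded_mfunM (b i ord0) (b j (lift ord0 ord0))) (b k (lift ord0 (lift ord0 ord0))).
Qed.

Lemma cosb3_measurable r i j k : measurable_fun [set: T3] (cosb3 r i j k).
Proof.
apply: measurable_funM; last exact: (measurableT_comp (@cosb_measurable R r k) measurable_snd).
apply: measurable_funM.
  exact: (measurableT_comp (@cosb_measurable R r i) (measurableT_comp measurable_fst measurable_fst)).
exact: (measurableT_comp (@cosb_measurable R r j) (measurableT_comp measurable_snd measurable_fst)).
Qed.

Lemma cosb3_le1 (r : R) i j k (x : pt3 R) : `|cosb3 r i j k x| <= 1.
Proof.
by rewrite normrM -[leRHS]mulr1 ler_pM ?cosb_le1// normrM -[leRHS]mulr1 ler_pM ?cosb_le1.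
Qed.

Lemma cosb3_cube (r : R) i j k (x : pt3 R) : cosb3 r i j k x = \1_(cube r) x * cos3 r i j k x.
Proof.
rewrite /cosb3 /cosb /cos3; have -> : \1_(cube r) x = \1_(`[(- r)%R, r]%classic : set R) x.1.1 *
    \1_(`[(- r)%R, r]%classic : set R) x.1.2 * \1_(`[(- r)%R, r]%classic : set R) x.2 :> R.
  by case: x => [[x1 x2] x3]; rewrite cubeE !indicE !in_setX -!natrM !mulnb.
ring.
Qed.

Lemma cosb3_out (r : R) i j k (x : pt3 R) : ~ cube r x -> cosb3 r i j k x = 0.
Proof. by move=> xr; rewrite cosb3_cube indicE memNset ?mul0r. Qed.

Lemma cosb3_integrable r i j k : integrable3 (cosb3 r i j k).
Proof.
apply: (@bounded_support_integrable _ T3 R (leb3 R) (cube r) 1) => //.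
- exact: cube_measurable.
- exact: cube_measure_lty.
- exact: cosb3_measurable.
- by move=> x _; exact: cosb3_le1.
- by move=> x; exact: cosb3_out.
Qed.

Lemma cube_indic_integrable (r : R) : integrable3 (\1_(cube r) : pt3 R -> R).
Proof.
apply: (@bounded_support_integrable _ T3 R (leb3 R) (cube r) 1) => //.
- exact: cube_measurable.
- exact: cube_measure_lty.
- by apply: measurable_indic; exact: cube_measurable.
- by move=> x Qx; rewrite indicE mem_set// normr1.
- by move=> x Qx; rewrite indicE memNset.
Qed.

(** On the cube [|f| <= 1 + f ^+ 2]. *)
Lemma integrable_of_sqr (r : R) (f : pt3 R -> R) : measurable_fun [set: T3] f ->
  (forall x, ~ cube r x -> f x = 0) -> integrable3 (fun x => f x ^+ 2) -> integrable3 f.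
Proof.
move=> mf f0 if2; have iQ := cube_indic_integrable r.
apply: (@le_integrable _ T3 R mu setT measurableT _ (EFin \o (fun x => \1_(cube r) x + f x ^+ 2))).
- exact/measurable_EFinP.
- move=> x _ /=; rewrite lee_fin [leRHS]ger0_norm ?addr_ge0 ?sqr_ge0// indicE.
  have [Qx|/f0 ->] := pselect (cube r x); last by rewrite normr0 addr_ge0 ?sqr_ge0.
  rewrite mem_set//= -real_normK ?num_real//; have := normr_ge0 (f x).
  by move: `|f x| => t t0; have := sqr_ge0 (t - 1); nra.
- exact: integrable3D.
Qed.

(** The decay makes the series converge uniformly to a bounded [S]. All coefficients of [f - S]
    vanish, hence [f = S] almost everywhere by [cos_unique]. In [f ^+ 2 = f * S] the partial sum of
    [S] produces the squared coefficients and the uniformly small remainder the L1 norm of [f]. *)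
Lemma fourier_bound (r B : R) (f : pt3 R -> R) : 0 < r -> 0 <= B ->
  measurable_fun [set: T3] f -> (forall x, ~ cube r x -> f x = 0) ->
  integrable3 (fun x => f x ^+ 2) ->
  (forall i j k m, (m <= maxn i (maxn j k))%N ->
     `|\int[mu]_x (f x * cos3 r i j k x)| <= B / m.+1%:R ^+ 4) ->
  forall M, \int[mu]_x (f x ^+ 2) <=
    (r ^+ 3)^-1 * cube_sum (fun i j k => (\int[mu]_x (f x * cos3 r i j k x)) ^+ 2) M.+1
    + 3 * (B / r ^+ 3) / M.+1%:R * \int[mu]_x `|f x|.
Proof.
move=> r0 B0 mf f0 if2 cB M.
pose Q := cube r; have mQ : measurable (Q : set T3) by exact: cube_measurable.
have iQ := cube_indic_integrable r; have if1 := integrable_of_sqr mf f0 if2.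
pose c i j k := \int[mu]_x (f x * cos3 r i j k x).
pose nu m := cos_norm r m.
(* All squared norms are at least [r], so division by a product of three of them costs at most
   [(r ^+ 3)^-1]. *)
have nu_ge m : r <= nu m by rewrite /nu /cos_norm; case: ifP => _; lra.
have nu0 m : 0 < nu m := lt_le_trans r0 (nu_ge m).
pose a i j k := c i j k / (nu i * nu j * nu k).
have r3 : 0 < r ^+ 3 by rewrite exprn_gt0.
have nu3 i j k : r ^+ 3 <= nu i * nu j * nu k.
  by rewrite exprSr expr2 ler_pM ?mulr_ge0 ?(ltW r0)// ler_pM ?(ltW r0).
have nup i j k : 0 < nu i * nu j * nu k := lt_le_trans r3 (nu3 i j k).
pose B' := B / r ^+ 3; have B'0 : 0 <= B' by rewrite divr_ge0// ltW.
have aB i j k m : (m <= maxn i (maxn j k))%N -> `|a i j k| <= B' / m.+1%:R ^+ 4.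
  move=> mm; rewrite /a normf_div (gtr0_norm (nup i j k)) /B'.
  have -> : B / r ^+ 3 / m.+1%:R ^+ 4 = B / m.+1%:R ^+ 4 / r ^+ 3 by rewrite mulrAC.
  rewrite ler_pM ?invr_ge0 ?(ltW (nup _ _ _))//; first exact: cB.
  by rewrite lef_pV2 ?posrE.
pose t x i j k := a i j k * cosb3 r i j k x.
have tB x i j k m : (m <= maxn i (maxn j k))%N -> `|t x i j k| <= B' / m.+1%:R ^+ 4.
  move=> mm; rewrite /t normrM -[leRHS]mulr1 ler_pM ?cosb3_le1//; exact: aB.
pose SN N x := cube_sum (t x) N.
pose S x := limn (SN ^~ x).
have [cS SB] : (forall x, SN ^~ x @ \oo --> S x) /\
    (forall x N, `|S x - SN N.+1 x| <= 3 * B' / N.+1%:R).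
  split=> x; have [s cs sB] := cube_sum_cvg B'0 (tB x).
    by apply/cvg_ex; exists s.
  by have -> : S x = s by exact: (cvg_lim (@Rhausdorff R) cs).
have iSN N h : bounded_mfun (T := T3) h -> integrable3 (fun x => SN N x * h x).
  move=> bh; apply: integrable_mulC bh; rewrite /SN /cube_sum.
  by do 3 (apply: integrable3_sum => ?); apply: integrable3Z; exact: cosb3_integrable.
have mSN N : measurable_fun [set: T3] (SN N).
  apply/measurable_EFinP; have /measurable_int := iSN N _ (bounded_mfun_cst _ 1).
  by apply: eq_measurable_fun => x _ /=; rewrite mulr1.
have mS : measurable_fun [set: T3] S.
  by apply: (@measurable_fun_cvg _ T3 R setT SN S) => // x _; exact: cS.
have SN_out N x : ~ cube r x -> SN N x = 0.
  move=> xr; rewrite /SN /cube_sum big1// => i _; rewrite big1// => j _; rewrite big1// => k _.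
  by rewrite /t cosb3_out ?mulr0.
have S_out x : ~ cube r x -> S x = 0.
  move=> xr; rewrite /S (_ : SN ^~ x = fun=> 0) ?lim_cst//.
  by apply/funext => N; exact: SN_out.
have bS : bounded_mfun (T := T3) S.
  split=> //; exists (3 * B' + B') => x.
  have := SB x 0%N; rewrite divr1 => h.
  rewrite -[S x](subrK (SN 1 x)) (le_trans (ler_normD _ _))// lerD//.
  rewrite /SN /cube_sum !big_ord_recl !big_ord0 !addr0.
  by have := tB x 0%N 0%N 0%N 0%N isT; rewrite expr1n divr1.
have SQ x : S x = \1_Q x * S x.
  have [Qx|Qx] := pselect (Q x); first by rewrite indicE mem_set// mul1r.
  by rewrite S_out// mulr0.
have iSh h : bounded_mfun (T := T3) h -> integrable3 (fun x => S x * h x).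
  move=> bh; rewrite (_ : (fun _ => _) = (fun x => \1_Q x * (S x * h x))).
    by apply: integrable_mulC => //; exact: bounded_mfunM.
  by apply/funext => x; rewrite mulrA -SQ.
(* Orthogonality collapses the triple sum once [N] exceeds the three indices, and the norms cancel
   against the denominators in [a]. *)
have coefSN N i0 j0 k0 : (maxn i0 (maxn j0 k0) < N)%N ->
    \int[mu]_x (SN N x * cos3 r i0 j0 k0 x) = c i0 j0 k0.
  rewrite !gtn_max => /and3P[iN jN kN].
  have it i j k : integrable3 (fun x => t x i j k * cos3 r i0 j0 k0 x).
    apply: integrable_mulC (bounded_mfun_cos3 _ _ _ _); apply: integrable3Z; exact: cosb3_integrable.
  rewrite (_ : (fun _ => _) = (fun x => \sum_(i < N) \sum_(j < N) \sum_(k < N)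
      t x i j k * cos3 r i0 j0 k0 x)); last first.
    apply/funext => x; rewrite /SN /cube_sum mulr_suml; apply: eq_bigr => i _.
    by rewrite mulr_suml; apply: eq_bigr => j _; rewrite mulr_suml.
  rewrite Rintegral3_sum; last by move=> i; do 2 (apply: integrable3_sum => ?).
  pose D i0 i := if i == i0 then nu i else 0.
  have D0 (p q : nat) : q != p -> D p q = 0 by rewrite /D => /negbTE ->.
  transitivity (\sum_(i < N) (\sum_(j < N) (\sum_(k < N) a i j k * D k0 k) * D j0 j) * D i0 i).
    apply: eq_bigr => i _; rewrite Rintegral3_sum; last by move=> j; apply: integrable3_sum.
    rewrite mulr_suml; apply: eq_bigr => j _; rewrite Rintegral3_sum// !mulr_suml.
    apply: eq_bigr => k _; rewrite (_ : (fun _ => _) =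
      (fun x => a i j k * (cosb3 r i j k x * cos3 r i0 j0 k0 x))); last first.
      by apply/funext => x; rewrite /t -mulrA.
    rewrite Rintegral3Z//; last first.
      exact: integrable_mulC (cosb3_integrable _ _ _ _) (bounded_mfun_cos3 _ _ _ _).
    by rewrite cos3_orthogonal// /D /nu; ring.
  rewrite (sum_delta (fun i => \sum_(j < N) (\sum_(k < N) a i j k * D k0 k) * D j0 j) iN (D0 i0)).
  rewrite (sum_delta (fun j => \sum_(k < N) a i0 j k * D k0 k) jN (D0 j0)).
  rewrite (sum_delta (fun k => a i0 j0 k) kN (D0 k0)) /D !eqxx /a.
  by field; rewrite !gt_eqF.
pose g x := f x - S x.
have ig : integrable3 g.
  have iS : integrable3 S.
    by have := iSh _ (bounded_mfun_cst _ 1); rewrite (_ : (fun _ => _) = S)//; apply/funext => x; rewrite mulr1.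
  by have := integrableB measurableT if1 iS.
have g0 x : ~ cube r x -> g x = 0 by move=> xr; rewrite /g f0// S_out// subrr.
(* The coefficient of [f - S] equals that of [SN - S] for every large [N], hence is at most the
   uniform error times the volume of the cube; [N] tends to infinity in [cz]. *)
have cbig i j k N : (maxn i (maxn j k) < N.+1)%N ->
    `|\int[mu]_x (g x * cos3 r i j k x)| <= 3 * B' / N.+1%:R * \int[mu]_x \1_Q x.
  move=> hN; have bc := bounded_mfun_cos3 r i j k.
  have -> : \int[mu]_x (g x * cos3 r i j k x) = \int[mu]_x ((SN N.+1 x - S x) * cos3 r i j k x).
    rewrite /g.
    transitivity (\int[mu]_x (f x * cos3 r i j k x) - \int[mu]_x (S x * cos3 r i j k x)).
      rewrite -Rintegral3B//; [|exact: integrable_mulC|exact: iSh].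
      by congr (Rintegral _ _ _); apply/funext => x; rewrite mulrBl.
    rewrite -/(c i j k) -(coefSN _ _ _ _ hN) -Rintegral3B//; [|exact: iSN|exact: iSh].
    by congr (Rintegral _ _ _); apply/funext => x; rewrite mulrBl.
  have iD : integrable3 (fun x => (SN N.+1 x - S x) * cos3 r i j k x).
    rewrite (_ : (fun _ => _) = (fun x => SN N.+1 x * cos3 r i j k x - S x * cos3 r i j k x)).
      exact: (integrableB measurableT (iSN _ _ bc) (iSh _ bc)).
    by apply/funext => x; rewrite mulrBl.
  apply: (le_trans (@le_normr_Rintegral _ T3 R mu setT _ measurableT iD)).
  rewrite -Rintegral3Z//.
  apply: (@le_Rintegral _ T3 R mu) => //; [exact: integrable_norm iD|exact: integrable3Z|].
  move=> x _; rewrite normrM; have [Qx|Qx] := pselect (Q x); last first.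
    rewrite (S_out x Qx) (SN_out _ x Qx) subrr normr0 mul0r; apply: mulr_ge0; last by rewrite indicE.
    by rewrite divr_ge0// mulr_ge0.
  rewrite indicE mem_set//= ler_pM//; first by rewrite distrC; exact: SB.
  by rewrite !normrM -[leRHS]mulr1 ler_pM ?cos_max// -[leRHS]mulr1 ler_pM ?cos_max.
have cz i j k : \int[mu]_x (g x * cos3 r i j k x) = 0.
  apply/eqP; rewrite -normr_le0; pose V : R := \int[mu]_x \1_Q x.
  have Hc : (fun N : nat => 3 * B' * V * N.+1%:R^-1) @ \oo --> (0 : R).
    rewrite -[X in _ --> X](mulr0 (3 * B' * V)); apply: cvgMr; exact: cvg_harmonic.
  rewrite -(cvg_lim (@Rhausdorff R) Hc); apply: limr_ge; first exact: cvgP Hc.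
  near=> N; rewrite mulrAC; apply: cbig; rewrite ltnS.
  by near: N; exact: nbhs_infty_ge.
have fS : ae_eq mu (setT : set T3) (EFin \o (fun x => f x ^+ 2)) (EFin \o (fun x => f x * S x)).
  have := cos_unique r0 ig g0 cz; apply: filterS => x /= h Tx.
  have := h Tx; rewrite /g => -[] /eqP; rewrite subr_eq0 => /eqP fx.
  by rewrite expr2 {2}fx.
(* This takes the place of Parseval's identity: one factor [f] is kept, the other is expanded. *)
have -> : \int[mu]_x (f x ^+ 2) = \int[mu]_x (f x * S x).
  rewrite /Rintegral (ae_eq_integral _ _ _ _ _ fS)//; first exact: measurable_int if2.
  exact: measurable_int (integrable_mulC if1 bS).
have bSN : bounded_mfun (T := T3) (SN M.+1).
  split; first exact: mSN.
  have [_ [C SC]] := bS; exists (C + 3 * B' / M.+1%:R) => x.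
  by rewrite -(subKr (S x) (SN M.+1 x)) (le_trans (ler_normB _ _))// lerD.
have bSd : bounded_mfun (T := T3) (fun x => S x - SN M.+1 x).
  split; first exact: measurable_funB.
  by exists (3 * B' / M.+1%:R) => x.
have ifSN := integrable_mulC if1 bSN; have ifSd := integrable_mulC if1 bSd.
have -> : \int[mu]_x (f x * S x) = \int[mu]_x (f x * SN M.+1 x) + \int[mu]_x (f x * (S x - SN M.+1 x)).
  rewrite -Rintegral3D//; congr (Rintegral _ _ _); apply/funext => x.
  by rewrite -mulrDr subrKC.
apply: lerD; last first.
  apply: (le_trans (ler_norm _)); apply: (le_trans (@le_normr_Rintegral _ T3 R mu setT _ measurableT ifSd)).
  have in1 : integrable3 (fun x => `|f x|) by exact: (integrable_norm if1).
  rewrite -Rintegral3Z//.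
  apply: (@le_Rintegral _ T3 R mu) => //; [exact: (integrable_norm ifSd)|exact: integrable3Z|].
  by move=> x _; rewrite normrM mulrC ler_wpM2r//; exact: SB.
have it i j k : integrable3 (fun x => a i j k * (f x * cosb3 r i j k x)).
  apply: integrable3Z; apply: integrable_mulC => //.
  by split; [exact: cosb3_measurable|exists 1 => x; exact: cosb3_le1].
rewrite (_ : (fun x => f x * SN M.+1 x) = (fun x => \sum_(i < M.+1) \sum_(j < M.+1) \sum_(k < M.+1)
    a i j k * (f x * cosb3 r i j k x))); last first.
  apply/funext => x; rewrite /SN /cube_sum mulr_sumr; apply: eq_bigr => i _.
  rewrite mulr_sumr; apply: eq_bigr => j _; rewrite mulr_sumr; apply: eq_bigr => k _.
  by rewrite /t; ring.
rewrite Rintegral3_sum; last by move=> i; do 2 (apply: integrable3_sum => ?).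
rewrite /cube_sum mulr_sumr; apply: ler_sum => i _.
rewrite Rintegral3_sum; last by move=> j; apply: integrable3_sum.
rewrite mulr_sumr; apply: ler_sum => j _; rewrite Rintegral3_sum// mulr_sumr; apply: ler_sum => k _.
rewrite Rintegral3Z//; last first.
  apply: integrable_mulC => //.
  by split; [exact: cosb3_measurable|exists 1 => x; exact: cosb3_le1].
have -> : \int[mu]_x (f x * cosb3 r i j k x) = c i j k.
  congr (Rintegral _ _ _); apply/funext => x; rewrite cosb3_cube.
  have [Qx|/f0 ->] := pselect (Q x); last by rewrite !mul0r.
  by rewrite indicE mem_set// mul1r.
rewrite /a -/(c i j k) mulrAC -expr2 mulrC ler_wpM2r ?sqr_ge0// lef_pV2 ?posrE//.
Unshelve. all: by end_near.
Qed.

End FourierBound.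

(** * Fourier coefficients of the source *)

Section SourceDecay.
Variable R : realType.
Implicit Types (x d : pt3 R).
Local Notation mT := (measurableTypeR R).
Local Notation T3 := (mT * mT * mT)%type.
Local Notation mu := (leb3 R).
Local Notation integrable3 h :=
  ((mu : {measure set T3 -> \bar R}).-integrable [set: T3] (EFin \o h)).

Lemma ball3_open (r : R) : 0 < r -> open (ball3 r).
Proof.
move=> r0; rewrite (_ : ball3 r = [set x | enorm x ^+ 2 < r ^+ 2]); last first.
  by apply/seteqP; split=> x; rewrite /ball3/= ltr_pXn2r ?nnegrE ?enorm_ge0 ?ltW.
by apply: (@enorm2_open _ (fun t => t < r ^+ 2)); exact: open_lt.
Qed.

Lemma ball3_measurable (r : R) : 0 < r -> measurable (ball3 r : set T3).
Proof. by move=> /ball3_open; exact: open3_measurable. Qed.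

Lemma ball3_measure_le (r : R) : 0 < r -> (mu (ball3 r : set T3) <= ((2 * r) ^+ 3)%:E)%E.
Proof.
move=> r0; rewrite -(cube_measure (ltW r0)); apply: le_measure; rewrite ?inE.
- exact: ball3_measurable.
- exact: cube_measurable.
- by move=> x /ltW; exact: ball_cube.
Qed.

Lemma L2_extend0 (r : R) (f : pt3 R -> R) : 0 < r -> in_L2 (ball3 r) (cplx f) ->
  [/\ measurable_fun [set: T3] (extend0 r f),
      integrable3 (fun x => extend0 r f x ^+ 2) &
      L2norm2 (ball3 r) (cplx f) = (\int[mu]_x (extend0 r f x ^+ 2))%:E].
Proof.
move=> r0 [mf _ fin]; have mB := ball3_measurable r0.
have mf0 : measurable_fun [set: T3] (extend0 r f).
  exact/(measurable_restrictT _ mB).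
have E : (L2norm2 (ball3 r) (cplx f) = \int[mu]_x (extend0 r f x ^+ 2)%:E)%E.
  rewrite /L2norm2 integral_mkcond; apply: eq_integral => x _.
  rewrite /extend0 !patchE; case: ifP => _; last by rewrite expr0n.
  by rewrite cmod_cplx real_normK ?num_real.
have i2 : integrable3 (fun x => extend0 r f x ^+ 2).
  apply/integrableP; split; first by apply/measurable_EFinP; exact: measurable_funX.
  apply: le_lt_trans fin; rewrite E; apply: ge0_le_integral_nonmeasurable => x _.
    exact: abse_ge0.
  by rewrite /= ger0_norm ?sqr_ge0.
split=> //; rewrite E /Rintegral fineK//.
exact: integrable_fin_num i2.
Qed.

Lemma weak_deriv_L2norm_le n (r Q : R) (f : pt3 R -> R) (a : {ffun 'I_3 -> 'I_n.+1}) :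
  0 < Q -> in_sobolev n (ball3 r) (cplx f) -> (sobolev_norm n (ball3 r) (cplx f) <= Q%:E)%E ->
  (multi_order (fun i => val (a i)) <= n)%N ->
  (L2norm2 (ball3 r) (weak_deriv (ball3 r) (fun i => val (a i)) (cplx f)) <= (Q ^+ 2)%:E)%E.
Proof.
move=> Q0 _ + an; rewrite /sobolev_norm => H.
pose F (b : {ffun 'I_3 -> 'I_n.+1}) := L2norm2 (ball3 r) (weak_deriv (ball3 r) (val \o b) (cplx f)).
have F0 b : (0 <= F b)%E by apply: integral_ge0 => x _; rewrite lee_fin sqr_ge0.
have S0 : (0 <= \sum_(b : {ffun 'I_3 -> 'I_n.+1} | (multi_order (val \o b) <= n)%N) F b)%E.
  by apply: sume_ge0 => b _.
have S2 : (\sum_(b : {ffun 'I_3 -> 'I_n.+1} | (multi_order (val \o b) <= n)%N) F b <= (Q ^+ 2)%:E)%E.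
  by rewrite -lee_sqrt ?lee_fin ?sqr_ge0// EFin_expe sqrte_sqr gee0_abs// lee_fin ltW.
apply: le_trans S2; rewrite (bigD1 a)//=; apply: leeDl; exact: sume_ge0.
Qed.

(** The derivatives pass to the weak derivative [h], without sign as the order is even. The integral
    of [|h|] over the ball is bounded through [t <= t ^+ 2 / Q + Q]: the first term gives
    [Q ^+ 2 / Q], the second [Q] times the volume, hence the form of [C]. *)
Lemma weak_deriv_pairing (r : R) n Q f (a : 'I_3 -> nat) phi :
  0 < r -> 0 < Q -> in_sobolev n (ball3 r) (cplx f) ->
  (sobolev_norm n (ball3 r) (cplx f) <= Q%:E)%E -> (multi_order a <= n)%N -> ~~ odd (multi_order a) ->
  test_fun (ball3 r) phi -> (forall x, cmod (phi x) <= 1) ->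
  let C := Q * (1 + (2 * r) ^+ 3) in
  `|\int[mu]_(x in ball3 r) (f x * complex.Re (partial_multi a phi x))| <= C /\
  `|\int[mu]_(x in ball3 r) (f x * complex.Im (partial_multi a phi x))| <= C.
Proof.
move=> r0 Q0 sf nf an oa tphi phi1 C.
have an1 i : (a i < n.+1)%N.
  by rewrite ltnS (leq_trans _ an)// /multi_order (bigD1 i)//= leq_addr.
pose b : {ffun 'I_3 -> 'I_n.+1} := [ffun i => Ordinal (an1 i)].
have ab : (fun i => val (b i)) = a by apply/funext => i; rewrite ffunE.
have wl : (L2norm2 (ball3 r) (weak_deriv (ball3 r) a (cplx f)) <= (Q ^+ 2)%:E)%E.
  by have := @weak_deriv_L2norm_le n r Q f b Q0 sf nf; rewrite ab; apply.
have [_ [mRe mIm _] /(_ _ tphi)] : is_weak_deriv (ball3 r) a (cplx f) (weak_deriv (ball3 r) a (cplx f)).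
  by rewrite /weak_deriv; apply: xgetPex; exact: sf.
set h := weak_deriv _ _ _ in wl mRe mIm *.
have -> : (-1) ^+ multi_order a = 1 :> R[i] by rewrite -signr_odd (negbTE oa).
rewrite mul1r /cintegral => -[eRe eIm].
have mB := ball3_measurable r0.
have [/smooth_onP[sr si] _ _] := tphi.
have mr := continuous3_measurable (sm_continuous sr).
have mi := continuous3_measurable (sm_continuous si).
have mcm : measurable_fun (ball3 r : set T3) (fun x => cmod (h x) ^+ 2).
  rewrite (_ : (fun _ => _) = (fun x => complex.Re (h x) ^+ 2 + complex.Im (h x) ^+ 2)).
    by apply: measurable_funD; exact: measurable_funX.
  by apply/funext => x; rewrite cmod2.
have key (p : pt3 R -> R) : measurable_fun (ball3 r : set T3) p ->
    (forall x, `|p x| <= cmod (h x)) -> `|\int[mu]_(x in ball3 r) p x| <= C.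
  move=> mp ph; have H : (`|\int[mu]_(x in ball3 r) (p x)%:E| <= C%:E)%E.
    apply: (le_trans (@le_abse_integral _ T3 R mu _ _ mB _)); first exact/measurable_EFinP.
    apply: (@le_trans _ _ (\int[mu]_(x in ball3 r) ((Q^-1)%:E * (cmod (h x) ^+ 2)%:E + Q%:E))%E).
      apply: ge0_le_integral_nonmeasurable => x _; first exact: abse_ge0.
      rewrite -EFinM -EFinD lee_fin (le_trans (ph x))//.
      have := cmod_ge0 (h x); move: (cmod (h x)) => t t0.
      by rewrite -(ler_pM2l Q0) mulrDr mulVKf ?gt_eqF//; nra.
    rewrite (@ge0_integralD _ T3 R mu _ mB) //; last 3 first.
    - by move=> x _; rewrite -EFinM lee_fin mulr_ge0 ?sqr_ge0// invr_ge0 ltW.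
    - by apply: emeasurable_funM; [exact: measurable_cst|exact/measurable_EFinP].
    - by move=> x _; rewrite lee_fin ltW.
    rewrite (@ge0_integralZl_EFin _ T3 R mu _ mB) //; last 3 first.
    - by move=> x _; rewrite lee_fin sqr_ge0.
    - exact/measurable_EFinP.
    - by rewrite invr_ge0 ltW.
    rewrite (@integral_cst _ T3 R mu _ mB) /C mulrDr mulr1 EFinD; apply: leeD.
      apply: (@le_trans _ _ ((Q^-1)%:E * (Q ^+ 2)%:E)%E).
        by apply: lee_wpmul2l => //; rewrite lee_fin invr_ge0 ltW.
      by rewrite -EFinM expr2 mulKf ?gt_eqF.
    rewrite EFinM; apply: lee_wpmul2l; first by rewrite lee_fin ltW.
    exact: ball3_measure_le.
  have fin : (\int[mu]_(x in ball3 r) (p x)%:E)%E \is a fin_num.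
    by rewrite fin_num_abs (le_lt_trans H)// ltry.
  by rewrite -lee_fin /Rintegral; move: H; rewrite -{1}(fineK fin).
have hphi x : cmod (h x * phi x) <= cmod (h x).
  by rewrite cmodM -[leRHS]mulr1 ler_wpM2l ?cmod_ge0.
split.
  rewrite (_ : (fun _ => _) = (fun x => complex.Re (cplx f x * partial_multi a phi x))); last first.
    by apply/funext => x; rewrite ReM /= mul0r subr0.
  rewrite eRe; apply: key => [|x]; last exact: (le_trans (normRe_cmod _)).
  rewrite (_ : (fun _ => _) = (fun x => complex.Re (h x) * complex.Re (phi x) -
    complex.Im (h x) * complex.Im (phi x))); last by apply/funext => x; rewrite ReM.
  by apply: measurable_funB; apply: measurable_funM => //; exact: measurable_funTS.
rewrite (_ : (fun _ => _) = (fun x => complex.Im (cplx f x * partial_multi a phi x))); last first.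
  by apply/funext => x; rewrite ImM /= mul0r addr0.
rewrite eIm; apply: key => [|x]; last exact: (le_trans (normIm_cmod _)).
rewrite (_ : (fun _ => _) = (fun x => complex.Re (h x) * complex.Im (phi x) +
  complex.Im (h x) * complex.Re (phi x))); last by apply/funext => x; rewrite ImM.
by apply: measurable_funD; apply: measurable_funM => //; exact: measurable_funTS.
Qed.

(** The pure fourth derivative in direction [j]: of even order, and acting on a plane wave as
    multiplication by [(s * d_j) ^+ 4]. *)
Definition four_at (j : 'I_3) : 'I_3 -> nat := fun i => if i == j then 4%N else 0%N.

Lemma multi_order_four j : multi_order (four_at j) = 4%N.
Proof.
rewrite /multi_order (bigD1 j)//= {1}/four_at eqxx big1// => i ij.
by rewrite /four_at (negbTE ij).
Qed.

Lemma partial_multi_four j (g : pt3 R -> R[i]) :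
  partial_multi (four_at j) g = iter 4 (partial3 j) g.
Proof.
rewrite /partial_multi enum_ordSl enum_ordSl enum_ordSl /=.
rewrite (_ : enum 'I_0 = [::]) /=; last by apply: size0nil; rewrite size_enum_ord.
by case: j => [[|[|[|//]]] Hj]; rewrite /four_at /=; congr (partial3 _ (partial3 _ (partial3 _ (partial3 _ _))));
  apply/val_inj.
Qed.

Lemma iter_partial3_pw j s d m : iter m (partial3 j) (pw s d) =
  fun x => ((0 +i* 1)%C * s * (coord3 j d)%:C%C) ^+ m * pw s d x.
Proof.
elim: m => [|m IH]; first by apply/funext => x; rewrite expr0 mul1r.
rewrite iterS IH; apply/funext => x.
rewrite partial3Z; last exact: (csm_cdiff (csm_pw s d (@openT _)) I).
by rewrite partial3_pw mulrA -exprSr.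
Qed.

Lemma eq_on_iter_partial3 (U : set (pt3 R)) j (g h : pt3 R -> R[i]) m : open U ->
  (forall x, U x -> g x = h x) -> forall x, U x -> iter m (partial3 j) g x = iter m (partial3 j) h x.
Proof.
move=> oU gh; elim: m => [//|m IH] x Ux; rewrite !iterS.
exact: (eq_on_partial3 j oU IH Ux).
Qed.

Lemma cmod_pw_real (s : R) d x : cmod (pw s%:C%C d x) = 1.
Proof.
by rewrite /cmod /pw /= oppr0 mul0r expR0 !mul1r cos2Dsin2 sqrtr1.
Qed.

(** Four derivatives of the wave in one direction bring out [(s * d_j) ^+ 4], as [i^4 = 1], and
    [weak_deriv_pairing] bounds the result; [w = 1] is the case without derivatives. The wave
    becomes a test function by a cutoff that equals 1 on [ball3 rhat], where the source lives. *)
Lemma source_transform_decay (rhat r Q : R) n (f : pt3 R -> R) (s : R) d :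
  0 < rhat -> rhat < r -> (4 <= n)%N -> 0 < Q -> source_class rhat r n Q f -> 
  let C := Q * (1 + (2 * r) ^+ 3) in forall w, w = 1 \/ (exists j, w = (s * coord3 j d) ^+ 4) ->
  w * `|\int[mu]_x (extend0 r f x * complex.Re (pw s%:C%C d x))| <= C /\
  w * `|\int[mu]_x (extend0 r f x * complex.Im (pw s%:C%C d x))| <= C.
Proof.
move=> rh0 rhr n4 Q0 [sf nf supp] C w hw; have r0 := lt_trans rh0 rhr.
have oT := @openT (pt3 R).
(* With a quarter of the gap, and [q ^+ 2 = rhat ^+ 2 + e], the cutoff is 1 up to [rhat ^+ 2] and
   vanishes from [rhat ^+ 2 + 2 * e < r ^+ 2] on. *)
pose e := (r ^+ 2 - rhat ^+ 2) / 4; have rr : rhat ^+ 2 < r ^+ 2 by rewrite ltrXn2r ?nnegrE ?ltW.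
have e0 : 0 < e by rewrite divr_gt0// subr_gt0.
pose q := Num.sqrt (rhat ^+ 2 + e).
have q2 : q ^+ 2 = rhat ^+ 2 + e by rewrite sqr_sqrtr// addr_ge0 ?sqr_ge0// ltW.
pose chi := shell_cut q e.
pose phi x := cplx chi x * pw s%:C%C d x.
have sphi : csm setT phi by apply: csmM => //; [apply: csm_cplx; exact: sm_shell_cut|exact: csm_pw].
pose F := [set x : pt3 R | enorm x ^+ 2 <= q ^+ 2 + e].
have cF : closed F.
  rewrite (_ : F = ~` [set x | q ^+ 2 + e < enorm x ^+ 2]); last first.
    apply/seteqP; split=> x; rewrite /F/= => h; last by rewrite leNgt; exact/negP.
    by apply/negP; rewrite -leNgt.
  by apply: open_closedC; apply: (@enorm2_open _ (fun t => q ^+ 2 + e < t)); exact: open_gt.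
have FB : F `<=` ball3 r.
  move=> x; rewrite /F/ball3/= => xe; rewrite -(@ltr_pXn2r _ 2) ?nnegrE ?enorm_ge0 ?ltW//.
  by rewrite (le_lt_trans xe)// q2 /e; lra.
have tphi : test_fun (ball3 r) phi.
  apply: (csm_test_fun (a := r) sphi cF FB).
    by move=> x /FB /ltW; exact: ball_cube.
  move=> x; rewrite /F/= => /negP; rewrite -ltNge => xe.
  by rewrite /phi /cplx /chi shell_cut0 ?mul0r// ltW.
have phi1 x : cmod (phi x) <= 1.
  by rewrite /phi cmodM cmod_cplx cmod_pw_real mulr1 ger0_norm ?stp_ge0 ?stp_le1.
have phiE x : ball3 rhat x -> phi x = pw s%:C%C d x.
  move=> xr; rewrite /phi /cplx /chi shell_cut1 ?mul1r// q2 addrK.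
  by rewrite lerXn2r ?nnegrE ?enorm_ge0 ?(ltW rh0)// ltW.
have fE x : extend0 r f x != 0 -> ball3 rhat x by move=> h; apply: supp; exact: subset_closure.
have oB := ball3_open rh0.
have [a [an oa aE]] : exists a : 'I_3 -> nat, [/\ (multi_order a <= n)%N, ~~ odd (multi_order a) &
    forall x, ball3 rhat x -> partial_multi a phi x = w%:C%C * pw s%:C%C d x].
  case: hw => [->|[j ->]].
    exists (fun=> 0%N); rewrite /multi_order big1//; split=> // x xr.
    rewrite mul1r -(phiE x xr) /partial_multi.
    by elim: (enum _) => //= i l ->.
  exists (four_at j); rewrite multi_order_four; split=> // x xr.
  rewrite partial_multi_four (eq_on_iter_partial3 j 4 oB phiE xr) iter_partial3_pw.
  congr (_ * _); rewrite -mulrA exprMn -rmorphM -rmorphXn/=.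
  have -> : (0 +i* 1)%C ^+ 4 = 1 :> R[i].
    by rewrite (exprM _ 2 2); have -> : (0 +i* 1)%C ^+ 2 = -1 :> R[i]; [exact: sqr_i|rewrite sqrrN expr1n].
  by rewrite mul1r.
have w0 : 0 <= w.
  by case: hw => [->|[j ->]] //; rewrite (exprM _ 2 2) sqr_ge0.
have [HR HI] := weak_deriv_pairing r0 Q0 sf nf an oa tphi phi1.
have sr0 : in_sobolev n (ball3 r) (cplx f) := sf.
have [h0 [Lf _ _]] : exists h, is_weak_deriv (ball3 r) (fun=> 0%N) (cplx f) h.
  by apply: sf; rewrite /multi_order big1.
have [mf0 if2 _] := L2_extend0 r0 Lf.
have f0c x : ~ cube r x -> extend0 r f x = 0.
  move=> xr; rewrite /extend0 patchE memNset// => xb; apply: xr.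
  by apply: ball_cube; exact: ltW.
have if1 := integrable_of_sqr mf0 f0c if2.
have [spr spi] := csm_pw s%:C%C d oT.
have conv (P : R[i] -> R) : (forall z : R[i], P (w%:C%C * z) = w * P z) ->
   (forall z, `|P z| <= cmod z) -> sm setT (fun x => P (pw s%:C%C d x)) ->
   \int[mu]_(x in ball3 r) (f x * P (partial_multi a phi x)) =
   w * \int[mu]_x (extend0 r f x * P (pw s%:C%C d x)).
  move=> PZ P1 sP.
  have ip : integrable3 (fun x => extend0 r f x * P (pw s%:C%C d x)).
    apply: integrable_mulC => //; split; first exact: continuous3_measurable (sm_continuous sP).
    by exists 1 => x; rewrite (le_trans (P1 _))// cmod_pw_real.
  rewrite -Rintegral3Z// /Rintegral integral_mkcond; congr fine.
  apply: eq_integral => x _; rewrite patchE; case: ifPn => [xr|xr].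
    have Ef : extend0 r f x = f x by rewrite /extend0 patchE xr.
    have [fx0|fx0] := eqVneq (extend0 r f x) 0; first by rewrite -Ef fx0 !mul0r mulr0.
    by rewrite (aE x (fE x fx0)) PZ Ef; congr (_%:E); ring.
  by rewrite /extend0 patchE (negbTE xr) mul0r mulr0.
split; rewrite -(ger0_norm w0) -normrM.
  rewrite -(conv (@complex.Re R))//; last exact: normRe_cmod.
  by move=> z; rewrite ReM /= mul0r subr0.
rewrite -(conv (@complex.Im R))//; last exact: normIm_cmod.
by move=> z; rewrite ImM /= mul0r addr0.
Qed.

Lemma polar_direction x : exists2 d, enorm d = 1 & forall l, enorm x * coord3 l d = coord3 l x.
Proof.
have [z|z] := eqVneq (enorm x) 0.
  (* The zero vector has no direction; any unit vector does. *)
  exists (1, 0, 0); first by rewrite /enorm /= expr1n !expr0n/= !addr0 sqrtr1.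
  by move=> l; rewrite z mul0r; symmetry; apply/eqP; rewrite -normr_le0 -z enorm_coord3.
exists ((enorm x)^-1 * x.1.1, (enorm x)^-1 * x.1.2, (enorm x)^-1 * x.2).
  apply/eqP; rewrite -(@eqrXn2 _ 2)// ?enorm_ge0// enorm2 /= !exprMn -!mulrDr -enorm2.
  by rewrite -exprMn mulVf// expr1n.
by move=> l; rewrite /coord3; case: ifP => _; [|case: ifP => _]; rewrite /= mulVKf.
Qed.

(** A product of three cosines is the mean of four shifted cosines of [xi . x], one for each choice
    of signs of the last two components of [xi]. Each is a combination, with coefficients at most 1,
    of the real and imaginary parts of a plane wave at the real wavenumber [s = |xi|]; hence the
    factor 2. *)
Lemma cos3_coef_le (r b : R) i j k (f : pt3 R -> R) : 0 < r -> integrable3 f ->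
  (forall (s : R) d, 0 <= s -> enorm d = 1 -> s * coord3 ord0 d = pi / (2 * r) * i%:R ->
    `|s * coord3 (lift ord0 ord0) d| = pi / (2 * r) * j%:R ->
    `|s * coord3 (lift ord0 (lift ord0 ord0)) d| = pi / (2 * r) * k%:R ->
    `|\int[mu]_x (f x * complex.Re (pw s%:C%C d x))| <= b /\
    `|\int[mu]_x (f x * complex.Im (pw s%:C%C d x))| <= b) ->
  `|\int[mu]_x (f x * cos3 r i j k x)| <= 2 * b.
Proof.
move=> r0 iF H; have oT := @openT (pt3 R).
pose o := pi / (2 * r); have o0 : 0 < o by rewrite divr_gt0 ?pi_gt0 ?mulr_gt0.
pose xi (e1 e2 : R) : pt3 R := (o * i%:R, e1 * (o * j%:R), e2 * (o * k%:R)).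
(* The phase comes from the shift [t + r] in [cosm]. *)
pose ph (e1 e2 : R) x := cos (dot3 (xi e1 e2) x + dot3 (xi e1 e2) ((r, r), r)).
have bph e1 e2 : bounded_mfun (T := T3) (ph e1 e2).
  split; last by exists 1 => x; exact: cos_max.
  apply: continuous3_measurable; apply: sm_continuous; apply: (sm_cos oT).
  by apply: smD => //; [exact: sm_dot3|exact: sm_cst].
have dotE e1 e2 x : dot3 (xi e1 e2) x = o * i%:R * x.1.1 + e1 * (o * j%:R) * x.1.2 + e2 * (o * k%:R) * x.2.
  by rewrite /dot3 !big_ord_recl big_ord0 /coord3 /= addr0 addrA.
have cosE x : cos3 r i j k x = 4^-1 * (ph 1 1 x + ph 1 (-1) x + (ph (-1) 1 x + ph (-1) (-1) x)).
  pose A := i%:R * (o * (x.1.1 + r)); pose B := j%:R * (o * (x.1.2 + r)); pose C := k%:R * (o * (x.2 + r)).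
  have E e1 e2 : ph e1 e2 x = cos (A + e1 * B + e2 * C).
    by rewrite /ph !dotE /A /B /C /=; congr cos; ring.
  rewrite !E !mul1r !mulN1r -/(cos A * cos B * cos C) /cos3 /cosm -/A -/B -/C.
  rewrite !cosD !sinD !cosN !sinN; move: (cos A) (sin A) (cos B) (sin B) (cos C) (sin C) => *; lra.
have hb e1 e2 : `|e1| = 1 -> `|e2| = 1 -> `|\int[mu]_x (f x * ph e1 e2 x)| <= 2 * b.
  move=> n1 n2.
  have [d d1 dE] := polar_direction (xi e1 e2).
  set s := enorm _ in dE.
  have s0 : 0 <= s := enorm_ge0 _.
  have norm1 (e t : R) : `|e| = 1 -> 0 <= t -> `|e * t| = t.
    by move=> e1' t0; rewrite normrM e1' mul1r ger0_norm.
  have [h1 h2] : `|\int[mu]_x (f x * complex.Re (pw s%:C%C d x))| <= b /\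
    `|\int[mu]_x (f x * complex.Im (pw s%:C%C d x))| <= b.
    by apply: H => //; rewrite dE /coord3 /= -/o ?norm1// mulr_ge0// ltW.
  have dotd x : dot3 (xi e1 e2) x = s * dot3 d x.
    by rewrite /dot3 mulr_sumr; apply: eq_bigr => l _; rewrite mulrA dE.
  pose al := dot3 (xi e1 e2) ((r, r), r).
  have [sr si] := csm_pw s%:C%C d oT.
  have bP (P : R[i] -> R) : (forall z, `|P z| <= cmod z) -> sm setT (fun x => P (pw s%:C%C d x)) ->
      integrable3 (fun x => f x * P (pw s%:C%C d x)).
    move=> P1 sP; apply: integrable_mulC => //; split; first exact: continuous3_measurable (sm_continuous sP).
    by exists 1 => x; rewrite (le_trans (P1 _))// cmod_pw_real.
  have iR := bP _ (@normRe_cmod R) sr; have iI := bP _ (@normIm_cmod R) si.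
  rewrite (_ : (fun _ => _) = (fun x => cos al * (f x * complex.Re (pw s%:C%C d x)) +
      (- sin al) * (f x * complex.Im (pw s%:C%C d x)))); last first.
    apply/funext => x; rewrite /ph dotd -/al cosD /pw /= oppr0 mul0r expR0 !mul1r.
    by ring.
  rewrite Rintegral3D//; [|exact: integrable3Z|exact: integrable3Z].
  rewrite !Rintegral3Z// (le_trans (ler_normD _ _))// mulr_natl mulr2n.
  apply: lerD; rewrite normrM -[leRHS]mul1r ler_pM// ?normrN; [exact: cos_max|exact: sin_max].
have ifp e1 e2 := integrable_mulC iF (bph e1 e2).
rewrite (_ : (fun _ => _) = (fun x => 4^-1 * ((f x * ph 1 1 x + f x * ph 1 (-1) x) +
  (f x * ph (-1) 1 x + f x * ph (-1) (-1) x)))); last first.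
  by apply/funext => x; rewrite cosE; ring.
rewrite Rintegral3Z//; last by apply: integrable3D; apply: integrable3D.
rewrite Rintegral3D//; [|exact: integrable3D|exact: integrable3D].
rewrite !Rintegral3D// normrM ger0_norm ?invr_ge0// mulrC ler_pdivrMr//.
have n1 : `|1 : R| = 1 := normr1 _; have n2 : `|-1 : R| = 1 by rewrite normrN1.
have := (hb _ _ n1 n1, hb _ _ n1 n2, hb _ _ n2 n1, hb _ _ n2 n2).
move: (\int[mu]_x _) (\int[mu]_x _) (\int[mu]_x _) (\int[mu]_x _) => p q u v [[[h1 h2] h3] h4].
rewrite (le_trans (ler_normD _ _))// (le_trans (lerD (ler_normD _ _) (ler_normD _ _)))//; lra.
Qed.

End SourceDecay.

(** * Interpolation in the wavenumber *)

Section Interpolation.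
Variable R : realType.

Lemma cmod_prod (J : Type) (l : seq J) (P : pred J) (F : J -> R[i]) :
  cmod (\prod_(j <- l | P j) F j) = \prod_(j <- l | P j) cmod (F j).
Proof.
by elim/big_rec2 : _ => [|j y x _ <-]; [rewrite cmod_cplx normr1|rewrite cmodM].
Qed.

Lemma cmod_eq0 (z : R[i]) : cmod z = 0 -> z = 0.
Proof. by move=> h; apply/eqP; rewrite -normr_eq0 -cmod_norm h. Qed.

Lemma cmodV (z : R[i]) : cmod z^-1 = (cmod z)^-1.
Proof.
have [->|z0] := eqVneq z 0; first by rewrite invr0 cmod_cplx normr0 invr0.
have c0 : cmod z != 0 by apply: contra z0 => /eqP /cmod_eq0 ->.
by apply: (mulIf c0); rewrite mulVf// -cmodM mulVf// cmod_cplx normr1.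
Qed.

Definition lagrange_coef (N : nat) (s : nat -> R[i]) (z : R[i]) (j : nat) : R[i] :=
  \prod_(l < N | val l != j) ((z - s l) / (s j - s l)).

(** The difference between [X^p] and its interpolation polynomial has degree below [N] and [N]
    distinct roots. *)
Lemma lagrange_exp (N : nat) (s : nat -> R[i]) (z : R[i]) (p : nat) : (p < N)%N ->
  (forall j l, (j < N)%N -> (l < N)%N -> s j = s l -> j = l) ->
  \sum_(j < N) lagrange_coef N s z j * s j ^+ p = z ^+ p.
Proof.
move=> pN sI.
pose L (j : nat) : {poly R[i]} := \prod_(l < N | val l != j) ((s j - s l)^-1 *: ('X - (s l)%:P)).
have LE j x : (L j).[x] = lagrange_coef N s x j.
  by rewrite horner_prod; apply: eq_bigr => l _; rewrite hornerZ hornerXsubC mulrC.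
have sL (j : 'I_N) : (size (L j) <= N)%N.
  rewrite /L; apply: (leq_trans (size_poly_prod_leq _ _)).
  have h : (\sum_(l < N | val l != val j) size ((s j - s l)^-1 *: ('X - (s l)%:P))
      <= \sum_(l < N | val l != val j) 2)%N.
    by apply: leq_sum => l _; rewrite (leq_trans (size_scale_leq _ _))// size_XsubC.
  rewrite leq_subLR; apply: (leq_ltn_trans h); rewrite sum_nat_const muln2 -addnn ltn_add2l.
  rewrite (@eq_card _ _ (predC1 j)); last by move=> l; rewrite !inE.
  by rewrite cardC1 card_ord ltn_predL (leq_ltn_trans (leq0n _) (ltn_ord j)).
have Ld (i j : 'I_N) : lagrange_coef N s (s i) j = (i == j)%:R.
  have [->|ij] := eqVneq i j.
    rewrite /lagrange_coef big1// => l lj; rewrite divff// subr_eq0.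
    by apply: contra lj => /eqP /(sI _ _ (ltn_ord j) (ltn_ord l)) ->.
  by rewrite /lagrange_coef (bigD1 i)//= subrr mul0r mul0r.
pose q : {poly R[i]} := \sum_(j < N) (s j ^+ p) *: L j - 'X^p.
have q0 : q = 0.
  apply: (@roots_geq_poly_eq0 _ q [seq s i | i <- iota 0 N]).
  - apply/allP => _ /mapP[i + ->]; rewrite mem_iota add0n => /= iN.
    rewrite /root /q hornerD hornerN horner_sum hornerXn (bigD1 (Ordinal iN))//= big1 => [|j ji].
      by rewrite hornerZ LE (Ld (Ordinal iN) (Ordinal iN)) eqxx mulr1 addr0 subrr.
    rewrite hornerZ LE (Ld (Ordinal iN) j) eq_sym (negbTE ji) mulr0//.
  - rewrite map_inj_in_uniq ?iota_uniq// => i j; rewrite !mem_iota !add0n => /= iN jN.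
    exact: sI.
  - rewrite size_map size_iota (leq_trans (size_polyD _ _))// geq_max size_polyN size_polyXn pN andbT.
    apply: (leq_trans (size_sum _ _ _)); apply/bigmax_leqP => j _.
    exact: leq_trans (size_scale_leq _ _) (sL j).
have : q.[z] = 0 by rewrite q0 horner0.
rewrite /q hornerD hornerN horner_sum hornerXn => /eqP; rewrite subr_eq0 => /eqP <-.
by apply: eq_bigr => j _; rewrite hornerZ LE mulrC.
Qed.

Definition dist_nat (j l : nat) : nat := (j - l) + (l - j).

Lemma prod_dist_nat (j m : nat) :
  (\prod_(l < j + m.+1 | val l != j) dist_nat j l = j`! * m`!)%N.
Proof.
elim: m => [|m IH].
  rewrite addn1 big_mkcond big_ord_recr/= eqxx/= muln1 fact0 muln1.
  rewrite (eq_bigr (fun l : 'I_j => (j - l)%N)); last first.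
    move=> l _; rewrite (ltn_eqF (ltn_ord l))/= /dist_nat.
    by rewrite (eqP (ltnW (ltn_ord l) : (l - j == 0)%N)) addn0.
  rewrite (reindex_inj rev_ord_inj)/= (eq_bigr (fun l : 'I_j => l.+1)); last first.
    by move=> l _; rewrite subKn.
  by elim: j => [|j IH]; [rewrite big_ord0|rewrite big_ord_recr/= IH factS mulnC].
rewrite addnS big_mkcond big_ord_recr/= -big_mkcond/= IH factS.
have -> : ((j + m.+1)%N != j) by rewrite -[X in _ != X]addn0 eqn_add2l.
have -> : dist_nat j (j + m.+1) = m.+1.
  by rewrite /dist_nat addKn (eqP (leq_addr _ _ : (j - (j + m.+1) == 0)%N)).
by rewrite -mulnA [(m`! * _)%N]mulnC.
Qed.

(** The product is [j! (n - j)!], that is [n!] divided by a binomial coefficient, and the latter is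
    at most [2 ^ n]. *)
Lemma prod_dist_nat_ge (n j : nat) : (j <= n)%N ->
  (n`! <= 2 ^ n * \prod_(l < n.+1 | val l != j) dist_nat j l)%N.
Proof.
move=> jn; have -> : (\prod_(l < n.+1 | val l != j) dist_nat j l = j`! * (n - j)`!)%N.
  by rewrite -prod_dist_nat addnS subnKC.
rewrite -(bin_fact jn) leq_mul2r; apply/orP; right.
rewrite -[2%N]/(1 + 1)%N expnDn (bigD1 (Ordinal (jn : (j < n.+1)%N)))//=.
by rewrite !exp1n !muln1 leq_addr.
Qed.

(** Nodes separated like equally spaced points have denominators no smaller than
    [j! (n - j)! (del / (n + 1))^n]. The factorials compensate the power [(n + 1)^n] up to an
    exponential, so the weights grow only geometrically for fixed [T] and [del]. *)
Lemma lagrange_coef_le (n : nat) (s : nat -> R[i]) (z : R[i]) (j : nat) (T del : R) :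
  (j <= n)%N -> 0 < T -> 0 < del -> (forall l, (l <= n)%N -> cmod (z - s l) <= 2 * T) ->
  (forall i l, (i <= n)%N -> (l <= n)%N ->
     del * (dist_nat i l)%:R / n.+1%:R <= cmod (s i - s l)) ->
  cmod (lagrange_coef n.+1 s z j) <= (4 * T / del) ^+ n * expR n.+1%:R.
Proof.
move=> jn T0 d0 zs sep.
have n0 : (0 : R) < n.+1%:R by [].
have dn (l : 'I_n.+1) : val l != j -> (0 < dist_nat j l)%N.
  rewrite /dist_nat lt0n addn_eq0 !subn_eq0 -eqn_leq eq_sym; exact.
have cardE : #|[pred l : 'I_n.+1 | val l != j]| = n.
  rewrite (@eq_card _ _ (predC1 (Ordinal (jn : (j < n.+1)%N)))); last by move=> l; rewrite !inE.
  by rewrite cardC1 card_ord.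
pose q := 2 * T * n.+1%:R / del.
have q0 : 0 < q by rewrite divr_gt0// !mulr_gt0.
apply: (@le_trans _ _ (\prod_(l < n.+1 | val l != j) (q * ((dist_nat j l)%:R)^-1))).
  rewrite /lagrange_coef cmod_prod; apply: ler_prod => l lj; rewrite cmod_ge0/= cmodM cmodV.
  have dl : (0 : R) < (dist_nat j l)%:R by rewrite ltr0n dn.
  have sl := sep j l jn (ltn_ord l : (l <= n)%N).
  have c0 : 0 < cmod (s j - s l) by rewrite (lt_le_trans _ sl)// divr_gt0// mulr_gt0.
  rewrite ler_pdivrMr// (le_trans (zs l (ltn_ord l : (l <= n)%N)))//.
  have e1 : 2 * T = q * (dist_nat j l)%:R^-1 * (del * (dist_nat j l)%:R / n.+1%:R).
    by rewrite /q; field; rewrite !gt_eqF.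
  by rewrite {1}e1 ler_wpM2l// mulr_ge0 ?invr_ge0 ?(ltW q0)// ltW.
rewrite big_split/= prodr_const cardE prodfV.
pose P := (\prod_(l < n.+1 | val l != j) dist_nat j l)%N.
have -> : \prod_(l < n.+1 | val l != j) (dist_nat j l)%:R = P%:R :> R by rewrite -natr_prod.
have P0 : (0 : R) < P%:R by rewrite ltr0n prodn_cond_gt0.
have f0 : (0 : R) < n`!%:R by rewrite ltr0n fact_gt0.
have Pf : P%:R^-1 <= 2 ^+ n / n`!%:R :> R.
  rewrite ler_pdivlMr// mulrC ler_pdivrMr// -natrX -natrM ler_nat; exact: prod_dist_nat_ge.
(* A single term of the exponential series at [n + 1] stands in for Stirling's formula. *)
have nf : n.+1%:R ^+ n <= n`!%:R * expR n.+1%:R :> R.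
  have := expR_ge1Dxn n (ler0n R n.+1); rewrite factS natrM exprS -mulf_div divff ?gt_eqF// mul1r.
  move=> h; rewrite mulrC -ler_pdivrMr//; apply: le_trans h; by rewrite lerDr.
have -> : q ^+ n = (2 * T / del) ^+ n * n.+1%:R ^+ n by rewrite -exprMn /q; congr (_ ^+ _); ring.
have -> : (4 * T / del) ^+ n = (2 * T / del) ^+ n * 2 ^+ n by rewrite -exprMn; congr (_ ^+ _); ring.
have c0 : 0 <= (2 * T / del) ^+ n by rewrite exprn_ge0// ltW// divr_gt0// mulr_gt0.
rewrite -[X in X <= _]mulrA -[X in _ <= X]mulrA ler_wpM2l//.
apply: (@le_trans _ _ (n`!%:R * expR n.+1%:R * (2 ^+ n / n`!%:R))).
  by apply: ler_pM.
by rewrite le_eqVlt; apply/orP; left; apply/eqP; field; rewrite gt_eqF.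
Qed.

(* exp(i s t) *)
Definition ce (s : R[i]) (t : R) : R[i] :=
  (expR (- complex.Im s * t) * cos (complex.Re s * t)
     +i* (expR (- complex.Im s * t) * sin (complex.Re s * t)))%C.

Definition ce_taylor (N : nat) (s : R[i]) (t : R) : R[i] :=
  \sum_(p < N) ((0 +i* 1)%C * s) ^+ p * ((p`!%:R)^-1 * t ^+ p)%:C%C.

(** The mean value theorem for the difference between the claimed bound and [g], then for [- g]. *)
Lemma growth_bound (g dg : R -> R) (K t : R) (n : nat) : 0 <= t ->
  (forall u : R, is_derive u 1 g (dg u)) -> g 0 = 0 ->
  (forall u, 0 <= u <= t -> `|dg u| <= K * u ^+ n) -> `|g t| <= K * t ^+ n.+1 / n.+1%:R.
Proof.
move=> t0.
have half (g' dg' : R -> R) : (forall u : R, is_derive u 1 g' (dg' u)) -> g' 0 = 0 ->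
    (forall u, 0 <= u <= t -> dg' u <= K * u ^+ n) -> g' t <= K * t ^+ n.+1 / n.+1%:R.
  move=> hg g0 hd.
  pose h (u : R) := K / n.+1%:R * u ^+ n.+1 - g' u.
  have dh (u : R) : is_derive u 1 h (K * u ^+ n - dg' u).
    have d1 : is_derive u 1 (fun u : R => u ^+ n.+1) (n.+1%:R * u ^+ n).
      rewrite (_ : (fun _ => _) = horner ('X^(n.+1) : {poly R})); last first.
        by apply/funext => z; rewrite hornerXn.
      apply: DeriveDef; first exact: derivable_horner.
      by rewrite -derive1E -derivE derivXn hornerMn hornerXn mulr_natl.
    have d2 := is_deriveB (@is_deriveZ R R R _ (K / n.+1%:R) u 1 _ d1) (hg u).
    apply: is_derive_eq d2 _; rewrite /GRing.scale/=; congr (_ - _).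
    by rewrite mulrA divfK.
  have ch : {within `[0, t], continuous h}.
    apply: continuous_subspaceT => u; apply/differentiable_continuous/derivable1_diffP.
    by have [] := dh u.
  have [c ct hc] := MVT_segment t0 (fun u _ => dh u) ch.
  have : 0 <= h t - h 0.
    by rewrite hc subr0 mulr_ge0// subr_ge0 hd//; move: ct; rewrite in_itv.
  rewrite /h g0 expr0n/= mulr0 !subr0 subr_ge0 => h1; apply: (le_trans h1).
  by rewrite mulrAC.
move=> hg g0 hd; rewrite ler_norml; apply/andP; split.
  rewrite lerNl; apply: (half (fun u => - g u) (fun u => - dg u) (fun u => is_deriveN (hg u))).
    by rewrite g0 oppr0.
  by move=> u ut; rewrite (le_trans (ler_norm _))// normrN hd.
by apply: (half g dg) => // u ut; rewrite (le_trans (ler_norm _))// hd.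
Qed.

Lemma is_derive_poly (A : nat -> R) N (t : R) :
  is_derive t 1 (fun u => \sum_(p < N.+1) A p * ((p`!%:R)^-1 * u ^+ p))
    (\sum_(p < N) A p.+1 * ((p`!%:R)^-1 * t ^+ p)).
Proof.
pose P : {poly R} := \poly_(p < N.+1) (A p / p`!%:R).
have E : (fun u => \sum_(p < N.+1) A p * ((p`!%:R)^-1 * u ^+ p)) = horner P.
  by apply/funext => u; rewrite horner_poly; apply: eq_bigr => p _; rewrite mulrA.
have dP : P^`() = \poly_(p < N) (A p.+1 / p`!%:R).
  apply/polyP => p; rewrite coef_deriv !coef_poly ltnS; case: ifP => _; last by rewrite mul0rn.
  have p0 : p.+1%:R != 0 :> R by rewrite pnatr_eq0.
  have f0 : p`!%:R != 0 :> R by rewrite pnatr_eq0 -lt0n fact_gt0.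
  by rewrite -mulr_natr factS natrM; field; rewrite ?f0 ?p0 ?nat1r ?p0.
rewrite E; apply: DeriveDef; first exact: derivable_horner.
rewrite -derive1E -derivE dP horner_poly.
by apply: eq_bigr => p _; rewrite mulrA.
Qed.

(** The derivative of the remainder of order [N + 1] is [i * s] times the remainder of order [N].
    Real and imaginary parts are integrated separately, which doubles the bound at each step and
    explains [2 * cmod s]. *)
Lemma ce_taylor_ge0 (s : R[i]) (rho : R) N : forall t, 0 <= t <= rho ->
  cmod (ce s t - ce_taylor N s t) <=
  (2 * cmod s) ^+ N / N`!%:R * expR (cmod s * rho) * t ^+ N.
Proof.
pose I : R[i] := (0 +i* 1)%C.
elim: N => [|N IH] t /andP[t0 tr].
  rewrite /ce_taylor big_ord0 subr0 !expr0 fact0 divr1 mul1r mulr1.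
  rewrite /cmod /ce /= !exprMn -mulrDr cos2Dsin2 mulr1 sqrtr_sqr ger0_norm ?expR_ge0//.
  rewrite ler_expR (le_trans (ler_norm _))// normrM normrN ler_pM ?normIm_cmod//.
  by rewrite ger0_norm.
pose D (M : nat) u := ce s u - ce_taylor M s u.
pose K := cmod s * ((2 * cmod s) ^+ N / N`!%:R * expR (cmod s * rho)).
have bnd u : 0 <= u <= t -> cmod (I * s * D N u) <= K * u ^+ N.
  move=> /andP[u0 ut]; rewrite !cmodM (_ : cmod I = 1); last first.
    by rewrite /cmod/= expr0n expr1n add0r sqrtr1.
  rewrite mul1r /K -[X in _ <= X]mulrA ler_wpM2l ?cmod_ge0//.
  by apply: IH; rewrite u0 (le_trans ut).
have ISD u : I * s * D N u = I * s * ce s u - \sum_(p < N) (I * s) ^+ p.+1 * ((p`!%:R)^-1 * u ^+ p)%:C%C.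
  rewrite /D mulrBr /ce_taylor mulr_sumr; congr (_ - _); apply: eq_bigr => p _.
  by rewrite exprS !mulrA.
have dl (a u : R) : is_derive u 1 (fun t : R => a * t) a.
  by have := is_deriveZ a (is_derive_id u (1 : R)); rewrite /GRing.scale/= mulr1.
have de u := @is_derive1_comp R (@expR R) (fun t : R => - complex.Im s * t) u _ _ (is_derive_expR _) (dl _ u).
have dc u := @is_derive1_comp R (@cos R) (fun t : R => complex.Re s * t) u _ _ (is_derive_cos _) (dl _ u).
have ds u := @is_derive1_comp R (@sin R) (fun t : R => complex.Re s * t) u _ _ (is_derive_sin _) (dl _ u).
have dR (u : R) : is_derive u 1 (fun u => complex.Re (D N.+1 u)) (complex.Re (I * s * D N u)).
  have d1 := is_deriveM (de u) (dc u).
  have d2 := is_derive_poly (fun p => complex.Re ((I * s) ^+ p)) N u.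
  have := is_deriveB d1 d2; rewrite (_ : _ - _ = (fun u => complex.Re (D N.+1 u))); last first.
    apply/funext => z; rewrite /D ReD ReN /ce_taylor Re_sum /=; congr (_ - _).
    by apply: eq_bigr => p _; rewrite ReM /= mulr0 subr0.
  move=> hD; apply: is_derive_eq hD _; rewrite ISD ReD ReN Re_sum; congr (_ - _); last first.
    by apply: eq_bigr => p _; rewrite ReM /= mulr0 subr0.
  by rewrite !ReM !ImM /GRing.scale/=; ring.
have dI (u : R) : is_derive u 1 (fun u => complex.Im (D N.+1 u)) (complex.Im (I * s * D N u)).
  have d1 := is_deriveM (de u) (ds u).
  have d2 := is_derive_poly (fun p => complex.Im ((I * s) ^+ p)) N u.
  have := is_deriveB d1 d2; rewrite (_ : _ - _ = (fun u => complex.Im (D N.+1 u))); last first.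
    apply/funext => z; rewrite /D ImD ImN /ce_taylor Im_sum /=; congr (_ - _).
    by apply: eq_bigr => p _; rewrite ImM /= mulr0 add0r.
  move=> hD; apply: is_derive_eq hD _; rewrite ISD ImD ImN Im_sum; congr (_ - _); last first.
    by apply: eq_bigr => p _; rewrite ImM /= mulr0 add0r.
  by rewrite !ImM !ReM /GRing.scale/=; ring.
have D0 : D N.+1 0 = 0.
  rewrite /D /ce /ce_taylor !mulr0 expR0 cos0 sin0 mulr1 mulr0 big_ord_recl big1 => [|p _].
    rewrite !expr0 fact0 mulr1 mul1r invr1 addr0.
    by apply: complex_eq; rewrite /= ?oppr0 ?addr0 ?subrr.
  by rewrite expr0n/= mulr0 rmorph0 mulr0.
have hR := growth_bound t0 dR (congr1 (@complex.Re R) D0) (fun u ut => le_trans (normRe_cmod _) (bnd u ut)).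
have hI := growth_bound t0 dI (congr1 (@complex.Im R) D0) (fun u ut => le_trans (normIm_cmod _) (bnd u ut)).
apply: (le_trans (cmod_le _)); apply: (le_trans (lerD hR hI)).
have f0 : N`!%:R != 0 :> R by rewrite pnatr_eq0 -lt0n fact_gt0.
have n0 : N.+1%:R != 0 :> R by rewrite pnatr_eq0.
have fE (c e q f u v : R) : q != 0 -> f != 0 -> c * (u / f * e) * (t * v) / q
    + c * (u / f * e) * (t * v) / q = 2 * c * u / (q * f) * e * (t * v).
  by move=> q0 f0'; field; rewrite q0 f0'.
by rewrite /K factS natrM (exprS (2 * cmod s)) (exprS t) (fE _ _ _ _ _ _ n0 f0) lexx.
Qed.

Lemma ce_taylor_le (s : R[i]) (rho t : R) N : `|t| <= rho ->
  cmod (ce s t - ce_taylor N s t) <=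
  (2 * cmod s) ^+ N / N`!%:R * expR (cmod s * rho) * `|t| ^+ N.
Proof.
move=> tr; have [t0|t0] := leP 0 t.
  by have := @ce_taylor_ge0 s rho N t; rewrite (ger0_norm t0) in tr *; apply; rewrite t0.
(* The exponential and its Taylor sum depend on [s * t] only, so negative times are reached by
   changing both signs. *)
have := @ce_taylor_ge0 (- s) rho N (- t); rewrite cmodN ltr0_norm// in tr *.
have -> : ce (- s) (- t) = ce s t by rewrite /ce ReN ImN !mulrNN.
have -> : ce_taylor N (- s) (- t) = ce_taylor N s t.
  apply: eq_bigr => p _; rewrite mulrN exprNn [(- t) ^+ p]exprNn mulrCA rmorphM/= mulrACA.
  have -> : (-1) ^+ p * ((-1) ^+ p : R)%:C%C = 1 :> R[i].
    by rewrite rmorphXn rmorphN1/= -exprMn mulrNN mul1r expr1n.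
  by rewrite mul1r.
by apply; rewrite tr oppr_ge0 ltW.
Qed.

Local Notation mT := (measurableTypeR R).
Local Notation T3 := (mT * mT * mT)%type.
Local Notation mu := (leb3 R).
Local Notation integrable3 h :=
  ((mu : {measure set T3 -> \bar R}).-integrable [set: T3] (EFin \o h)).

Lemma integrable_mul_continuous (r : R) (f h : pt3 R -> R) : integrable3 f ->
  (forall x, ~ cube r x -> f x = 0) -> continuous h -> integrable3 (fun x => f x * h x).
Proof.
move=> iF f0 ch; have [M HM] := @real_compact_bounded R r h (fun x _ => ch x).
rewrite (_ : (fun _ => _) = (fun x => f x * (\1_(cube r) x * h x))); last first.
  apply/funext => x; have [xr|/f0 ->] := pselect (cube r x); last by rewrite !mul0r.
  by rewrite indicE mem_set// mul1r.
apply: integrable_mulC => //; split.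
  apply: measurable_funM; last exact: continuous3_measurable.
  by apply: measurable_indic; exact: cube_measurable.
exists `|M| => x; have [xr|xr] := pselect (cube r x).
  by rewrite indicE mem_set// mul1r (le_trans (HM x xr))// ler_norm.
by rewrite indicE memNset// mul0r normr0.
Qed.

(** The wave at [xi] is compared with the Lagrange combination of the waves at the nodes.
    Interpolation is exact on Taylor polynomials of degree at most [n], so only Taylor tails remain:
    one for [xi] and [n + 1] for the nodes, the latter with total weight [Lam]. *)
Lemma interp_transform (r T del b : R) n (s : nat -> R[i]) (xi : R) (d : pt3 R) (f : pt3 R -> R) :
  0 < r -> 0 < T -> 0 < del -> 0 <= b -> integrable3 f -> (forall x, ~ cube r x -> f x = 0) ->
  enorm d = 1 -> `|xi| <= T -> (forall j, (j <= n)%N -> cmod (s j) <= T) ->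
  (forall i l, (i <= n)%N -> (l <= n)%N ->
     del * (dist_nat i l)%:R / n.+1%:R <= cmod (s i - s l)) ->
  (forall j, (j <= n)%N -> `|\int[mu]_x (f x * complex.Re (pw (s j) d x))| <= b /\
     `|\int[mu]_x (f x * complex.Im (pw (s j) d x))| <= b) ->
  let Lam := n.+1%:R * ((4 * T / del) ^+ n * expR n.+1%:R) in
  let err := (6 * r * T) ^+ n.+1 / n.+1`!%:R * expR (3 * r * T) in
  let tot := Lam * (2 * b) + (1 + Lam) * err * \int[mu]_x `|f x| in
  `|\int[mu]_x (f x * complex.Re (pw xi%:C%C d x))| <= tot /\
  `|\int[mu]_x (f x * complex.Im (pw xi%:C%C d x))| <= tot.
Proof.
move=> r0 T0 del0 b0 iF f0 d1 xiT sT sep data Lam err tot.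
pose N := n.+1; pose L := lagrange_coef N s xi%:C%C.
pose lam := (4 * T / del) ^+ n * expR n.+1%:R.
have cxi : cmod (xi%:C%C) <= T by rewrite cmod_cplx.
have Lle j : (j <= n)%N -> cmod (L j) <= lam.
  move=> jn; apply: lagrange_coef_le => // l ln.
  by rewrite (le_trans (cmodD _ _))// cmodN (le_trans (lerD cxi (sT l ln)))//; lra.
have lam0 : 0 <= lam := le_trans (cmod_ge0 _) (Lle 0%N isT).
have sI j l : (j < N)%N -> (l < N)%N -> s j = s l -> j = l.
  move=> jN lN e; have := sep j l jN lN; rewrite e subrr cmod_cplx normr0 => h.
  apply/eqP; apply: contraTT h => jl; rewrite -ltNge divr_gt0// mulr_gt0// ltr0n.
  by rewrite /dist_nat lt0n addn_eq0 !subn_eq0 -eqn_leq.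
pose e x := pw xi%:C%C d x - \sum_(j < N) L j * pw (s j) d x.
have oT := @openT (pt3 R).
have dotx x : cube r x -> `|dot3 d x| <= 3 * r.
  move=> xr; rewrite /dot3 (le_trans (ler_norm_sum _ _ _))// (le_trans (@ler_sum _ _ _ _ _ (fun=> r) _))//.
    by move=> j _; rewrite normrM -[leRHS]mul1r ler_pM ?xr// -d1 enorm_coord3.
  by rewrite !big_ord_recl big_ord0; lra.
have r30 : 0 <= 3 * r by rewrite mulr_ge0// ltW.
have Tb z x : cmod z <= T -> cube r x -> cmod (ce z (dot3 d x) - ce_taylor N z (dot3 d x)) <= err.
  move=> zT xr; have tx := dotx x xr; apply: (le_trans (ce_taylor_le z N tx)).
  have fN : (0 : R) < N`!%:R by rewrite ltr0n fact_gt0.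
  rewrite /err mulrAC; apply: ler_pM.
  - by rewrite mulr_ge0 ?exprn_ge0// divr_ge0 ?exprn_ge0 ?mulr_ge0 ?cmod_ge0.
  - exact: expR_ge0.
  - rewrite mulrAC ler_wpM2r ?invr_ge0 ?(ltW fN)// -exprMn lerXn2r ?nnegrE ?mulr_ge0 ?cmod_ge0 ?(ltW r0) ?(ltW T0)//.
    rewrite (_ : 6 * r * T = 2 * T * (3 * r)); last by ring.
    by apply: ler_pM; rewrite ?mulr_ge0 ?cmod_ge0// ler_wpM2l.
  - by rewrite ler_expR mulrC ler_wpM2l.
have eE x : cube r x -> cmod (e x) <= (1 + Lam) * err.
  move=> xr; set t := dot3 d x.
  (* Powers of the wavenumber of exponent below [N] are reproduced by [lagrange_exp], for each [t]
     separately. *)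
  have Tay : ce_taylor N xi%:C%C t = \sum_(j < N) L j * ce_taylor N (s j) t.
    rewrite /ce_taylor; under [RHS]eq_bigr do rewrite mulr_sumr.
    rewrite exchange_big/=; apply: eq_bigr => p _.
    rewrite exprMn -(lagrange_exp xi%:C%C (ltn_ord p) sI) mulr_sumr mulr_suml.
    by apply: eq_bigr => j _; rewrite exprMn /L; ring.
  have -> : e x = (ce xi%:C%C t - ce_taylor N xi%:C%C t)
      - \sum_(j < N) L j * (ce (s j) t - ce_taylor N (s j) t).
    have -> : \sum_(j < N) L j * (ce (s j) t - ce_taylor N (s j) t) =
        \sum_(j < N) L j * ce (s j) t - \sum_(j < N) L j * ce_taylor N (s j) t.
      by rewrite -sumrB; apply: eq_bigr => j _; rewrite mulrBr.
    by rewrite Tay opprB addrA subrK.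
  rewrite (le_trans (cmodD _ _))// cmodN mulrDl mul1r lerD//; first exact: Tb.
  rewrite (le_trans (cmod_sum _ _ _))//.
  apply: (le_trans (@ler_sum _ _ _ _ _ (fun=> lam * err) _)).
    move=> j _; rewrite cmodM ler_pM ?cmod_ge0//; first exact: (Lle j (ltn_ord j : (j <= n)%N)).
    by apply: Tb => //; exact: (sT j (ltn_ord j : (j <= n)%N)).
  by rewrite sumr_const card_ord /Lam -mulrA mulr_natl.
have se : csm setT e.
  apply: csmD => //; first exact: csm_pw.
  apply: csmN => //; apply: csm_sum => // j; apply: csmM => //; [exact: csm_cst|exact: csm_pw].
have err0 : 0 <= (1 + Lam) * err.
  have r00 : cube r (0, 0, 0) by move=> l; rewrite /coord3; case: ifP => _; [|case: ifP => _]; rewrite /= normr0 ltW.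
  exact: le_trans (cmod_ge0 _) (eE _ r00).
have in1 : integrable3 (fun x => `|f x|) by exact: (integrable_norm iF).
have main (P : R[i] -> R) : (forall z, `|P z| <= cmod z) -> (forall z1 z2, P (z1 + z2) = P z1 + P z2) ->
    (forall F : 'I_N -> R[i], P (\sum_j F j) = \sum_j P (F j)) ->
    (forall g, csm setT g -> sm setT (fun x => P (g x))) ->
    (forall l j, (j <= n)%N -> `|\int[mu]_x (f x * P (l * pw (s j) d x))| <= cmod l * (2 * b)) ->
    `|\int[mu]_x (f x * P (pw xi%:C%C d x))| <= tot.
  move=> P1 PD PS smP Pb.
  have ic g : csm setT g -> integrable3 (fun x => f x * P (g x)).
    by move=> sg; apply: (integrable_mul_continuous iF f0); exact: sm_continuous (smP _ sg).
  have sj j : csm setT (fun x => L j * pw (s j) d x).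
    by apply: csmM => //; [exact: csm_cst|exact: csm_pw].
  have -> : \int[mu]_x (f x * P (pw xi%:C%C d x)) =
      \int[mu]_x (\sum_(j < N) f x * P (L j * pw (s j) d x)) + \int[mu]_x (f x * P (e x)).
    rewrite -Rintegral3D//; last 2 first.
    - by apply: integrable3_sum => j; apply: ic.
    - exact: ic.
    congr (Rintegral _ _ _); apply/funext => x; rewrite -mulr_sumr -mulrDr -PS -PD; congr (_ * P _).
    by rewrite /e addrC subrK.
  apply: (le_trans (ler_normD _ _)); apply: lerD.
    rewrite Rintegral3_sum; last by move=> j; exact: ic.
    apply: (le_trans (ler_norm_sum _ _ _)).
    apply: (le_trans (@ler_sum _ _ _ _ _ (fun=> lam * (2 * b)) _)).
      move=> j _; have jn : (j <= n)%N := ltn_ord j; apply: (le_trans (Pb _ _ jn)).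
      by rewrite ler_wpM2r ?mulr_ge0// Lle.
    by rewrite sumr_const card_ord (_ : Lam = lam *+ N) ?mulrnAl// -mulr_natl.
  have ie := ic _ se.
  apply: (le_trans (@le_normr_Rintegral _ T3 R mu setT _ measurableT ie)).
  rewrite -Rintegral3Z//.
  apply: (@le_Rintegral _ T3 R mu) => //; [exact: (integrable_norm ie)|exact: integrable3Z|].
  move=> x _; rewrite normrM mulrC; have [xr|/f0 ->] := pselect (cube r x); last by rewrite normr0 !mulr0.
  by rewrite ler_wpM2r// (le_trans (P1 _))// eE.
have iRe j := integrable_mul_continuous iF f0 (sm_continuous (csm_pw (s j) d oT).1).
have iIm j := integrable_mul_continuous iF f0 (sm_continuous (csm_pw (s j) d oT).2).
have comb (p q u v c1 c2 m : R) : `|p| <= m -> `|q| <= m -> `|c1| <= b -> `|c2| <= b ->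
    `|p * c1 + q * c2| <= m * (2 * b).
  move=> pm qm c1b c2b; rewrite (le_trans (ler_normD _ _))// !normrM.
  have := ler_pM (normr_ge0 _) (normr_ge0 _) pm c1b; have := ler_pM (normr_ge0 _) (normr_ge0 _) qm c2b.
  by clear; lra.
split; apply: main.
- exact: normRe_cmod.
- exact: ReD.
- exact: Re_sum.
- by move=> g [].
- move=> l j jn; have [h1 h2] := data j jn.
  rewrite (_ : (fun _ => _) = (fun x => complex.Re l * (f x * complex.Re (pw (s j) d x)) +
     (- complex.Im l) * (f x * complex.Im (pw (s j) d x)))); last first.
    by apply/funext => x; rewrite ReM; ring.
  rewrite Rintegral3D//; [|exact: integrable3Z|exact: integrable3Z].
  rewrite !Rintegral3Z//; apply: comb => //; first exact: normRe_cmod.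
  by rewrite normrN normIm_cmod.
- exact: normIm_cmod.
- exact: ImD.
- exact: Im_sum.
- by move=> g [].
- move=> l j jn; have [h1 h2] := data j jn.
  rewrite (_ : (fun _ => _) = (fun x => complex.Im l * (f x * complex.Re (pw (s j) d x)) +
     complex.Re l * (f x * complex.Im (pw (s j) d x)))); last first.
    by apply/funext => x; rewrite ImM; ring.
  rewrite Rintegral3D//; [|exact: integrable3Z|exact: integrable3Z].
  rewrite !Rintegral3Z//; apply: comb => //; first exact: normIm_cmod.
  exact: normRe_cmod.
Qed.

(** * Choice of wavenumbers and separation of their roots *)

Lemma fourth_root (z : R[i]) : exists s, s ^+ 4 = z.
Proof. by exists (4.-root z); apply: rootCK. Qed.

(** The upper half of the interval contains [n + 1] cells of length [h] separated by gaps of length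
    [h]. Were the data above the stated bound throughout one cell, that cell alone would contribute
    [2 * e ^+ 2] to the integral. *)
Lemma wavenumber_nodes (K e : R) (n : nat) (g : R -> \bar R) : 0 < K -> 0 < e ->
  (forall k, 0 <= g k)%E ->
  (\int[@lebesgue_measure R]_(k in `]0%R, K[) g k <= (e ^+ 2)%:E)%E ->
  exists k : nat -> R, (forall j, (j <= n)%N ->
      [/\ K / 2 <= k j, k j <= K & (g (k j) <= (8 * n.+1%:R / K * e ^+ 2)%:E)%E]) /\
    (forall j l, (j <= n)%N -> (l <= n)%N ->
      K / 4 * (dist_nat j l)%:R / n.+1%:R <= `|k j - k l|).
Proof.
(* [h] is the length [K / 2] divided into [n + 1] pairs of a cell and a gap. *)
move=> K0 e0 g0 gK; pose h := K / (4 * n.+1%:R).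
have n0 : (0 : R) < n.+1%:R by [].
have h0 : 0 < h by rewrite divr_gt0// mulr_gt0.
have hE : K = 4 * n.+1%:R * h by rewrite /h; field; rewrite gt_eqF.
pose lo (j : nat) := K / 2 + 2 * j%:R * h; pose hi (j : nat) := lo j + h.
have hiK j : (j <= n)%N -> hi j < K.
  move=> jn; rewrite /hi /lo {2}hE {1}hE.
  have jn' : j%:R + 1 <= n.+1%:R :> R by rewrite natr1 ler_nat.
  have := ler_wpM2r (ltW h0) jn'; rewrite mulrDl mul1r => ?; lra.
have ex j : exists k : R, (j <= n)%N -> lo j <= k <= hi j /\ (g k <= (8 * n.+1%:R / K * e ^+ 2)%:E)%E.
  have [jn|] := boolP (j <= n)%N; last by exists 0.
  apply: contrapT => H.
  pose c := 8 * n.+1%:R / K * e ^+ 2.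
  have cE : c * h = 2 * e ^+ 2 by rewrite /c /h; field; rewrite !gt_eqF.
  have c0 : 0 <= c by rewrite mulr_ge0 ?sqr_ge0// divr_ge0// ?mulr_ge0// ltW.
  pose I : set R := `[lo j, hi j]%classic.
  have mI : measurable I by exact: measurable_itv.
  have lebI : @lebesgue_measure R I = h%:E.
    rewrite /I lebesgue_measure_itv/= lte_fin ifT; last by rewrite /hi ltrDl.
    by rewrite -EFinD; congr (_%:E); rewrite /hi addrC addKr.
  have big : ((2 * e ^+ 2)%:E <= \int[@lebesgue_measure R]_(k in `]0%R, K[) g k)%E.
    apply: (@le_trans _ _ (\int[@lebesgue_measure R]_(k in I) c%:E)%E).
      by rewrite (@integral_cst _ mT R _ I mI) [X in (_ <= _ * X)%E]lebI -EFinM cE.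
    apply: (@le_trans _ _ (\int[@lebesgue_measure R]_(k in I) g k)%E).
      apply: ge0_le_integral_nonmeasurable => k kI; first by rewrite lee_fin.
      rewrite leNgt; apply/negP => /ltW gk; apply: H; exists k => _; split => //.
    rewrite [X in (X <= _)%E]integral_mkcond [X in (_ <= X)%E]integral_mkcond.
    apply: ge0_le_integral_nonmeasurable => k _; rewrite !patchE; first by case: ifP.
    case: ifPn => [kI|_]; last by case: ifP.
    rewrite ifT//; move: kI; rewrite !inE /I/= !in_itv/= => /andP[k1 k2].
    rewrite (le_lt_trans k2 (hiK j jn)) andbT (lt_le_trans _ k1)// /lo.
    by rewrite ltr_wpDr ?divr_gt0// mulr_ge0 ?(ltW h0)// mulr_ge0.
  have := le_trans big gK; rewrite lee_fin; have := exprn_gt0 2 e0; lra.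
have /choice[k kP] := ex; exists k; split=> [j jn|j l jn ln].
  have [/andP[k1 k2] kg] := kP j jn; split=> //; last by rewrite (le_trans k2)// ltW// hiK.
  by rewrite (le_trans _ k1)// /lo lerDl mulr_ge0 ?(ltW h0)// mulr_ge0.
have -> : K / 4 * (dist_nat j l)%:R / n.+1%:R = (dist_nat j l)%:R * h.
  by rewrite /h; field; rewrite gt_eqF.
(* The distance is at least [2 * (b - a) * h - h], and [b - a >= 1] lets the gap absorb the lost
   [h]. *)
have half (a b : nat) : (a < b)%N -> (a <= n)%N -> (b <= n)%N -> (dist_nat a b)%:R * h <= k b - k a.
  move=> ab an bn; have [/andP[a1 a2] _] := kP a an; have [/andP[b1 b2] _] := kP b bn.
  have -> : (dist_nat a b)%:R = b%:R - a%:R :> R.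
    by rewrite /dist_nat (eqP (ltnW ab : (a - b == 0)%N)) add0n natrB// ltnW.
  have ba : 1 <= b%:R - a%:R :> R by rewrite lerBrDr nat1r ler_nat.
  have := ler_wpM2r (ltW h0) ba; rewrite mul1r mulrBl => hh.
  move: a2 b1; rewrite /hi /lo => a2 b1; lra.
have [jl|lj|->] := ltngtP j l.
- by rewrite distrC (le_trans (half _ _ jl jn ln))// ler_norm.
- by rewrite /dist_nat addnC (le_trans (half _ _ lj ln jn))// ler_norm.
- by rewrite /dist_nat subnn mul0r normr_ge0.
Qed.

(** The Lipschitz bound of the fourth power is used backwards: separated values force separated
    roots, whichever branch of the root was taken at each node. *)
Lemma root_separation (S0 : R) (s t : R[i]) : cmod s <= S0 -> cmod t <= S0 ->
  cmod (s ^+ 4 - t ^+ 4) <= 4 * S0 ^+ 3 * cmod (s - t).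
Proof.
move=> sS tS; have S00 := le_trans (cmod_ge0 _) sS.
have -> : s ^+ 4 - t ^+ 4 = (s * s * s + s * s * t + s * t * t + t * t * t) * (s - t) by ring.
rewrite cmodM ler_wpM2r ?cmod_ge0//.
have c3 (a b c : R[i]) : cmod a <= S0 -> cmod b <= S0 -> cmod c <= S0 -> cmod (a * b * c) <= S0 ^+ 3.
  by move=> *; rewrite !cmodM exprSr expr2 !ler_pM ?mulr_ge0 ?cmod_ge0.
rewrite (_ : 4 * S0 ^+ 3 = S0 ^+ 3 + S0 ^+ 3 + S0 ^+ 3 + S0 ^+ 3); last by ring.
rewrite (le_trans (cmodD _ _))// lerD//; last exact: c3.
rewrite (le_trans (cmodD _ _))// lerD//; last exact: c3.
by rewrite (le_trans (cmodD _ _))// lerD//; exact: c3.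
Qed.

End Interpolation.

(** * The stability estimate *)

Section Stability.
Variable R : realType.
Local Notation mT := (measurableTypeR R).
Local Notation T3 := (mT * mT * mT)%type.
Local Notation mu := (leb3 R).
Local Notation integrable3 h :=
  ((mu : {measure set T3 -> \bar R}).-integrable [set: T3] (EFin \o h)).

Lemma boundary_norm2_ge0 (r k : R) v : (0 <= boundary_norm2 r k v)%E.
Proof.
apply: integral_ge0 => th; rewrite /= in_itv/= => /andP[t0 tp].
apply: integral_ge0 => ph _; rewrite lee_fin mulr_ge0//; last first.
  by rewrite mulr_ge0 ?sqr_ge0// sin_ge0_pi// t0 tp.
have g0 u x : 0 <= @grad_norm2 R u x by apply: sumr_ge0 => i _; exact: sqr_ge0.
have k4 : 0 <= k ^+ 4 by rewrite -[4%N]/(2 * 2)%N exprM sqr_ge0.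
by rewrite !addr_ge0// mulr_ge0 ?addr_ge0 ?sqr_ge0.
Qed.

Lemma extend0_cube (r : R) f x : ~ cube r x -> extend0 r f x = 0.
Proof.
move=> nx; rewrite /extend0 patchE ifF//; apply/negbTE/negP; rewrite inE /ball3/= => xr.
by apply: nx => i; rewrite (le_trans (enorm_coord3 x i))// ltW.
Qed.

Lemma source_extend0 (rhat r Q : R) n f : 0 < r -> source_class rhat r n Q f ->
  [/\ measurable_fun [set: T3] (extend0 r f), integrable3 (extend0 r f),
      integrable3 (fun x => extend0 r f x ^+ 2) &
      L2norm2 (ball3 r) (cplx f) = (\int[mu]_x (extend0 r f x) ^+ 2)%:E].
Proof.
move=> r0 [sf _ _].
have [h [fL2 _ _]] : exists h, is_weak_deriv (ball3 r) (fun=> 0%N) (cplx f) h.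
  by apply: sf; rewrite /multi_order big1.
have [mf i2 L2] := L2_extend0 r0 fL2; split=> //.
by apply: (integrable_of_sqr (r := r)) => //; exact: extend0_cube.
Qed.

(** The largest of the three indices, [p], is up to the factor [om] a component of the frequency,
    and four derivatives in that direction yield [(om * p)^-4]. Passing from [p] to [m + 1 <= 2 * p]
    costs [16 = 2^4]; when [p = 0] the bound without derivatives serves. *)
Lemma source_coef_decay (rhat r Q : R) n f : 0 < rhat -> rhat < r -> (4 <= n)%N -> 0 < Q ->
  source_class rhat r n Q f -> forall i j k m, (m <= maxn i (maxn j k))%N ->
  `|\int[mu]_x (extend0 r f x * cos3 r i j k x)| <=
  2 * (Q * (1 + (2 * r) ^+ 3) * (1 + 16 / (pi / (2 * r)) ^+ 4)) / m.+1%:R ^+ 4.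
Proof.
move=> rh0 rhr n4 Q0 hf i j k m mM; have r0 := lt_trans rh0 rhr.
have [_ if1 _ _] := source_extend0 r0 hf.
set om := pi / (2 * r); have om0 : 0 < om by rewrite divr_gt0 ?pi_gt0// mulr_gt0.
set C := Q * (1 + (2 * r) ^+ 3).
have C0 : 0 <= C by rewrite mulr_ge0 ?(ltW Q0)// addr_ge0// exprn_ge0// mulr_ge0// ltW.
have m0 : (0 : R) < m.+1%:R ^+ 4 by rewrite exprn_gt0.
have A0 : 0 <= 16 / om ^+ 4 by rewrite divr_ge0// exprn_ge0// ltW.
rewrite -[X in _ <= X]mulrA; apply: cos3_coef_le => // s d s0 d1 e1 e2 e3.
have coord p : [|| p == i, p == j | p == k] -> exists l, `|s * coord3 l d| = om * p%:R.
  case/or3P => /eqP ->; [exists ord0|exists (lift ord0 ord0)|exists (lift ord0 (lift ord0 ord0))] => //.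
  by rewrite e1 ger0_norm// mulr_ge0// ltW.
have [w [w0 wC]] : exists w : R, (w = 1 \/ exists l, w = (s * coord3 l d) ^+ 4) /\
    forall v, w * v <= C -> 0 <= v -> v <= C * (1 + 16 / om ^+ 4) / m.+1%:R ^+ 4.
  pose p := maxn i (maxn j k).
  have [p0|p0] := posnP p.
    exists 1; split; [by left|move=> v vC v0]; have /eqP-> : m == 0%N by rewrite -leqn0 -p0.
    by rewrite expr1n divr1 -[v]mul1r (le_trans vC)// ler_peMr// lerDl.
  have [l hl] : exists l, `|s * coord3 l d| = om * p%:R.
    by apply: coord; rewrite /p; case: (leqP j k) => ?; case: (leqP i _) => ?; rewrite eqxx ?orbT.
  exists ((s * coord3 l d) ^+ 4); split; first by right; exists l.
  have -> : (s * coord3 l d) ^+ 4 = (om * p%:R) ^+ 4.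
    by rewrite -hl -normrX ger0_norm// -[4%N]/(2 * 2)%N exprM sqr_ge0.
  move=> v vC v0; rewrite ler_pdivlMr//.
  have mp : m.+1%:R <= 2 * p%:R :> R.
    by rewrite -natrM ler_nat mul2n -addnn (leq_trans (_ : m.+1 <= p.+1)%N)// -addn1 leq_add2l.
  have mp4 : m.+1%:R ^+ 4 <= (2 * p%:R) ^+ 4 :> R by rewrite lerXn2r ?nnegrE// mulr_ge0.
  have E (o q u : R) : 0 < o -> 16 / o ^+ 4 * ((o * q) ^+ 4 * u) = u * (2 * q) ^+ 4.
    by move=> o0; field; rewrite gt_eqF.
  apply: (@le_trans _ _ (v * (2 * p%:R) ^+ 4)); first by rewrite ler_wpM2l.
  rewrite -(E om)// mulrDr mulr1 [C * _]mulrC; apply: (le_trans (ler_wpM2l A0 vC)).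
  by rewrite lerDr.
have [hR hI] := source_transform_decay rh0 rhr n4 Q0 hf w0.
by split; apply: wC => //; exact: normr_ge0.
Qed.

Lemma coef_sum_le (N : nat) (t : nat -> nat -> nat -> R) (c : R) :
  (forall i j k, (i < N)%N -> (j < N)%N -> (k < N)%N -> t i j k <= c) ->
  cube_sum t N <= N%:R ^+ 3 * c.
Proof.
move=> h; rewrite /cube_sum.
have -> : N%:R ^+ 3 * c = \sum_(i < N) \sum_(j < N) \sum_(k < N) c.
  by rewrite !sumr_const !card_ord -!mulrnA -natrX mulr_natl !expnS expn0 muln1 mulnA.
by apply: ler_sum => i _; apply: ler_sum => j _; apply: ler_sum => k _; exact: h.
Qed.

(** Let [X] and [Y] be the integrals of [f ^+ 2] and [|f|]. The one-term case of [fourier_bound]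
    gives [X <= z + 3 * b * Y], while [Y <= t * V + X / t] for every [t > 0]; together they
    close. *)
Lemma source_L1_bounded (rhat r Q : R) n : 0 < rhat -> rhat < r -> (4 <= n)%N -> 0 < Q ->
  exists2 Y : R, 0 < Y & forall f, source_class rhat r n Q f -> \int[mu]_x `|extend0 r f x| <= Y.
Proof.
move=> rh0 rhr n4 Q0; have r0 := lt_trans rh0 rhr.
set B := 2 * (Q * (1 + (2 * r) ^+ 3) * (1 + 16 / (pi / (2 * r)) ^+ 4)).
have B0 : 0 < B.
  rewrite !mulr_gt0 ?ltr_wpDr// ?divr_ge0 ?exprn_ge0 ?mulr_ge0 ?divr_ge0 ?pi_ge0 ?(ltW r0)//.
  by rewrite invr_ge0 mulr_ge0 ?(ltW r0).
pose V := \int[mu]_x (\1_(cube r) x : R).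
have V0 : 0 <= V by apply: Rintegral_ge0 => x _; rewrite indicE.
pose b := B / r ^+ 3.
have b0 : 0 < b by rewrite divr_gt0// exprn_gt0.
(* Twice the coefficient [3 * b], so that exactly half of [Y] is absorbed. *)
pose t := 6 * b.
exists (2 * (t * V) + (r ^+ 3)^-1 * B ^+ 2 / (3 * b) + 1).
  have h1 : 0 <= 2 * (t * V) by apply: mulr_ge0 => //; apply: mulr_ge0 => //; rewrite mulr_ge0// ltW.
  have h2 : 0 <= (r ^+ 3)^-1 * B ^+ 2 / (3 * b).
    by rewrite divr_ge0 ?(mulr_ge0 _ (ltW b0))// mulr_ge0 ?sqr_ge0// invr_ge0 exprn_ge0// ltW.
  by rewrite ltr_wpDl// addr_ge0.
move=> f hf; have [mf if1 if2 _] := source_extend0 r0 hf.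
have hd := source_coef_decay rh0 rhr n4 Q0 hf.
have := fourier_bound r0 (ltW B0) mf (@extend0_cube r f) if2 hd 0%N.
set X := \int[mu]_x (extend0 r f x) ^+ 2; set Y := \int[mu]_x `|extend0 r f x|.
rewrite divr1 -/b.
have S1 : cube_sum (fun i j k => (\int[mu]_x (extend0 r f x * cos3 r i j k x)) ^+ 2) 1 <= B ^+ 2.
  rewrite -[B ^+ 2]mul1r -[X in X * _](expr1n R 3); apply: (@coef_sum_le 1%N) => i j k i1 j1 k1.
  rewrite -[X in X <= _]real_normK ?num_real// lerXn2r ?nnegrE ?normr_ge0 ?(ltW B0)//.
  by have := hd i j k 0%N (leq0n _); rewrite expr1n divr1.
have YX : Y <= t * V + X / t.
  have t0 : 0 < t by rewrite mulr_gt0.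
  rewrite /V /X [X in _ <= _ + X]mulrC -!Rintegral3Z//; last exact: cube_indic_integrable.
  rewrite -Rintegral3D//; last 2 first.
  - exact: (integrable3Z _ (@cube_indic_integrable R r)).
  - exact: integrable3Z.
  apply: (@le_Rintegral _ T3 R mu) => //; first exact: (integrable_norm if1).
    by apply: integrable3D; apply: integrable3Z => //; exact: cube_indic_integrable.
  move=> x _; have [xr|xr] := pselect (cube r x); last first.
    by rewrite extend0_cube// normr0 expr0n/= mulr0 addr0 mulr_ge0 ?(ltW t0)// indicE.
  rewrite indicE mem_set// mulr1 -[X in _ * X]real_normK ?num_real//.
  set a := `|_|; have a0 : 0 <= a := normr_ge0 _.
  rewrite -(ler_pM2l t0) mulrDr mulVKf ?gt_eqF//.
  have am (p q : R) : q * p <= q * q + p ^+ 2.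
    by clear; have := sqr_ge0 (p - q / 2); have := sqr_ge0 q; rewrite !expr2; lra.
  exact: am.
have r30 : 0 <= (r ^+ 3)^-1 by rewrite invr_ge0 exprn_ge0// ltW.
move=> hX; have hX2 := le_trans hX (lerD (ler_wpM2l r30 S1) (lexx _)).
have YE : t * Y <= t * (t * V) + X.
  have t0 : 0 < t by rewrite mulr_gt0.
  by rewrite (le_trans (ler_wpM2l (ltW t0) YX))// mulrDr [X / t]mulrC mulVKf ?gt_eqF.
have b30 : 0 < 3 * b by exact: mulr_gt0.
have : 3 * b * Y <= 3 * b * (2 * (t * V) + (r ^+ 3)^-1 * B ^+ 2 / (3 * b)).
  rewrite mulrDr [X in _ <= _ + X]mulrC divfK ?(gt_eqF b30)//.
  have lin (d x z v y : R) : 6 * d * y <= 6 * d * v + x -> x <= z + 3 * d * y ->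
      3 * d * y <= 3 * d * (2 * v) + z by clear; lra.
  exact: (lin b X _ (t * V) Y YE hX2).
by rewrite (ler_pM2l b30) => h; apply: (le_trans h); rewrite lerDl.
Qed.

Definition lagrange_weight (T del : R) n : R :=
  n.+1%:R * ((4 * T / del) ^+ n * expR n.+1%:R).

Definition taylor_tail (r T : R) n : R :=
  (6 * r * T) ^+ n.+1 / n.+1`!%:R * expR (3 * r * T).

(* At least node_density * T^2 nodes make the Taylor tail beat the Lagrange
   weights by a factor exp(-T). *)
Definition node_density (r del : R) : R :=
  1 + 6 * r * expR 3 * (1 + 4 / del) * expR (3 * r + 1).

(** With [N = n + 1] the product is at most [2 * (kap * T ^+ 2 / N) ^+ N * expR (3 * r * T)]. The
    three factors [expR N] gathered in [kap] come from [N <= expR N], from the weights and from the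
    factorial. The density makes the base at most [expR (- (3 * r + 1))], and [N >= T] finishes. *)
Lemma interp_error_le (r T del : R) n : 0 < r -> 1 <= T -> 0 < del ->
  node_density r del * T ^+ 2 <= n.+1%:R ->
  (1 + lagrange_weight T del n) * taylor_tail r T n <= 2 * expR (- T).
Proof.
rewrite /node_density /lagrange_weight /taylor_tail.
set kap := 6 * r * expR 3 * (1 + 4 / del).
set Lam := n.+1%:R * _; set err := _ / _ * expR _.
move=> r0 T1 del0 hN.
have T0 : 0 < T by rewrite (lt_le_trans _ T1).
pose N := n.+1; have N0 : (0 : R) < N%:R by [].
pose c := 1 + 4 / del; have d40 : 0 < 4 / del by rewrite divr_gt0.
have c0 : 0 < c by rewrite addr_gt0.
have kap0 : 0 < kap by rewrite !mulr_gt0// expR_gt0.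
(* [g] dominates both 1 and [4 * T / del], so that all powers can be raised to the same exponent
   [N]. *)
pose g := c * T; have g1 : 1 <= g.
  by rewrite -[1]mul1r ler_pM// /c lerDl ltW.
have g0 : 0 < g by rewrite (lt_le_trans _ g1).
have NeN : N%:R <= expR N%:R :> R by rewrite (le_trans _ (expR_ge1Dx _))// lerDr.
have eN1 : 1 <= expR N%:R :> R by rewrite -expR0 ler_expR.
have LamE : 1 + Lam <= 2 * (expR N%:R * (g ^+ N * expR N%:R)).
  have h1 : 1 <= expR N%:R * (g ^+ N * expR N%:R).
    have gN : 1 <= g ^+ N by rewrite exprn_ege1.
    by apply: mulr_ege1 => //; apply: mulr_ege1.
  have h2 : Lam <= expR N%:R * (g ^+ N * expR N%:R).
    rewrite /Lam; apply: ler_pM => //.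
      by rewrite mulr_ge0 ?expR_ge0// exprn_ge0// divr_ge0 ?mulr_ge0 ?(ltW T0) ?(ltW del0).
    rewrite ler_wpM2r ?expR_ge0//; apply: (@le_trans _ _ (g ^+ n)).
      rewrite lerXn2r ?nnegrE ?(ltW g0)// ?divr_ge0 ?mulr_ge0 ?(ltW T0) ?(ltW del0)//.
      by rewrite mulrAC ler_wpM2r ?(ltW T0)// /c lerDr.
    by rewrite exprS ler_peMl// exprn_ge0// ltW.
  by have := lerD h1 h2; lra.
have f0 : (0 : R) < N`!%:R by rewrite ltr0n fact_gt0.
have nf : N%:R ^+ N <= N`!%:R * expR N%:R :> R.
  have := expR_ge1Dxn n (ler0n R N).
  by move=> h; rewrite mulrC -ler_pdivrMr// (le_trans _ h)// lerDr.
have errE : err <= (6 * r * T) ^+ N * (expR N%:R / N%:R ^+ N) * expR (3 * r * T).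
  rewrite /err ler_wpM2r ?expR_ge0// ler_wpM2l ?exprn_ge0 ?mulr_ge0 ?(ltW r0) ?(ltW T0)//.
  by rewrite ler_pdivlMr ?exprn_gt0// mulrC ler_pdivrMr// mulrC.
have err0 : 0 <= err.
  by rewrite !mulr_ge0 ?expR_ge0 ?invr_ge0 ?exprn_ge0 ?mulr_ge0 ?(ltW r0) ?(ltW T0)// ltW.
have Lam0 : 0 <= 1 + Lam.
  by rewrite addr_ge0// !mulr_ge0 ?expR_ge0// exprn_ge0// divr_ge0 ?mulr_ge0 ?(ltW T0) ?(ltW del0).
apply: (le_trans (ler_pM Lam0 err0 LamE errE)).
have -> : 2 * (expR N%:R * (g ^+ N * expR N%:R)) *
    ((6 * r * T) ^+ N * (expR N%:R / N%:R ^+ N) * expR (3 * r * T)) =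
    2 * ((kap * T ^+ 2 / N%:R) ^+ N * expR (3 * r * T)).
  have -> : kap * T ^+ 2 / N%:R = expR 1 ^+ 3 * g * (6 * r * T) / N%:R.
    by rewrite -expRM_natl mulr1 /kap /g /c; field; rewrite !gt_eqF.
  have pE (u w v z : R) : (u * w * v / z) ^+ N = u ^+ N * w ^+ N * v ^+ N / z ^+ N.
    by rewrite !exprMn exprVn.
  have qE (u v w x y : R) : 2 * (u * (v * u)) * (w * (u / x) * y) = 2 * (u ^+ 3 * v * w / x * y).
    by ring.
  by rewrite pE exprAC -[expR 1 ^+ N]expRM_natl mulr1; exact: qE.
rewrite ler_pM2l//.
have q1 : kap * T ^+ 2 / N%:R <= expR (- (3 * r + 1)).
  rewrite ler_pdivrMr// expRN ler_pdivlMl ?expR_gt0//.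
  by apply: le_trans hN; rewrite mulrA [expR _ * _]mulrC ler_wpM2r ?sqr_ge0// lerDr.
have TN : T <= N%:R.
  apply: le_trans hN; apply: (@le_trans _ _ (T ^+ 2)); first by rewrite expr2 ler_peMl// ltW.
  by rewrite ler_peMl ?sqr_ge0// lerDl mulr_ge0 ?expR_ge0// ltW.
apply: (@le_trans _ _ (expR (- (3 * r + 1)) ^+ N * expR (3 * r * T))).
  have q0 : 0 <= kap * T ^+ 2 / N%:R by rewrite divr_ge0// mulr_ge0 ?sqr_ge0// (ltW kap0).
  by rewrite ler_wpM2r ?expR_ge0// lerXn2r ?nnegrE ?expR_ge0.
rewrite -expRM_natl -expRD ler_expR mulrN.
have r31 : 0 <= 3 * r + 1 by rewrite addr_ge0// mulr_ge0// ltW.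
by have := ler_wpM2r r31 TN; lra.
Qed.

Lemma natr_le_expR n : n%:R <= expR n%:R :> R.
Proof. by rewrite (le_trans _ (expR_ge1Dx _))// lerDr. Qed.

Lemma lagrange_weight_ge0 (T del : R) n : 0 < T -> 0 < del -> 0 <= lagrange_weight T del n.
Proof.
move=> T0 d0; rewrite mulr_ge0// mulr_ge0 ?expR_ge0// exprn_ge0// divr_ge0 ?(ltW d0)//.
by rewrite mulr_ge0// ltW.
Qed.

Lemma taylor_tail_ge0 (r T : R) n : 0 < r -> 0 < T -> 0 <= taylor_tail r T n.
Proof.
by move=> r0 T0; rewrite mulr_ge0 ?expR_ge0// divr_ge0// exprn_ge0// !mulr_ge0// ltW.
Qed.

(** Bounding [q ^+ n] by [expR (n * q)] discards a logarithm of [T]; with [n] of order [T ^+ 2] the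
    exponent becomes cubic. *)
Lemma lagrange_weight_le (T del : R) n : 0 < T -> 0 < del ->
  lagrange_weight T del n <= expR (n.+1%:R * (2 + 4 * T / del)).
Proof.
move=> T0 del0; set q := 4 * T / del.
have q0 : 0 <= q by rewrite divr_ge0 ?mulr_ge0 ?(ltW T0) ?(ltW del0).
have qE : q ^+ n <= expR (n.+1%:R * q).
  apply: (@le_trans _ _ (expR q ^+ n)).
    by rewrite lerXn2r ?nnegrE ?expR_ge0// (le_trans _ (expR_ge1Dx _))// lerDr.
  by rewrite -expRM_natl ler_expR ler_wpM2r// ler_nat.
have -> : n.+1%:R * (2 + q) = n.+1%:R + (n.+1%:R * q + n.+1%:R) by ring.
by rewrite !expRD /lagrange_weight ler_pM ?mulr_ge0 ?exprn_ge0 ?expR_ge0 ?natr_le_expR// ler_wpM2r ?expR_ge0.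
Qed.

(** For [k <= K] it exceeds the modulus of [k ^+ 2 + i * k * sigma]; being at least 1, it also
    bounds the fourth roots. *)
Definition root_radius (sigma K : R) : R := 1 + K ^+ 2 + K * sigma.
(** The separation [K / 4] of the wavenumbers, times [K] for their squares since two of them add up
    to at least [K], divided by the Lipschitz constant [4 * S0 ^+ 3] of the fourth power. *)
Definition root_gap (sigma K : R) : R := K ^+ 2 / (16 * root_radius sigma K ^+ 3).

(** The constant comes from [boundary_functional] at radius [S0] and does not depend on the number
    of nodes, which is fixed only after the truncation index of the cosine series. *)
Lemma interpolation_data (rhat r sigma K : R) : 0 < rhat -> rhat < r -> 0 < sigma -> 0 < K ->
  exists2 C : R, 0 < C & forall f (u : R -> pt3 R -> R[i]) (eps : R) n,
    closure [set x | extend0 r f x != 0] `<=` ball3 rhat ->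
    (forall k, 0 < k -> is_solution r sigma k f (u k)) -> 0 < eps ->
    (\int[@lebesgue_measure R]_(k in `]0%R, K[) boundary_norm2 r k (u k) <= (eps ^+ 2)%:E)%E ->
    exists s : nat -> R[i],
      [/\ forall j, (j <= n)%N -> cmod (s j) <= root_radius sigma K,
         forall i l, (i <= n)%N -> (l <= n)%N ->
           root_gap sigma K * (dist_nat i l)%:R / n.+1%:R <= cmod (s i - s l) &
         forall d j, enorm d = 1 -> (j <= n)%N ->
           let b := C * (Num.sqrt (8 * n.+1%:R / K) * eps) in
           `|\int[mu]_x (extend0 r f x * complex.Re (pw (s j) d x))| <= b /\
           `|\int[mu]_x (extend0 r f x * complex.Im (pw (s j) d x))| <= b].
Proof.
move=> rh0 rhr sig0 K0; set S0 := root_radius sigma K.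
have K20 : 0 < K ^+ 2 by rewrite exprn_gt0.
have Ks0 : 0 < K * sigma by rewrite mulr_gt0.
have S01 : 1 <= S0 by rewrite /S0 /root_radius -addrA lerDl addr_ge0// ltW.
have S00 : 0 < S0 by rewrite (lt_le_trans _ S01).
have [C C0 hC] := boundary_functional sigma rh0 rhr K0 (ltW S00).
exists C => // f u eps n hf hu e0 he.
have [k [kb ks]] := wavenumber_nodes n K0 e0 (fun k => boundary_norm2_ge0 r k (u k)) he.
pose Z j : R[i] := (k j ^+ 2)%:C%C + (0 +i* (k j * sigma))%C.
have [s sE] := choice (fun j => fourth_root (Z j)).
have n0 : (0 : R) < n.+1%:R by [].
have k0 j : (j <= n)%N -> 0 < k j by move=> /kb[h _ _]; rewrite (lt_le_trans _ h)// divr_gt0.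
have sS j : (j <= n)%N -> cmod (s j) <= S0.
  move=> jn; have [_ kK _] := kb j jn; have kp := k0 j jn.
  have ZS : cmod (Z j) < S0.
    apply: (le_lt_trans (cmod_le _)); rewrite ReD ImD /= addr0 add0r.
    rewrite !ger0_norm ?sqr_ge0 ?mulr_ge0 ?(ltW kp) ?(ltW sig0)//.
    have h1 : k j ^+ 2 <= K ^+ 2 by rewrite lerXn2r ?nnegrE ?(ltW kp) ?(ltW K0).
    have h2 : k j * sigma <= K * sigma by rewrite ler_wpM2r ?(ltW sig0).
    by rewrite /S0 /root_radius; lra.
  (* A root of modulus above [S0 >= 1] would have a fourth power at least as large as itself, hence
     larger than [S0]. *)
  rewrite leNgt; apply/negP => h; have h1 : 1 <= cmod (s j) by rewrite (le_trans S01)// ltW.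
  move: ZS; rewrite -sE ltNge => /negP; apply.
  rewrite !exprS expr0 mulr1 !cmodM (le_trans (ltW h))//.
  by rewrite ler_peMr ?cmod_ge0// !mulr_ege1.
exists s; split=> //.
  move=> i l il ln; have [ki _ _] := kb i il; have [kl _ _] := kb l ln.
  have sep := root_separation (sS i il) (sS l ln); rewrite !sE in sep.
  have h1 : `|k i - k l| * K <= cmod (Z i - Z l).
    apply: (le_trans _ (normRe_cmod _)); rewrite ReD ReN !ReD /= !addr0.
    rewrite subr_sqr normrM ler_wpM2l// ger0_norm ?addr_ge0 ?(ltW (k0 _ _))//; lra.
  have h2 := le_trans (ler_wpM2r (ltW K0) (ks i l il ln)) (le_trans h1 sep).
  have E (D N S X : R) : 0 < N -> 0 < S -> K / 4 * D / N * K <= 4 * S ^+ 3 * X ->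
      K ^+ 2 / (16 * S ^+ 3) * D / N <= X.
    clear => N0 S0; rewrite -ler_pdivrMl ?mulr_gt0 ?exprn_gt0//; apply: le_trans.
    by rewrite le_eqVlt; apply/orP; left; apply/eqP; field; rewrite !gt_eqF.
  exact: E h2.
move=> d j d1 jn b; have [ki _ kg] := kb j jn.
have eta0 : 0 < Num.sqrt (8 * n.+1%:R / K) * eps.
  by rewrite mulr_gt0// sqrtr_gt0 divr_gt0// mulr_gt0.
apply: (hC f (u (k j)) (k j) _ (s j) d ki (hu _ (k0 j jn)) hf (sE j) d1 (sS j jn) eta0).
by rewrite exprMn sqr_sqrtr// divr_ge0 ?(ltW K0)// mulr_ge0.
Qed.

(** Polynomial prefactors are absorbed, in the growing exponential by raising its rate and in the
    decaying one by giving up four powers; [256 = 4^4] comes from [expr_le_expR]. *)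
Lemma cube_log_tradeoff (m : nat) (c1 c2 w : R) : (0 < m)%N -> 0 <= c1 -> 0 <= c2 ->
  c1 * m%:R ^+ 3 * expR (w * m%:R ^+ 3) <= expR ((c1 + 1 + w) * m%:R ^+ 3) /\
  c2 * m%:R ^+ 3 * expR (- m%:R) <= 256 * c2 / m%:R.
Proof.
move=> m0 c10 c20; set x : R := m%:R; have x1 : 1 <= x by rewrite ler1n.
have x0 : 0 < x by rewrite (lt_le_trans _ x1).
have x3 : 1 <= x ^+ 3 by rewrite exprn_ege1.
have x30 : 0 <= x ^+ 3 by rewrite (le_trans _ x3).
split.
  rewrite !mulrDl !expRD ler_wpM2r ?expR_ge0// ler_pM//.
    by rewrite (le_trans _ (expR_ge1Dx _))// (le_trans (ler_peMr c10 x3))// ler_wpDl.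
  by rewrite (le_trans _ (expR_ge1Dx _))// mul1r lerDr.
have h := expr_le_expR 4 (ltW x0).
have E : x ^+ 3 * expR (- x) <= 256 / x.
  rewrite expRN ler_pdivrMr ?expR_gt0// mulrAC ler_pdivlMr// -exprSr (le_trans h)//.
  by rewrite ler_wpM2r ?expR_ge0// -natrX ler_nat.
by rewrite -mulrA (le_trans (ler_wpM2l c20 E))// mulrA [c2 * 256]mulrC.
Qed.

(** The length of a vector with three components of size at most [om * m], with [sqrt 3] rounded up
    to 2. *)
Lemma frequency_le (s om : R) d (i j k m : nat) : 0 <= s -> 0 <= om -> enorm d = 1 ->
  s * coord3 ord0 d = om * i%:R -> `|s * coord3 (lift ord0 ord0) d| = om * j%:R ->
  `|s * coord3 (lift ord0 (lift ord0 ord0)) d| = om * k%:R ->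
  (i <= m)%N -> (j <= m)%N -> (k <= m)%N -> s <= 2 * om * m%:R.
Proof.
move=> s0 om0 d1 e1 e2 e3 im jm km.
rewrite -(@ler_pXn2r _ 2)// ?nnegrE ?mulr_ge0//.
have -> : s ^+ 2 = (s * coord3 ord0 d) ^+ 2 + (s * coord3 (lift ord0 ord0) d) ^+ 2 +
    (s * coord3 (lift ord0 (lift ord0 ord0)) d) ^+ 2.
  rewrite !exprMn -!mulrDr (_ : _ + _ + _ = 1) ?mulr1//.
  by rewrite -[RHS](expr1n R 2) -d1 /enorm sqr_sqrtr// !addr_ge0// sqr_ge0.
rewrite e1 -[X in _ + X + _]real_normK ?num_real// e2 -[X in _ + _ + X]real_normK ?num_real// e3 !exprMn.
have le (q : nat) : (q <= m)%N -> om ^+ 2 * q%:R ^+ 2 <= om ^+ 2 * m%:R ^+ 2.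
  by move=> qm; rewrite ler_wpM2l ?sqr_ge0// lerXn2r ?nnegrE// ler_nat.
have [[h1 h2] h3] := (le i im, le j jm, le k km).
have h4 := mulr_ge0 (sqr_ge0 om) (sqr_ge0 (m%:R : R)); lra.
Qed.

(** The truncation index fixes everything else: [T] is a multiple of [M + 1] reaching all low
    frequencies, and the number of nodes is a multiple of [T ^+ 2]. The weights are then exponential
    in [(M + 1)^3], while the Taylor error and the series tail are at most of order
    [1 / (M + 1)]. *)
Lemma interpolation_stability (rhat r sigma K Q : R) n : 0 < rhat -> rhat < r ->
  0 < sigma -> 0 < K -> 0 < Q -> (4 <= n)%N ->
  exists a A : R, [/\ 0 <= a, 0 <= A & forall f (u : R -> pt3 R -> R[i]) (eps : R),
    source_class rhat r n Q f ->
    (forall k, 0 < k -> is_solution r sigma k f (u k)) -> 0 < eps ->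
    (\int[@lebesgue_measure R]_(k in `]0%R, K[) boundary_norm2 r k (u k) <= (eps ^+ 2)%:E)%E ->
    forall M : nat, \int[mu]_x (extend0 r f x) ^+ 2 <=
      expR (a * M.+1%:R ^+ 3) * eps ^+ 2 + A / M.+1%:R].
Proof.
move=> rh0 rhr sig0 K0 Q0 n4; have r0 := lt_trans rh0 rhr.
have [Y Y0 hY] := source_L1_bounded rh0 rhr n4 Q0.
have [C C0 hC] := interpolation_data rh0 rhr sig0 K0.
set om := pi / (2 * r); have om0 : 0 < om by rewrite divr_gt0 ?pi_gt0// mulr_gt0.
set B := 2 * (Q * (1 + (2 * r) ^+ 3) * (1 + 16 / om ^+ 4)).
have B0 : 0 <= B.
  have h1 : 0 <= (2 * r) ^+ 3 by rewrite exprn_ge0// mulr_ge0// ltW.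
  have h2 : 0 <= 16 / om ^+ 4 by rewrite divr_ge0// exprn_ge0// ltW.
  by rewrite mulr_ge0// mulr_ge0 ?addr_ge0// mulr_ge0 ?addr_ge0// ltW.
set S0 := root_radius sigma K.
have K20 : 0 < K ^+ 2 by rewrite exprn_gt0.
have Ks0 : 0 < K * sigma by rewrite mulr_gt0.
have S01 : 1 <= S0 by rewrite /S0 /root_radius -addrA lerDl addr_ge0// ltW.
have S00 : 0 < S0 by rewrite (lt_le_trans _ S01).
set del := root_gap sigma K.
have del0 : 0 < del by rewrite divr_gt0// mulr_gt0// exprn_gt0.
rewrite -/S0 -/del in hC; clearbody S0 del.
(* The three terms make [T] dominate [m], the frequencies [2 * om * m] and the moduli of the
   nodes. *)
pose cT := 1 + 2 * om + S0.
have om20 : 0 <= 2 * om := mulr_ge0 (ler0n R 2) (ltW om0).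
have cT1 : 1 <= cT by rewrite /cT -addrA lerDl; exact: addr_ge0 om20 (ltW S00).
have cT0 : 0 < cT by rewrite (lt_le_trans _ cT1).
have [nd nd0 ndE] : exists2 nd : R, 0 <= nd & nd = node_density r del.
  exists (node_density r del) => //; rewrite /node_density addr_ge0// mulr_ge0 ?expR_ge0//.
  rewrite mulr_ge0 ?addr_ge0 ?divr_ge0 ?(ltW del0)// mulr_ge0 ?expR_ge0//.
  by rewrite mulr_ge0// ltW.
(* The rate of the weights: at most [(nd + 1) * T ^+ 2] nodes, each costing at most
   [(2 + 4 / del) * T]. *)
pose w := (nd + 1) * (2 + 4 / del) * cT ^+ 3.
have ir30 : 0 <= (r ^+ 3)^-1 by rewrite invr_ge0 exprn_ge0// ltW.
pose c1 := (r ^+ 3)^-1 * (8 * (2 * C) ^+ 2 * (8 / K)).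
pose c2 := (r ^+ 3)^-1 * (32 * Y ^+ 2).
have c10 : 0 <= c1.
  by rewrite mulr_ge0// mulr_ge0 ?divr_ge0 ?(ltW K0)// mulr_ge0 ?sqr_ge0.
have c20 : 0 <= c2 by rewrite mulr_ge0// mulr_ge0 ?sqr_ge0.
have w0 : 0 <= w.
  rewrite mulr_ge0 ?exprn_ge0 ?(ltW cT0)// mulr_ge0 ?addr_ge0 ?divr_ge0 ?(ltW del0)//.
have q0 : 0 <= B / r ^+ 3 by rewrite mulr_ge0.
exists (c1 + 1 + 3 * w), (256 * c2 + 3 * (B / r ^+ 3) * Y); split.
- by rewrite !addr_ge0// mulr_ge0.
- apply: addr_ge0; first exact: mulr_ge0 (ler0n R 256) c20.
  exact: mulr_ge0 (mulr_ge0 (ler0n R 3) q0) (ltW Y0).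
move=> f u eps hf hu e0 he M; set m : R := M.+1%:R.
have m1 : 1 <= m by rewrite ler1n.
have m0 : 0 < m by [].
have [mf if1 if2 _] := source_extend0 r0 hf.
pose T := cT * m.
have mT : m <= T by rewrite /T ler_peMl// ltW.
have T1 : 1 <= T by exact: le_trans mT.
have T0 : 0 < T by rewrite (lt_le_trans _ T1).
have ST : S0 <= T.
  by rewrite -[S0]mulr1 /T ler_pM// ?(ltW S00)// /cT lerDr; exact: addr_ge0 ler01 om20.
have omT : 2 * om * m <= T.
  by rewrite /T ler_wpM2r ?(ltW m0)// /cT -addrA [2 * om + _]addrC addrA lerDr; exact: addr_ge0 ler01 (ltW S00).
(* There are [p + 1] nodes: at least [nd * T ^+ 2], as [interp_error_le] asks, and at most one more
   than that. *)
pose p := Num.truncn (nd * T ^+ 2).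
have ndp : nd * T ^+ 2 <= p.+1%:R by rewrite ltW// truncnS_gt.
have T21 : 1 <= T ^+ 2 by rewrite exprn_ege1.
have pnd : p.+1%:R <= (nd + 1) * T ^+ 2.
  by rewrite -natr1 mulrDl mul1r lerD// truncn_le// mulr_ge0// sqr_ge0.
pose N : R := p.+1%:R; have N0 : 0 < N by [].
pose Lam := lagrange_weight T del p.
pose err := taylor_tail r T p.
have wE : w * m ^+ 3 = (nd + 1) * (2 + 4 / del) * T ^+ 3 by rewrite /w -mulrA -exprMn.
have LamE : Lam <= expR (w * m ^+ 3).
  apply: (le_trans (lagrange_weight_le p T0 del0)); rewrite ler_expR.
  have d40 : 0 <= 4 / del by rewrite divr_ge0// ltW.
  have h1 : 2 + 4 * T / del <= (2 + 4 / del) * T.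
    have hq (q : R) : 2 + q * T <= (2 + q) * T by rewrite [leRHS]mulrDl lerD2r ler_peMr.
    by rewrite [4 * T / del]mulrAC.
  have h2 : 0 <= 2 + 4 * T / del by rewrite mulrAC addr_ge0// mulr_ge0// ltW.
  apply: (le_trans (ler_pM (ltW N0) h2 pnd h1)).
  by rewrite wE le_eqVlt; apply/orP; left; apply/eqP; ring.
have Lam0 : 0 <= Lam := lagrange_weight_ge0 p T0 del0.
have NLam : N <= expR (w * m ^+ 3).
  apply: (le_trans (natr_le_expR _)); rewrite ler_expR (le_trans pnd)// wE -mulrA.
  have nd1 : 0 <= nd + 1 := addr_ge0 nd0 ler01.
  have d2 : 1 <= 2 + 4 / del.
    by apply: ler_wpDr; [rewrite divr_ge0// ltW|rewrite ler1n].
  have E (q x : R) : q * x ^+ 3 = q * x * x ^+ 2 by clear; ring.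
  apply: (ler_wpM2l nd1); rewrite E; apply: ler_peMl; first exact: sqr_ge0.
  exact: mulr_ege1.
have errE : (1 + Lam) * err <= 2 * expR (- T) by apply: interp_error_le => //; rewrite -ndE.
have err0 : 0 <= (1 + Lam) * err := mulr_ge0 (addr_ge0 ler01 Lam0) (taylor_tail_ge0 p r0 T0).
have [s [sS sep data]] := hC f u eps p (let: And3 _ _ h := hf in h) hu e0 he.
pose b := C * (Num.sqrt (8 * N / K) * eps).
have b0 : 0 <= b := mulr_ge0 (ltW C0) (mulr_ge0 (sqrtr_ge0 _) (ltW e0)).
pose tot := Lam * (2 * b) + 2 * expR (- T) * Y.
have IY0 : 0 <= \int[mu]_x `|extend0 r f x| by apply: Rintegral_ge0.
have tot0 : 0 <= tot.
  apply: addr_ge0; first by rewrite mulr_ge0// mulr_ge0.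
  by rewrite mulr_ge0 ?(ltW Y0)// mulr_ge0 ?expR_ge0.
have coef i j k : (i < M.+1)%N -> (j < M.+1)%N -> (k < M.+1)%N ->
    `|\int[mu]_x (extend0 r f x * cos3 r i j k x)| <= 2 * tot.
  move=> iM jM kM; apply: cos3_coef_le => // xi d xi0 d1 e1 e2 e3.
  have xiT : `|xi| <= T.
    rewrite ger0_norm//; apply: le_trans omT.
    exact: (frequency_le xi0 (ltW om0) d1 e1 e2 e3 (ltnW iM) (ltnW jM) (ltnW kM)).
  have := interp_transform r0 T0 del0 b0 if1 (@extend0_cube r f) d1 xiT
    (fun j jp => le_trans (sS j jp) ST) sep (fun j jp => data d j d1 jp).
  rewrite -/(lagrange_weight T del p) -/(taylor_tail r T p) -/Lam -/err.
  have le : Lam * (2 * b) + (1 + Lam) * err * \int[mu]_x `|extend0 r f x| <= tot.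
    by rewrite lerD2l ler_pM// hY.
  by move=> [h1 h2]; split; [exact: le_trans h1 le|exact: le_trans h2 le].
have hd := source_coef_decay rh0 rhr n4 Q0 hf.
apply: (le_trans (fourier_bound r0 B0 mf (@extend0_cube r f) if2 hd M)).
have sq i j k : (i < M.+1)%N -> (j < M.+1)%N -> (k < M.+1)%N ->
    (\int[mu]_x (extend0 r f x * cos3 r i j k x)) ^+ 2 <= (2 * tot) ^+ 2.
  move=> iM jM kM; rewrite -[X in X <= _]real_normK ?num_real//.
  by rewrite lerXn2r ?nnegrE ?normr_ge0 ?mulr_ge0// coef.
have [t1 t2] := cube_log_tradeoff (3 * w) (ltn0Sn M) c10 c20.
have b2 : b ^+ 2 = C ^+ 2 * (8 * N / K) * eps ^+ 2.
  by rewrite /b !exprMn sqr_sqrtr ?mulrA// divr_ge0 ?mulr_ge0 ?(ltW K0).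
have tot2 : (2 * tot) ^+ 2 <= 8 * (Lam * (2 * b)) ^+ 2 + 32 * Y ^+ 2 * expR (- m).
  have em : expR (- T) ^+ 2 <= expR (- m).
    by rewrite expr2 -expRD ler_expR -opprD lerN2 (le_trans mT)// lerDl ltW.
  have sqD (x y : R) : (2 * (x + y)) ^+ 2 <= 8 * x ^+ 2 + 8 * y ^+ 2.
    by rewrite -subr_ge0 (_ : _ - _ = (2 * (x - y)) ^+ 2) ?sqr_ge0//; ring.
  apply: (le_trans (sqD _ _)); rewrite lerD2l.
  have -> : 8 * (2 * expR (- T) * Y) ^+ 2 = 32 * Y ^+ 2 * expR (- T) ^+ 2 by ring.
  by rewrite ler_wpM2l// mulr_ge0 ?sqr_ge0.
(* Two factors [Lam] and the factor [N] from the pigeonhole bound are each at most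
   [expR (w * m ^+ 3)], hence the rate [3 * w]. *)
have Lb : 8 * (Lam * (2 * b)) ^+ 2 <= 8 * (2 * C) ^+ 2 * (8 / K) * expR (3 * w * m ^+ 3) * eps ^+ 2.
  have E (L y c k v e : R) : y ^+ 2 = c ^+ 2 * (8 * v / k) * e ^+ 2 ->
      8 * (L * (2 * y)) ^+ 2 = 8 * (2 * c) ^+ 2 * (8 / k) * (L ^+ 2 * v) * e ^+ 2.
    by clear=> h; transitivity (32 * L ^+ 2 * y ^+ 2); [ring|rewrite h; ring].
  have -> : 8 * (Lam * (2 * b)) ^+ 2 = 8 * (2 * C) ^+ 2 * (8 / K) * (Lam ^+ 2 * N) * eps ^+ 2.
    exact: E b2.
  rewrite ler_wpM2r ?sqr_ge0// ler_wpM2l//.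
    by rewrite mulr_ge0 ?divr_ge0 ?(ltW K0)// mulr_ge0 ?sqr_ge0.
  have -> : 3 * w * m ^+ 3 = w * m ^+ 3 + w * m ^+ 3 + w * m ^+ 3 by ring.
  by rewrite !expRD expr2; apply: ler_pM; [exact: mulr_ge0|exact: ltW|exact: ler_pM|exact: NLam].
have hsum := coef_sum_le sq.
have m30 : 0 <= m ^+ 3 by rewrite exprn_ge0// ltW.
have h1 : (r ^+ 3)^-1 * cube_sum (fun i j k => (\int[mu]_x (extend0 r f x * cos3 r i j k x)) ^+ 2) M.+1
    <= expR ((c1 + 1 + 3 * w) * m ^+ 3) * eps ^+ 2 + 256 * c2 / m.
  apply: (le_trans (ler_wpM2l ir30 (le_trans hsum (ler_wpM2l m30 (le_trans tot2 (lerD Lb (lexx _))))))).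
  have -> : forall x y e z k v, x * (m ^+ 3 * (y * e * z + k * v)) =
     x * y * m ^+ 3 * e * z + x * k * m ^+ 3 * v by move=> *; ring.
  by rewrite lerD// ler_wpM2r ?sqr_ge0.
have h2 : 3 * (B / r ^+ 3) / m * \int[mu]_x `|extend0 r f x| <= 3 * (B / r ^+ 3) * Y / m.
  by rewrite mulrAC ler_wpM2r ?invr_ge0 ?(ltW m0)// ler_wpM2l ?hY// mulr_ge0.
have -> : (256 * c2 + 3 * (B / r ^+ 3) * Y) / m = 256 * c2 / m + 3 * (B / r ^+ 3) * Y / m.
  exact: mulrDl.
by rewrite addrA; exact: lerD.
Qed.

(** Here [eps ^+ 2 = expR (- 2 * expR y)]. The lower bound on [y] keeps [a * (M + 1)^3], at most
    [8 * a * y ^+ q], below [expR y]; one factor [expR (- expR y)] is left and beats every power of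
    [y]. *)
Lemma log_log_choice (a A y eps X : R) n : 0 <= a -> 0 <= A ->
  1 + 8 * a * (3 * n.+1).+1%:R ^+ (3 * n.+1).+1 <= y -> eps = expR (- expR y) ->
  (forall M : nat, X <= expR (a * M.+1%:R ^+ 3) * eps ^+ 2 + A / M.+1%:R) ->
  X <= (n.+1%:R ^+ n.+1 + A) / y ^+ n.+1.
Proof.
move=> a0 A0; set q := (3 * n.+1)%N; set cq : R := q.+1%:R ^+ q.+1 => yb -> hX.
have cq0 : 0 <= cq by rewrite exprn_ge0.
have y1 : 1 <= y by rewrite (le_trans _ yb)// lerDl; exact: mulr_ge0 (mulr_ge0 (ler0n R 8) a0) cq0.
have y0 : 0 < y by rewrite (lt_le_trans _ y1).
have ya : 8 * a * cq <= y by rewrite (le_trans _ yb)// lerDr.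
set z := y ^+ n.+1; have z1 : 1 <= z by rewrite exprn_ege1.
have z0 : 0 < z by rewrite (lt_le_trans _ z1).
apply: (le_trans (hX (Num.truncn z))); set M := Num.truncn z.
have zM : z <= M.+1%:R by rewrite ltW// truncnS_gt.
have Mz : M.+1%:R <= 2 * z.
  by rewrite -natr1 (_ : 2 * z = z + z) ?lerD ?truncn_le ?(ltW z0)//; ring.
have ae : a * M.+1%:R ^+ 3 <= expR y.
  apply: (@le_trans _ _ (8 * a * y ^+ q)).
    have -> : 8 * a * y ^+ q = a * (2 * z) ^+ 3 by rewrite exprMn /z -exprM mulnC -/q; ring.
    by rewrite ler_wpM2l// lerXn2r ?nnegrE ?mulr_ge0 ?(ltW z0).
  (* One more power than needed is compared with [expR y], and the spare factor [y] pays for the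
     constant [8 * a * cq]. *)
  have yq : y ^+ q.+1 = y ^+ q * y := exprSr y q.
  rewrite -(ler_pM2r y0) -[X in X <= _](mulrA (8 * a)) -yq.
  have h := expr_le_expR q.+1 (ltW y0).
  have a80 : 0 <= 8 * a by rewrite mulr_ge0.
  apply: (le_trans (ler_wpM2l a80 h)); rewrite -/cq mulrA [expR y * y]mulrC.
  by rewrite ler_wpM2r ?expR_ge0.
rewrite mulrDl lerD//; last first.
  by rewrite ler_wpM2l// lef_pV2 ?posrE.
rewrite ler_pdivlMr// -expRM_natl -expRD.
apply: (@le_trans _ _ (expR (- expR y) * z)).
  by rewrite ler_wpM2r ?(ltW z0)// ler_expR; lra.
rewrite expRN mulrC ler_pdivrMr ?expR_gt0// (le_trans (expr_le_expR n.+1 (ltW y0)))//.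
by rewrite ler_wpM2l ?exprn_ge0// ler_expR (le_trans _ (expR_ge1Dx _))// lerDr.
Qed.

End Stability.

Theorem theorem3p6 (R : realType) (rhat r : R) (n : nat)
    (rhat_gt0 : 0 < rhat) (rhat_lt_r : rhat < r) (n_ge4 : (4 <= n)%N) :
  exists C' C : R, [/\ 0 < C', 0 < C &
    forall sigma Q K : R, 0 < sigma -> 0 < Q -> 0 < K ->
    exists eps0 : R, 0 < eps0 < expR (- 1) /\
      forall (f : pt3 R -> R) (u : R -> pt3 R -> R[i]),
        source_class rhat r n Q f ->
        (forall k : R, 0 < k -> is_solution r sigma k f (u k)) ->
        forall eps : R, 0 < eps < eps0 ->
        (eps ^+ 2)%:E =
          (\int[@lebesgue_measure R]_(k in `]0%R, K[)
             boundary_norm2 r k (u k))%E ->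
        (L2norm2 (ball3 r) (cplx f) <=
          (C' * expR (C * sigma ^+ 2) *
           (eps ^+ 2 +
            Q ^+ 2 / (K `^ (2^-1 * (n%:R - 3)) *
                      ln `|ln eps| `^ (2^-1 * (n%:R - 3)))))%:E)%E].
Proof.
exists 1, 1; split=> // sigma Q K sig0 Q0 K0.
have [a [A [a0 A0 hX]]] := interpolation_stability rhat_gt0 rhat_lt_r sig0 K0 Q0 n_ge4.
have r0 := lt_trans rhat_gt0 rhat_lt_r.
set p : R := 2^-1 * (n%:R - 3).
have pn : p <= n%:R.
  have : 3 <= n%:R :> R by rewrite ler_nat ltnW.
  by rewrite /p; lra.
pose D : R := n.+1%:R ^+ n.+1 + A.
have Kp0 : 0 < K `^ p by rewrite powR_gt0.
have D0 : 0 <= D by rewrite addr_ge0// exprn_ge0.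
(* The threshold forces [1 + c + e < y]. Here 1 permits comparing powers of [y], [c] is the
   condition of [log_log_choice], and [e] below absorbs the constant of the bound. *)
pose c : R := 8 * a * (3 * n.+1).+1%:R ^+ (3 * n.+1).+1.
have c0 : 0 <= c by rewrite mulr_ge0 ?exprn_ge0// mulr_ge0.
pose e := D * K `^ p / Q ^+ 2.
have e0 : 0 <= e by rewrite divr_ge0 ?sqr_ge0// mulr_ge0// ltW.
exists (expR (- expR (1 + c + e))); split.
  rewrite expR_gt0 ltr_expR ltrN2 (lt_le_trans _ (expR_ge1Dx _))//; lra.
move=> f u hf hu eps /andP[eps0 epsle] epsE.
have [_ _ _ ->] := source_extend0 r0 hf.
rewrite lee_fin; set X := Rintegral _ _ _.
have lnb : expR (1 + c + e) < - ln eps.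
  by rewrite ltrNr -ltr_expR lnK ?posrE.
have lnn : `|ln eps| = - ln eps.
  by rewrite ltr0_norm// -oppr_gt0 (lt_trans (expR_gt0 _) lnb).
rewrite lnn; set y := ln (- ln eps).
have ey : expR y = - ln eps by rewrite lnK// posrE (lt_trans (expR_gt0 _) lnb).
have yb : 1 + c + e < y by rewrite -ltr_expR ey.
have y1 : 1 <= y by rewrite (le_trans _ (ltW yb))// -addrA lerDl; exact: addr_ge0.
have y0 : 0 < y := lt_le_trans ltr01 y1.
have epsy : eps = expR (- expR y) by rewrite ey opprK lnK ?posrE.
have le1 : X <= D / y ^+ n.+1.
  apply: (log_log_choice a0 A0 _ epsy); first by rewrite -/c (le_trans _ (ltW yb))// lerDl.
  by apply: (hX f u eps hf hu eps0); rewrite epsE.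
have yp0 : 0 < y `^ p by rewrite powR_gt0.
(* In [y ^+ n.+1 = y * y ^+ n] one factor [y] exceeds [D * K ^ p / Q ^+ 2], and [y ^+ n] dominates
   [y ^ p] since [p <= n] and [y >= 1]. This brings the multiplicative constant down to 1. *)
have le2 : D / y ^+ n.+1 <= Q ^+ 2 / (K `^ p * y `^ p).
  have E (d k q z v w : R) : 0 <= d -> 0 < k -> 0 < q -> 0 < z -> 0 < v ->
      d * k / q <= z -> v <= w -> d / (z * w) <= q / (k * v).
    move=> d0 k0 q0 z0 v0; rewrite ler_pdivrMr// => h vw.
    have w0 := lt_le_trans v0 vw.
    rewrite ler_pdivrMr ?mulr_gt0// mulrAC ler_pdivlMr ?mulr_gt0//.
    rewrite (mulrA d) (mulrA q) (mulrC q); apply: ler_pM => //; last exact: ltW.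
    by rewrite mulr_ge0// ltW.
  rewrite exprS; apply: E => //; first exact: exprn_gt0.
    by rewrite -/e (le_trans _ (ltW yb))// lerDr; exact: addr_ge0.
  by rewrite -powR_mulrn ?(ltW y0)// ler_powR.
rewrite (le_trans le1)// (le_trans le2)// mul1r mul1r.
set w := Q ^+ 2 / _; have w0 : 0 <= w by rewrite divr_ge0 ?sqr_ge0// mulr_ge0 ?powR_ge0.
rewrite (@le_trans _ _ (eps ^+ 2 + w))//; first by rewrite lerDr sqr_ge0.
rewrite ler_peMl ?addr_ge0 ?sqr_ge0//.
by rewrite (le_trans _ (expR_ge1Dx _))// lerDl sqr_ge0.
Qed.
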